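(* Let $\Lambda$ be a non-extremal unimodular lattice (odd or even) of dimension $n$ with $16\leq n\leq 23$ that contains no vector of norm $1$. Then the secrecy gain of $\Lambda$ is achieved at $\tau=i$, i.e. the secrecy function $\Xi_\Lambda$ attains its maximum at $\tau=i$, and $$\chi_{\Lambda}=\frac{1}{1-\frac{2n}{2^6}+\frac{2n(n-23)+K(\Lambda)}{2^{12}}},$$ where $K(\Lambda)$ denotes the kissing number of $\Lambda$.
   Context: A lattice $\Lambda\subset\mathbb{R}^n$ of dimension $n$ is unimodular if it equals its dual $\Lambda^*=\{\mathbf{x}\in\mathbb{R}^n:\mathbf{x}\cdot\lambda\in\mathbb{Z}\ \text{for all } \lambda\in\Lambda\}$. The norm of a vector is its squared length $\mathbf{x}\cdot\mathbf{x}$. A unimodular lattice is even if all its vectors have even norm, and odd otherwise. A lattice of dimension $n$ is called extremal if its minimal nonzero norm is $\lfloor n/8\rfloor+1$ (so $3$ for $16\le n\le 23$). The kissing number of a lattice is the number of its vectors of minimal nonzero norm; for the lattices in the claim this is the number of vectors of norm $2$. For $\tau$ in the upper half plane let $q=e^{\pi i\tau}$, $\Theta_\Lambda(\tau)=\sum_{\lambda\in\Lambda}q^{\lambda\cdot\lambda}$ and $\vartheta_3(\tau)=\Theta_{\mathbb{Z}}(\tau)=\sum_{m\in\mathbb{Z}}q^{m^2}$. The secrecy function of an $n$-dimensional unimodular lattice is $\Xi_\Lambda(\tau)=\vartheta_3^n(\tau)/\Theta_\Lambda(\tau)$, considered for $\tau=yi$ with $y>0$, and the secrecy gain $\chi_\Lambda$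 is the maximal value of $\Xi_\Lambda(yi)$ over $y>0$. *)

(* Defs.v *)
From mathcomp Require Import all_boot all_order all_algebra finmap.
From mathcomp Require Import all_classical all_reals all_analysis.
Set Implicit Arguments.
Unset Strict Implicit.
Unset Printing Implicit Defensive.
Import Order.TTheory GRing.Theory Num.Theory.
Local Open Scope classical_set_scope.
Local Open Scope ring_scope.

Section Lattices.
Context {R : realType} {n : nat}.
Implicit Types (x y : 'rV[R]_n) (L : set 'rV[R]_n).

Definition dotp x y : R := \sum_(i < n) x 0 i * y 0 i.

(* The norm of a vector is its squared length. *)
Definition sqnorm x : R := dotp x x.

(* Full-dimensional lattices: integer combinations of the rows of an
   invertible matrix. *)
Definition lattice L : Prop :=
  exists2 B : 'M[R]_n, B \in unitmx &
    L = [set map_mx intr z *m B | z in [set: 'rV[int]_n]].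

Definition dual L : set 'rV[R]_n :=
  [set x | forall l, L l -> dotp x l \is a Num.int].

Definition unimodular L : Prop := lattice L /\ L = dual L.

Definition minimal_vectors L : set 'rV[R]_n :=
  [set x | [/\ L x, x != 0 &
    forall y, L y -> y != 0 -> sqnorm x <= sqnorm y]].

Definition is_minimal_norm L (m : R) : Prop :=
  exists2 x, minimal_vectors L x & sqnorm x = m.

Definition extremal L : Prop := is_minimal_norm L ((n %/ 8).+1)%:R.

(* fset_set A is empty when A is infinite, but a lattice has only finitely
   many minimal vectors. *)
Definition kissing_number L : nat := #|` fset_set (minimal_vectors L)|%fset.

End Lattices.

Section Secrecy.
Context {R : realType}.
Implicit Types (y : R).

(* All functions of tau below are restricted to the imaginary half-axis
   tau = y * i with y > 0, and take y as argument (so tau = i is y = 1).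
   There q = e^(pi i tau) = e^(- pi y), a real number in ]0, 1[. *)
Definition nome y : R := expR (- (pi * y)).

(* The series below have nonnegative terms, so their unordered sums make sense
   in \bar R; for y > 0 (and L a lattice) they are finite, hence fine is
   harmless. *)
Definition theta n (L : set 'rV[R]_n) y : R :=
  fine (\esum_(x in L) (nome y `^ sqnorm x)%:E).

Definition theta3 y : R :=
  fine (\esum_(m in [set: int]) (nome y ^ (m ^+ 2))%:E).

Definition secrecy_function n (L : set 'rV[R]_n) y : R :=
  theta3 y ^+ n / theta L y.

Definition secrecy_gain n (L : set 'rV[R]_n) : R :=
  sup [set secrecy_function L y | y in [set y | 0 < y]].

End Secrecy.

(* Main.v *)
(** The theta series of L is a modular form of weight n/2, so for n < 24 it is
    a combination of three products of theta constants,
    theta3^n - 2n theta3^(n-8) D + a2 theta3^(n-16) D^2 with D = (theta2 theta4)^4 / 16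
    and a2 = 2n(n-23) + K.  With z = D / theta3^8 this reads
    1/Xi = 1 - 2nz + a2 z^2, and Jacobi's theta3^4 = theta2^4 + theta4^4 gives
    0 <= z <= 1/64 with equality at tau = i.  The quadratic decreases on [0, 1/64]
    as soon as a2 <= 64n, i.e. K <= 2n(55-n), which is a root-system estimate:
    two roots with inner product 1 have at most 107-2n common neighbours.

    The functional equations come from Poisson summation, proved for Gaussians by
    Polya's limit of binomial coefficients and transported to L through the
    residue classes of an orthogonal frame contained in 2L.  Membership of the
    theta series in the expected space is proved without the theory of modular
    forms: the difference G of the two sides satisfies G = O(q^3), the product of
    its three transforms under the theta group is invariant under the full
    modular group, and a maximum modulus argument on a fundamental domain shows
    that a form vanishing to such an order is zero.  On the unit disk "analytic"
    means locally uniform limit of polynomials, which suffices here.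

    K > 0 because K = 0 would give a positive number of vectors of norm 3, making
    L extremal. *)

Require Import Defs.
From HB Require Import structures.
From mathcomp Require Import all_boot all_order all_algebra finmap.
From mathcomp Require Import all_classical all_reals all_analysis.
From mathcomp Require Import complex.
From mathcomp Require Import ring lra zify.
Set Implicit Arguments.
Unset Strict Implicit.
Unset Printing Implicit Defensive.
Import Order.TTheory GRing.Theory Num.Theory ComplexField.Normc.
Import numFieldNormedType.Exports.
Local Open Scope ring_scope.


(** * Complex modulus and exponential *)

(** The weight n/2 is half-integral for odd n. Functional equations on the half-axis are therefore
    squared before they are continued, and afterwards only moduli are kept, which removes all
    multipliers. One fact lost in this way has to be recovered: the norms of the shadow are n/4 mod
    2. It is obtained by adding the known form theta3^n to the theta series, so that the relative
    phase of the two summands shows in a modulus. The product of the three transforms has weight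
    3n/2, so if nonzero it would have order at most n/8 at the cusp, in terms of e^(2 pi i tau). Two
    factors O(q^3) contribute 3 and the third carries q^((n-16)/4), which makes at least n/8 + 1.
    This surplus of one is what makes the invariant function contract by a fixed factor. The bound
    on K comes from a trace inequality (2K)^2 <= n K (8 + 2 (216 - 4n)), whose bracket bounds the
    sum of squared inner products of one root with all roots; 216 - 4n = 2 + 2 (107 - 2n) bounds the
    number of roots having product 1 with a given one. *)

Section ComplexTools.
Context {R : realType}.
Local Notation C := R[i].
Implicit Types (z w : C) (x y : R).

Lemma normc_ge0 z : 0 <= normc z.
Proof. by case: z => a b; exact: sqrtr_ge0. Qed.

Lemma normcX z n : normc (z ^+ n) = normc z ^+ n.
Proof. by elim: n => [|n ih]; rewrite ?expr0 ?normc1// !exprS normcM ih. Qed.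

Lemma normc_real x : normc (x%:C)%C = `|x|.
Proof. by rewrite /= expr0n /= addr0 sqrtr_sqr. Qed.

Lemma normc_sum (I : Type) (s : seq I) (P : pred I) (F : I -> C) :
  normc (\sum_(i <- s | P i) F i) <= \sum_(i <- s | P i) normc (F i).
Proof.
elim/big_rec2: _ => [|i y x _ h]; first by rewrite normc0.
by rewrite (le_trans (le_normcD _ _))// lerD2l.
Qed.

Lemma normc_sqr z : (normc z ^+ 2)%:C%C = z * (z^*)%C.
Proof.
case: z => a b /=; rewrite sqr_sqrtr ?addr_ge0 ?sqr_ge0//.
by apply/eqP; rewrite eq_complex /=; apply/andP; split; apply/eqP; ring.
Qed.

Definition cexp z : C := (expR (complex.Re z) * cos (complex.Im z) +i* (expR (complex.Re z) * sin (complex.Im z)))%C.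

Lemma cexpD z w : cexp (z + w) = cexp z * cexp w.
Proof.
case: z w => [a b] [c d]; rewrite /cexp /= expRD cosD sinD.
by apply/eqP; rewrite eq_complex /=; apply/andP; split; apply/eqP; ring.
Qed.

Lemma cexp0 : cexp 0 = 1.
Proof. by rewrite /cexp /= expR0 cos0 sin0 !mul1r. Qed.

Lemma cexpMn z n : cexp (z *+ n) = cexp z ^+ n.
Proof. by elim: n => [|n ih]; rewrite ?cexp0 // mulrS cexpD ih exprS. Qed.

Lemma cexp_real x : cexp (x%:C)%C = (expR x)%:C%C.
Proof. by rewrite /cexp /= cos0 sin0 mulr1 mulr0. Qed.

Lemma normc_cexp z : normc (cexp z) = expR (complex.Re z).
Proof.
rewrite /cexp /= !exprMn -mulrDr cos2Dsin2 mulr1 sqrtr_sqr.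
by rewrite ger0_norm ?expR_ge0.
Qed.

Lemma cexpN z : cexp (- z) = (cexp z)^-1.
Proof.
have h : cexp (- z) * cexp z = 1 by rewrite -cexpD addNr cexp0.
have h0 : cexp z != 0 by apply/eqP => e; move: h; rewrite e mulr0 => /esym/eqP; rewrite oner_eq0.
by apply: (mulIf h0); rewrite h mulVf.
Qed.

Definition cis x : C := cexp (0 +i* x)%C.

Lemma cisE x : cis x = (cos x +i* sin x)%C.
Proof. by rewrite /cis /cexp /= expR0 !mul1r. Qed.

Lemma cisD x y : cis (x + y) = cis x * cis y.
Proof. by rewrite /cis -cexpD; congr cexp; rewrite /GRing.add/= addr0. Qed.

Lemma cis0 : cis 0 = 1.
Proof. by rewrite cisE cos0 sin0. Qed.

Lemma cisMn x n : cis (x *+ n) = cis x ^+ n.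
Proof. by elim: n => [|n ih]; rewrite ?cis0 // mulrS cisD ih exprS. Qed.

Lemma normc_cis x : normc (cis x) = 1.
Proof. by rewrite /cis normc_cexp expR0. Qed.

Lemma cis_conj x : ((cis x)^*)%C = cis (- x).
Proof. by rewrite !cisE /= cosN sinN. Qed.

Lemma cis2pi : cis (pi *+ 2) = 1.
Proof. by rewrite cisE cos2pi sin2pi. Qed.

Lemma cis2pi_nat n : cis (pi *+ 2 * n%:R) = 1.
Proof. by rewrite mulr_natr cisMn cis2pi expr1n. Qed.

Lemma cis_neq1 x : 0 < x < pi *+ 2 -> cis x != 1.
Proof.
move=> /andP[x0 x2]; apply/eqP; rewrite cisE => -[h _].
(* cos x = 1 would force sin(x/2) = 0, while x/2 lies strictly between 0 and pi. *)
have : 0 < sin (x / 2).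
  apply: sin_gt0_pi; rewrite divr_gt0//= ltr_pdivrMr//.
  by rewrite mulr_natr.
have := cosD (x / 2) (x / 2); have := cos2Dsin2 (x / 2).
rewrite -splitr h !expr2; set s := sin _; set c := cos _.
by move=> h1 h2 s0; nra.
Qed.

Definition unity N : C := cis (pi *+ 2 / N%:R).

Lemma unityX N k : (0 < N)%N -> unity N ^+ (N * k) = 1.
Proof.
move=> N0; rewrite exprM -cisMn -[_ *+ N]mulr_natr divfK ?pnatr_eq0 -?lt0n//.
by rewrite cis2pi expr1n.
Qed.

Lemma unityXmod N k : (0 < N)%N -> unity N ^+ k = unity N ^+ (k %% N).
Proof.
by move=> N0; rewrite {1}(divn_eq k N) exprD mulnC unityX// mul1r.
Qed.

Lemma unity_eq1 N k : (0 < N)%N -> (unity N ^+ k == 1) = (N %| k)%N.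
Proof.
move=> N0; rewrite unityXmod// /dvdn; have := ltn_pmod k N0.
case: (k %% N)%N => [|m] mN; first by rewrite expr0 !eqxx.
apply/negbTE; rewrite -cisMn cis_neq1// -[_ *+ m.+1]mulr_natr.
have N0' : (0 : R) < N%:R by rewrite ltr0n.
have pi0 := pi_gt0 R.
have p2 : (0 : R) < pi *+ 2 by rewrite pmulrn_lgt0.
apply/andP; split; first by rewrite mulr_gt0 ?divr_gt0 ?ltr0n.
by rewrite mulrAC ltr_pdivrMr// ltr_pM2l// ltr_nat.
Qed.

Lemma sum_unity N k : (0 < N)%N ->
  \sum_(j < N) (unity N ^+ k) ^+ j = if (N %| k)%N then N%:R else 0.
Proof.
move=> N0; rewrite -unity_eq1//; set u := unity N ^+ k.
case: eqP => [->|/eqP u1].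
  by under eq_bigr do rewrite expr1n; rewrite sumr_const card_ord.
have := subrX1 u N; rewrite -exprM mulnC unityX// subrr => /esym/eqP.
by rewrite mulf_eq0 subr_eq0 (negPf u1) /= => /eqP.
Qed.

End ComplexTools.

(** * Uniform limits of polynomials on disks *)

Section PolyDisc.
Context {R : realType}.
Local Notation C := R[i].
Implicit Types (z w : C) (x y r e : R) (p : {poly R}) (f g : C -> C).

(** Real coefficients are enough for all series that occur, and they make evaluation commute with
    conjugation, on which [parseval] rests. *)
Definition pev p z : C := (map_poly (real_complex R) p).[z].

Lemma pevE p z : pev p z = \sum_(i < size p) (p`_i)%:C%C * z ^+ i.
Proof.
rewrite /pev horner_coef size_map_poly.
by apply: eq_bigr => i _; rewrite coef_map.
Qed.

Lemma pevE_wide p z n : (size p <= n)%N -> pev p z = \sum_(i < n) (p`_i)%:C%C * z ^+ i.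
Proof.
move=> pn; rewrite /pev (@horner_coef_wide _ n) ?size_map_poly//.
by apply: eq_bigr => i _; rewrite coef_map.
Qed.

Lemma pevD p p' z : pev (p + p') z = pev p z + pev p' z.
Proof. by rewrite /pev rmorphD hornerD. Qed.

Lemma pevM p p' z : pev (p * p') z = pev p z * pev p' z.
Proof. by rewrite /pev rmorphM hornerM. Qed.

Lemma pevC x z : pev x%:P z = x%:C%C.
Proof. by rewrite /pev map_polyC hornerC. Qed.

Lemma pevX z : pev 'X z = z.
Proof. by rewrite /pev map_polyX hornerX. Qed.

Lemma normc_pev p z : normc (pev p z) <= \sum_(i < size p) `|p`_i| * normc z ^+ i.
Proof.
rewrite pevE (le_trans (normc_sum _ _ _))//; apply: ler_sum => i _.
by rewrite normcM normc_real normcX.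
Qed.

Lemma pev_bounded p r : exists2 M, 0 <= M & forall z, normc z <= r -> normc (pev p z) <= M.
Proof.
exists (\sum_(i < size p) `|p`_i| * `|r| ^+ i) => [|z zr].
  by apply: sumr_ge0 => i _; rewrite mulr_ge0// exprn_ge0.
apply: le_trans (normc_pev _ _) _; apply: ler_sum => i _.
by rewrite ler_wpM2l// lerXn2r ?nnegrE ?normc_ge0// (le_trans zr)// ler_norm.
Qed.

Lemma pev_conj p z : ((pev p z)^*)%C = pev p (z^*)%C.
Proof.
rewrite !pevE (rmorph_sum (@conjc R)); apply: eq_bigr => i _.
by rewrite (rmorphM (@conjc R)) (rmorphXn (@conjc R))/= oppr0.
Qed.

(** A discrete Parseval identity: sampling at N equally spaced points of the circle is exact once N
    bounds the number of coefficients, since N-th roots of unity then separate all exponents. *)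
Lemma parseval p N r : (0 < N)%N -> (size p <= N)%N ->
  \sum_(j < N) normc (pev p (r%:C%C * unity N ^+ j)) ^+ 2 =
  N%:R * \sum_(k < N) (p`_k * r ^+ k) ^+ 2.
Proof.
move=> N0 pN; apply: (@complexI R); rewrite rmorphM !rmorph_sum/= rmorph_nat.
under eq_bigr => j _.
  rewrite normc_sqr pev_conj !(pevE_wide _ pN) mulr_suml.
  under eq_bigr => k _.
    rewrite mulr_sumr.
    under eq_bigr => l _.
      rewrite (rmorphM (@conjc R)) (rmorphXn (@conjc R))/= ?oppr0.
      rewrite (_ : _ * _ = ((p`_k * r ^+ k)%:C%C * (p`_l * r ^+ l)%:C%C) *
         (unity N ^+ k * ((unity N)^*)%C ^+ l) ^+ j); last first.
        rewrite !rmorphM/= !rmorphXn/= !exprMn -!exprM [(k * j)%N]mulnC [(l * j)%N]mulnC.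
        by ring.
      over.
    over.
  over.
rewrite exchange_big/= mulr_sumr; apply: eq_bigr => k _.
rewrite exchange_big/= (bigD1 k)//= [X in _ + X]big1 ?addr0.
  rewrite -mulr_sumr [X in _ * X](_ : _ = N%:R).
    by rewrite rmorphXn/= expr2 mulrC.
  rewrite -exprMn -[X in X ^+ k]normc_sqr normc_cis expr1n expr1n.
  by under eq_bigr do rewrite expr1n; rewrite sumr_const card_ord.
move=> l lk; rewrite -mulr_sumr [X in _ * X](_ : _ = 0) ?mulr0//.
have uc : ((unity N)^*)%C = (unity N)^-1 :> C.
  by rewrite /unity cis_conj /cis -cexpN; congr cexp; rewrite /GRing.opp/= oppr0.
have u0 : unity N != 0 :> C.
  by apply/eqP => u0; have := @unityX R N 1 N0; rewrite u0 muln1 expr0n gtn_eqF//= => /esym/eqP; rewrite oner_eq0.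
(* The exponent k - l is shifted by N to stay a natural number; 0 < m < 2N, and m = N only for k =
   l. *)
pose m := (k + (N - l))%N.
have -> : unity N ^+ k * (unity N)^*%C ^+ l = unity N ^+ m :> C.
  rewrite uc /m exprD exprVn; congr (_ * _).
  apply: (mulIf (expf_neq0 l u0)); rewrite mulVf ?expf_neq0// -exprD subnK; last exact: ltnW.
  by rewrite -[X in _ ^+ X]muln1 unityX.
rewrite sum_unity//; case: ifPn => // /dvdnP[q].
rewrite /m => hq; exfalso; move/eqP: lk; apply; apply/val_inj => /=.
have := ltn_ord k; have := ltn_ord l.
have : (q = 1)%N \/ (q = 0)%N \/ (1 < q)%N by lia.
by move=> [|[|]] hq'; nia.
Qed.

(** The maximum on the circle dominates the mean square over N sample points, with N taken beyond
    both K and the degree. *)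
Lemma pev_circle_l2 p r M : 0 <= r ->
  (forall z, normc z = r -> normc (pev p z) <= M) ->
  forall K, \sum_(k < K) (p`_k * r ^+ k) ^+ 2 <= M ^+ 2.
Proof.
move=> r0 hM K; pose N := (maxn 1 (maxn K (size p))).
have N0 : (0 < N)%N by rewrite /N; lia.
apply: (@le_trans _ _ (\sum_(k < N) (p`_k * r ^+ k) ^+ 2)).
  rewrite (big_ord_widen N (fun k => (p`_k * r ^+ k) ^+ 2)) ?/N; last by lia.
  by rewrite [leRHS](bigID (fun k : 'I_N => (k < K)%N))/= lerDl sumr_ge0// => i _; rewrite sqr_ge0.
rewrite -(@ler_pM2l _ N%:R) ?ltr0n// -parseval//; last by rewrite /N; lia.
apply: le_trans (_ : \sum_(j < N) M ^+ 2 <= _); last first.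
  by rewrite sumr_const card_ord mulr_natl.
apply: ler_sum => j _; rewrite lerXn2r ?nnegrE ?normc_ge0//.
  apply: le_trans (normc_ge0 _) (hM (r%:C)%C _).
  by rewrite normc_real ger0_norm.
by apply: hM; rewrite normcM normc_real ger0_norm// normcX normc_cis expr1n mulr1.
Qed.

Lemma pev_circle_coef p r M : 0 <= r ->
  (forall z, normc z = r -> normc (pev p z) <= M) ->
  forall k, `|p`_k| * r ^+ k <= M.
Proof.
move=> r0 hM k.
have M0 : 0 <= M.
  apply: le_trans (normc_ge0 _) (hM (r%:C)%C _).
  by rewrite normc_real ger0_norm.
rewrite -[r ^+ k]ger0_norm ?exprn_ge0// -normrM -(@ler_pXn2r _ 2%N)// ?nnegrE//.
rewrite real_normK ?num_real//.
apply: le_trans (pev_circle_l2 r0 hM k.+1).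
by rewrite big_ord_recr/= lerDr sumr_ge0// => i _; rewrite sqr_ge0.
Qed.

Definition approx r f p e := forall z, normc z <= r -> normc (f z - pev p z) <= e.

(** The disk algebra restricted to real coefficients. Coefficient estimates for polynomials pass to
    such limits, and the class is closed under products, composition and uniform limits. *)
Definition calA r f := forall e, 0 < e -> exists p, approx r f p e.

Lemma calA_bounded r f : calA r f ->
  exists2 M, 0 < M & forall z, normc z <= r -> normc (f z) <= M.
Proof.
move=> /(_ 1 ltr01)[p hp]; have [M M0 hM] := pev_bounded p r.
exists (M + 1) => [|z zr]; first by rewrite ltr_wpDl.
rewrite -[f z](subrK (pev p z)) addrC (le_trans (le_normcD _ _))//.
by rewrite lerD ?hM ?hp.
Qed.

Lemma calA_ext r f g : (forall z, normc z <= r -> f z = g z) -> calA r f -> calA r g.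
Proof.
move=> fg cf e /cf[p hp]; exists p => z zr; by rewrite -fg// hp.
Qed.

Lemma calA_const r x : calA r (fun=> x%:C%C).
Proof. by move=> e e0; exists x%:P => z _; rewrite pevC subrr normc0 ltW. Qed.

Lemma calA_id r : calA r id.
Proof. by move=> e e0; exists 'X => z _; rewrite pevX subrr normc0 ltW. Qed.

Lemma calA_add r f g : calA r f -> calA r g -> calA r (fun z => f z + g z).
Proof.
move=> cf cg e e0; have e2 : 0 < e / 2 by rewrite divr_gt0.
have [p hp] := cf _ e2; have [p' hp'] := cg _ e2.
exists (p + p') => z zr; rewrite pevD opprD addrACA (le_trans (le_normcD _ _))//.
by rewrite [leRHS]splitr lerD ?hp ?hp'.
Qed.

Lemma calA_mul r f g : calA r f -> calA r g -> calA r (fun z => f z * g z).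
Proof.
move=> cf cg e e0.
have [M M0 hM] := calA_bounded cf; have [M' M'0 hM'] := calA_bounded cg.
have e1 : 0 < e / (2 * M') by rewrite divr_gt0// mulr_gt0.
have [p hp] := cf _ e1.
have e2 : 0 < e / (2 * (M + e / (2 * M'))) by rewrite divr_gt0// mulr_gt0// addr_gt0.
have [p' hp'] := cg _ e2.
exists (p * p') => z zr; rewrite pevM.
have -> : f z * g z - pev p z * pev p' z =
  (f z - pev p z) * g z + pev p z * (g z - pev p' z) by ring.
rewrite (le_trans (le_normcD _ _))// [leRHS]splitr lerD// normcM.
  apply: (@le_trans _ _ (e / (2 * M') * M')).
    by rewrite ler_pM ?normc_ge0 ?hp ?hM'.
  by rewrite le_eqVlt; apply/orP; left; apply/eqP; field; rewrite gt_eqF.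
apply: (@le_trans _ _ ((M + e / (2 * M')) * (e / (2 * (M + e / (2 * M')))))).
  rewrite ler_pM ?normc_ge0 ?hp'//.
  rewrite -[pev p z](subrK (f z)) addrC (le_trans (le_normcD _ _))// lerD ?hM//.
  by rewrite -normcN opprB hp.
have : 0 < M + e / (2 * M') by rewrite addr_gt0.
move: (M + _) => h h0.
by rewrite le_eqVlt; apply/orP; left; apply/eqP; field; rewrite gt_eqF.
Qed.

Lemma calA_scale r x f : calA r f -> calA r (fun z => x%:C%C * f z).
Proof. by move=> cf; apply: calA_mul => //; exact: calA_const. Qed.

Lemma calA_opp r f : calA r f -> calA r (fun z => - f z).
Proof.
move=> cf; apply: calA_ext (calA_scale (-1) cf) => z _.
by rewrite rmorphN/= mulN1r.
Qed.

Lemma calA_sub2 r f g : calA r f -> calA r g -> calA r (fun z => f z - g z).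
Proof. by move=> cf cg; apply: calA_add => //; exact: calA_opp. Qed.

Lemma calA_exp r f n : calA r f -> calA r (fun z => f z ^+ n).
Proof.
move=> cf; elim: n => [|n ih]; first by apply: calA_ext (calA_const r 1).
by apply: calA_ext (calA_mul cf ih) => z _; rewrite exprS.
Qed.

Lemma calA_pev r f p : calA r f -> calA r (fun z => pev p (f z)).
Proof.
move=> cf; elim/poly_ind: p => [|p c ih].
  by apply: calA_ext (calA_const r 0) => z _; rewrite -(pevC 0 (f z)) polyC0.
apply: calA_ext (calA_add (calA_mul ih cf) (calA_const r c)) => z _.
by rewrite pevD pevM pevX pevC.
Qed.

Lemma calA_lim r f : (forall e, 0 < e -> exists2 g, calA r g &
    forall z, normc z <= r -> normc (f z - g z) <= e) -> calA r f.
Proof.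
move=> h e e0; have e2 : 0 < e / 2 by rewrite divr_gt0.
have [g cg hg] := h _ e2; have [p hp] := cg _ e2; exists p => z zr.
have -> : f z - pev p z = (f z - g z) + (g z - pev p z) by ring.
by rewrite (le_trans (le_normcD _ _))// [leRHS]splitr lerD ?hg ?hp.
Qed.

Lemma calA_comp r r' f g : calA r' f -> calA r g ->
  (forall z, normc z <= r -> normc (g z) <= r') -> calA r (fun z => f (g z)).
Proof.
move=> cf cg h; apply: calA_lim => e /cf[p hp].
exists (fun z => pev p (g z)); first exact: calA_pev.
by move=> z zr; apply: hp; exact: h.
Qed.

End PolyDisc.

(** * Cauchy-Schwarz, passage to the limit, geometric tails *)

Section Aux.
Context {R : realType}.

Lemma cauchy_schwarz_sum (I : finType) (P : pred I) (a b : I -> R) :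
  (\sum_(i | P i) a i * b i) ^+ 2 <=
  (\sum_(i | P i) a i ^+ 2) * (\sum_(i | P i) b i ^+ 2).
Proof.
set A := \sum_(i | P i) a i ^+ 2; set B := \sum_(i | P i) b i ^+ 2.
set X := \sum_(i | P i) a i * b i.
have A0 : 0 <= A by apply: sumr_ge0 => i _; rewrite sqr_ge0.
have h (t : R) : 0 <= A * t ^+ 2 - X * t *+ 2 + B.
  have -> : A * t ^+ 2 - X * t *+ 2 + B = \sum_(i | P i) (a i * t - b i) ^+ 2.
    rewrite /A /B /X !mulr_suml -sumrMnl -sumrB -big_split/=.
    by apply: eq_bigr => i _; ring.
  by apply: sumr_ge0 => i _; rewrite sqr_ge0.
have [A00|A0'] := eqVneq A 0.
  suff -> : X = 0 by rewrite expr0n /= A00 mul0r.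
  apply: big1 => i Pi; have := @psumr_eq0P _ _ P (fun i => a i ^+ 2) (fun i _ => sqr_ge0 (a i)) A00 i Pi.
  by move/eqP; rewrite sqrf_eq0 => /eqP ->; rewrite mul0r.
have {A0 A0'} A0 : 0 < A by rewrite lt_neqAle eq_sym A0' A0.
have := h (X / A); have -> : A * (X / A) ^+ 2 - X * (X / A) *+ 2 + B = (A * B - X ^+ 2) / A.
  by field; rewrite gt_eqF.
by rewrite pmulr_lge0 ?invr_gt0// subr_ge0.
Qed.

(** The form in which e tends to 0 throughout: c collects the error constants, and e <= 1 keeps
    points scaled by e inside a given disk. *)
Lemma lim_le (a b c : R) : (forall e, 0 < e -> e <= 1 -> a <= b + e * c) -> a <= b.
Proof.
move=> h; rewrite leNgt; apply/negP => ba.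
pose d := a - b; have d0 : 0 < d by rewrite subr_gt0.
have c1 : 0 < `|c| + 1 by rewrite ltr_wpDl.
pose e := Num.min 1 (d / 2 / (`|c| + 1)).
have e0 : 0 < e by rewrite lt_min ltr01 !divr_gt0.
have e1 : e <= 1 by rewrite ge_min lexx.
have := h e e0 e1; have : e * c <= d / 2.
  apply: le_trans (_ : e * (`|c| + 1) <= _).
    by rewrite ler_pM2l// (le_trans (ler_norm c))// lerDl.
  by rewrite -ler_pdivlMr// ge_min lexx orbT.
rewrite /d in d0 * => h1 h2; lra.
Qed.

Lemma geo_tail (x : R) K N : 0 <= x < 1 -> \sum_(K <= k < N) x ^+ k <= x ^+ K / (1 - x).
Proof.
move=> /andP[x0 x1]; rewrite ler_pdivlMr ?subr_gt0//.
have [NK|KN] := leqP N K.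
  by rewrite big_geq// mul0r exprn_ge0.
rewrite mulr_suml (eq_bigr (fun k => - (x ^+ k.+1 - x ^+ k))) => [|k _]; last first.
  by rewrite exprS; ring.
by rewrite sumrN telescope_sumr// 1?ltnW// opprB gerBl exprn_ge0.
Qed.

Lemma expn_lt_eps (x e : R) : 0 <= x < 1 -> 0 < e -> exists K, x ^+ K < e.
Proof.
move=> /andP[x0 x1] e0.
have : ((fun K => x ^+ K) @ \oo --> (0 : R))%classic by apply: cvg_expr; rewrite ger0_norm.
move/cvgr0Pnorm_lt => /(_ _ e0)[K _ hK]; exists K.
by have := hK K (leqnn _); rewrite ger0_norm ?exprn_ge0.
Qed.

End Aux.

(** * Taylor coefficients of uniform limits, and a Schwarz-type estimate *)

Section Coefs.
Context {R : realType}.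
Local Notation C := R[i].
Implicit Types (z w : C) (x y r e : R) (p : {poly R}) (f g : C -> C) (c : nat -> R).

(** Taylor coefficients read off from approximants: by Cauchy's estimate a polynomial within e of f
    on the disk has its k-th coefficient within e / r^k of that of f. *)
Definition coefs r f c := forall e p, approx r f p e ->
  forall k, `|c k - p`_k| * r ^+ k <= e.

Lemma approx_dist r f p p' e e' : approx r f p e -> approx r f p' e' ->
  forall z, normc z <= r -> normc (pev (p - p') z) <= e + e'.
Proof.
move=> h h' z zr; have -> : pev (p - p') z = pev p z - pev p' z.
  by rewrite /pev rmorphB hornerD hornerN.
have -> : pev p z - pev p' z = (f z - pev p' z) - (f z - pev p z) by ring.
by rewrite (le_trans (le_normcD _ _))// normcN addrC lerD ?h ?h'.
Qed.

(** Each approximant p confines the k-th coefficient to the interval of radius e / r^k around p_k.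
    By [pev_circle_coef] any two of these intervals meet, so the supremum of the left endpoints lies
    in all of them. *)
Lemma calA_coefs r f : 0 < r -> calA r f -> exists c, coefs r f c.
Proof.
move=> r0 cf.
have cmp e p e' p' k : approx r f p e -> approx r f p' e' ->
    p`_k - e / r ^+ k <= p'`_k + e' / r ^+ k.
  move=> h h'; have := pev_circle_coef (ltW r0)
    (fun z zr => approx_dist h h' (eq_ind_r (fun x => x <= r) (lexx r) zr)) k.
  rewrite -ler_pdivlMr ?exprn_gt0// coefB => hk.
  have := le_trans (ler_norm _) hk; rewrite mulrDl; lra.
pose S k := [set y | exists e p, approx r f p e /\ y = p`_k - e / r ^+ k]%classic.
have [p1 hp1] := cf 1 ltr01.
exists (fun k => sup (S k)) => e p hp k.
rewrite -ler_pdivlMr ?exprn_gt0// ler_norml.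
have S0 : (S k !=set0)%classic by exists (p1`_k - 1 / r ^+ k), 1, p1.
have Sb : has_ubound (S k).
  by exists (p`_k + e / r ^+ k) => _ [e' [p' [h' ->]]]; exact: cmp.
apply/andP; split.
  rewrite lerBrDl addrC; suff : p`_k - e / r ^+ k <= sup (S k) by lra.
  by apply: ub_le_sup => //; exists e, p.
rewrite lerBlDl; apply: ge_sup => // _ [e' [p' [h' ->]]]; exact: cmp.
Qed.

(** The remainder splits into the error of an approximant p, the error of its first K coefficients,
    and the tail of p. The first two vanish with e; the tail is geometric by Cauchy's estimate. *)
Lemma coefs_tail r f c M z K : 0 < r -> calA r f -> coefs r f c ->
  (forall z, normc z = r -> normc (f z) <= M) -> normc z < r ->
  normc (f z - \sum_(k < K) (c k)%:C%C * z ^+ k) <=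
    M * (normc z / r) ^+ K / (1 - normc z / r).
Proof.
move=> r0 cf hc hM zr; set rho := normc z / r.
have rho0 : 0 <= rho by rewrite divr_ge0 ?normc_ge0// ltW.
have rho1 : rho < 1 by rewrite ltr_pdivrMr// mul1r.
have rho1' : 0 < 1 - rho by rewrite subr_gt0.
have zE : normc z = r * rho by rewrite /rho mulrC divfK// gt_eqF.
apply: (@lim_le _ _ _ (1 + 1 / (1 - rho) + rho ^+ K / (1 - rho))) => e e0 _.
have [p hp] := cf _ e0.
have hpM w : normc w = r -> normc (pev p w) <= M + e.
  move=> wr; have -> : pev p w = f w - (f w - pev p w) by ring.
  by rewrite (le_trans (le_normcD _ _))// normcN lerD ?hM// hp// wr.
have hb := pev_circle_coef (ltW r0) hpM.
have -> : f z - \sum_(k < K) (c k)%:C%C * z ^+ k = (f z - pev p z) +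
  (\sum_(k < K) (p`_k - c k)%:C%C * z ^+ k) + (pev p z - \sum_(k < K) (p`_k)%:C%C * z ^+ k).
  have -> : \sum_(k < K) (p`_k - c k)%:C%C * z ^+ k =
     \sum_(k < K) (p`_k)%:C%C * z ^+ k - \sum_(k < K) (c k)%:C%C * z ^+ k.
    by rewrite -sumrB; apply: eq_bigr => k _; rewrite rmorphB/= mulrBl.
  by ring.
have h1 : normc (\sum_(k < K) (p`_k - c k)%:C%C * z ^+ k) <= e / (1 - rho).
  apply: le_trans (normc_sum _ _ _) _.
  apply: le_trans (_ : \sum_(k < K) e * rho ^+ k <= _).
    apply: ler_sum => k _; rewrite normcM normc_real normcX zE exprMn mulrA.
    rewrite ler_wpM2r ?exprn_ge0//.
    by rewrite -[p`_k - _]opprB normrN; exact: hc.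
  rewrite -mulr_sumr ler_pM2l// -(big_mkord xpredT (fun k => rho ^+ k)).
  by rewrite -[_^-1]mul1r -[X in _ <= X / _](expr0 rho); apply: geo_tail; rewrite rho0.
have h2 : normc (pev p z - \sum_(k < K) (p`_k)%:C%C * z ^+ k) <=
    (M + e) * (rho ^+ K / (1 - rho)).
  pose N := maxn K (size p).
  have -> : pev p z - \sum_(k < K) (p`_k)%:C%C * z ^+ k = \sum_(K <= k < N) (p`_k)%:C%C * z ^+ k.
    rewrite (@pevE_wide _ p z N) /N; last by lia.
    rewrite -!(big_mkord xpredT (fun k => (p`_k)%:C%C * z ^+ k)).
    rewrite [X in X - _](@big_cat_nat _ _ _ K)//=; last by lia.
    by rewrite addrAC subrr add0r.
  apply: le_trans (normc_sum _ _ _) _.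
  apply: le_trans (_ : \sum_(K <= k < N) (M + e) * rho ^+ k <= _).
    apply: ler_sum => k _; rewrite normcM normc_real normcX zE exprMn mulrA.
    by rewrite ler_wpM2r ?exprn_ge0.
  rewrite -mulr_sumr ler_wpM2l//; last by apply: geo_tail; rewrite rho0.
  by apply: le_trans (normc_ge0 _) (hpM (r%:C)%C _); rewrite normc_real gtr0_norm.
apply: le_trans (le_normcD _ _) _.
apply: le_trans (lerD (le_trans (le_normcD _ _) (lerD (hp z (ltW zr)) h1)) h2) _.
rewrite le_eqVlt; apply/orP; left; apply/eqP; field; by rewrite gt_eqF.
Qed.

(** Cauchy-Schwarz splits the series into the l2 norm of c_k r^k, at most M, and that of rho^k for k
    >= k0. The factor 1 / (1 - rho^2), absent from the classical Schwarz lemma, is the price of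
    arguing on coefficients. *)
Lemma max_vanish r f c M k0 z : 0 < r -> calA r f -> coefs r f c ->
  (forall i, (i < k0)%N -> c i = 0) ->
  (forall z, normc z = r -> normc (f z) <= M) -> normc z < r ->
  normc (f z) ^+ 2 <= M ^+ 2 * ((normc z / r) ^+ 2) ^+ k0 / (1 - (normc z / r) ^+ 2).
Proof.
move=> r0 cf hc c0 hM zr; set rho := normc z / r.
have rho0 : 0 <= rho by rewrite divr_ge0 ?normc_ge0// ltW.
have rho1 : rho < 1 by rewrite ltr_pdivrMr// mul1r.
have rho1' : 0 < 1 - rho by rewrite subr_gt0.
have rho2 : 0 <= rho ^+ 2 < 1 by rewrite sqr_ge0 exprn_ilt1.
have zE : normc z = r * rho by rewrite /rho mulrC divfK// gt_eqF.
have M0 : 0 <= M.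
  by apply: le_trans (normc_ge0 _) (hM (r%:C)%C _); rewrite normc_real gtr0_norm.
set B := (rho ^+ 2) ^+ k0 / (1 - rho ^+ 2).
have B0 : 0 <= B by rewrite divr_ge0 ?exprn_ge0// subr_ge0 ltW//; case/andP: rho2.
suff : normc (f z) <= M * Num.sqrt B.
  move=> h; apply: le_trans (_ : (M * Num.sqrt B) ^+ 2 <= _).
    by rewrite lerXn2r// ?nnegrE ?normc_ge0 ?mulr_ge0 ?sqrtr_ge0.
  by rewrite exprMn sqr_sqrtr// mulrA.
apply: (@lim_le _ _ _ (1 + 1 / (1 - rho) + Num.sqrt B)) => e e0 _.
have [p hp] := cf _ e0.
have hpM w : normc w = r -> normc (pev p w) <= M + e.
  move=> wr; have -> : pev p w = f w - (f w - pev p w) by ring.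
  by rewrite (le_trans (le_normcD _ _))// normcN lerD ?hM// hp// wr.
have hb := pev_circle_l2 (ltW r0) hpM.
pose N := maxn k0 (size p).
have -> : f z = (f z - pev p z) + \sum_(k < k0) (p`_k)%:C%C * z ^+ k +
  \sum_(k0 <= k < N) (p`_k)%:C%C * z ^+ k.
  rewrite (@pevE_wide _ p z N) /N; last by lia.
  rewrite -!(big_mkord xpredT (fun k => (p`_k)%:C%C * z ^+ k)).
  rewrite [X in _ - X](@big_cat_nat _ _ _ k0)//=; last by lia.
  by ring.
have h1 : normc (\sum_(k < k0) (p`_k)%:C%C * z ^+ k) <= e / (1 - rho).
  apply: le_trans (normc_sum _ _ _) _.
  apply: le_trans (_ : \sum_(k < k0) e * rho ^+ k <= _).
    apply: ler_sum => k _; rewrite normcM normc_real normcX zE exprMn mulrA.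
    rewrite ler_wpM2r ?exprn_ge0//.
    by have := hc _ _ hp k; rewrite c0// sub0r normrN.
  rewrite -mulr_sumr ler_pM2l// -(big_mkord xpredT (fun k => rho ^+ k)).
  by rewrite -[_^-1]mul1r -[X in _ <= X / _](expr0 rho); apply: geo_tail; rewrite rho0.
have h2 : normc (\sum_(k0 <= k < N) (p`_k)%:C%C * z ^+ k) <= (M + e) * Num.sqrt B.
  have Me : 0 <= M + e by rewrite addr_ge0// ltW.
  apply: le_trans (normc_sum _ _ _) _.
  rewrite -(@ler_pXn2r _ 2%N) ?nnegrE ?mulr_ge0 ?sqrtr_ge0//; last first.
    by apply: sumr_ge0 => i _; rewrite normc_ge0.
  rewrite [X in _ <= X]exprMn sqr_sqrtr//.
  rewrite (eq_bigr (fun k => (`|p`_k| * r ^+ k) * rho ^+ k)); last first.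
    by move=> k _; rewrite normcM normc_real normcX zE exprMn mulrA.
  rewrite (@big_nat_widenl _ _ _ k0 0)// big_mkord.
  apply: le_trans (cauchy_schwarz_sum _ _ _) _.
  apply: ler_pM; rewrite ?sumr_ge0//; try by move=> i _; rewrite sqr_ge0.
    apply: le_trans (hb N); rewrite [leRHS](bigID (fun i : 'I_N => (k0 <= i)%N))/=.
    apply: le_trans (_ : \sum_(i < N | (k0 <= i)%N) (p`_i * r ^+ i) ^+ 2 <= _).
      by apply: ler_sum => i _; rewrite !exprMn real_normK ?num_real.
    by rewrite lerDl sumr_ge0// => i _; rewrite sqr_ge0.
  rewrite -(big_mkord (fun i => (k0 <= i)%N) (fun i => (rho ^+ i) ^+ 2)).
  rewrite -(@big_nat_widenl _ _ _ k0 0 N xpredT)//.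
  under eq_bigr do rewrite exprAC.
  exact: geo_tail.
apply: le_trans (le_normcD _ _) _.
apply: le_trans (lerD (le_trans (le_normcD _ _) (lerD (hp z (ltW zr)) h1)) h2) _.
rewrite le_eqVlt; apply/orP; left; apply/eqP; field; by rewrite gt_eqF.
Qed.

End Coefs.

(** * Trigonometric bounds *)

Section Trig.
Local Open Scope classical_set_scope.
Local Open Scope ring_scope.
Context {R : realType}.
Implicit Types x y : R.

Lemma ge0_of_derive (f df : R -> R) b : (forall x, is_derive x 1 f (df x)) ->
  (forall x, 0 <= x <= b -> 0 <= df x) -> f 0 = 0 -> forall x, 0 <= x <= b -> 0 <= f x.
Proof.
move=> hd hdf f0 x /andP[x0 xb].
have fc : {within `[0, x]%classic, continuous f}.
  by apply: derivable_within_continuous => y _; apply: ex_derive; exact: hd.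
have [c] := MVT_segment x0 (fun y _ => hd y) fc.
rewrite in_itv/= => /andP[c0 cx]; rewrite f0 !subr0 => ->.
by rewrite mulr_ge0// hdf// c0 (le_trans cx).
Qed.

Lemma is_derive_id_sub_sin y : is_derive y 1 (fun x => x - sin x) (1 - cos y).
Proof. by apply: is_derive_eq. Qed.

Lemma is_derive_cos_sub_quad y :
  is_derive y 1 (fun x => cos x - (1 - x ^+ 2 / 2)) (y - sin y).
Proof. by apply: is_derive_eq; rewrite /GRing.scale/=; field. Qed.

Lemma is_derive_sin_sub_quad y :
  is_derive y 1 (fun x => sin x - (x - x ^+ 2)) (cos y - (1 - 2 * y)).
Proof. by apply: is_derive_eq; rewrite /GRing.scale/=; ring. Qed.

Lemma is_derive_sin_sub_xcos y : is_derive y 1 (fun x => sin x - x * cos x) (y * sin y).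
Proof. by apply: is_derive_eq; rewrite /GRing.scale/=; ring. Qed.

Lemma is_derive_cos_expR y : is_derive y 1 (fun x => 1 - cos x * expR (x ^+ 2 / 2))
  (expR (y ^+ 2 / 2) * (sin y - y * cos y)).
Proof. apply: is_derive_eq; rewrite /GRing.scale/=; by field. Qed.

Lemma sin_lex x : 0 <= x -> sin x <= x.
Proof.
move=> x0; rewrite -subr_ge0.
have hd := is_derive_id_sub_sin.
apply: (ge0_of_derive hd (b := x)) => [y _||]; rewrite ?subr_ge0 ?cos_le1//.
  by rewrite sin0 subr0.
by rewrite x0 lexx.
Qed.

Lemma cos_ge_quad x : 0 <= x -> 1 - x ^+ 2 / 2 <= cos x.
Proof.
move=> x0; rewrite -subr_ge0.
have hd := is_derive_cos_sub_quad.
apply: (ge0_of_derive hd (b := x)) => [y /andP[y0 _]||].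
- by rewrite subr_ge0 sin_lex.
- by rewrite cos0 expr0n/= mul0r subr0 subrr.
- by rewrite x0 lexx.
Qed.

Lemma sin_ge_quad x : 0 <= x -> x - x ^+ 2 <= sin x.
Proof.
move=> x0; rewrite -subr_ge0.
have hd := is_derive_sin_sub_quad.
have [x2|x2] := lerP x 2; last first.
  move: (sin x) (sin_geN1 x) => s hs; rewrite expr2.
  have : 2 * x < x * x by rewrite ltr_pM2r// (lt_trans _ x2).
  lra.
apply: (ge0_of_derive hd (b := x)) => [y /andP[y0 yx]||].
- rewrite subr_ge0 (le_trans _ (cos_ge_quad y0))// expr2.
  have := ler_wpM2r y0 (le_trans yx x2); lra.
- by rewrite sin0 expr0n/= !subr0.
- by rewrite x0 lexx.
Qed.

(** [cos x * expR (x ^+ 2 / 2)] decreases because sin x >= x cos x. This supplies the Gaussian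
    majorant for the powers of cosines in Polya's limit. *)
Lemma cos_le_expR x : 0 <= x <= pi / 2 -> cos x <= expR (- (x ^+ 2 / 2)).
Proof.
move=> /andP[x0 xpi].
have h1 y : 0 <= y <= pi / 2 -> 0 <= sin y - y * cos y.
  have hd := is_derive_sin_sub_xcos.
  apply: (ge0_of_derive hd) => [z /andP[z0 z1]|]; last by rewrite sin0 mul0r subr0.
  rewrite mulr_ge0// sin_ge0_pi// z0 (le_trans z1)//.
  by rewrite ler_pdivrMr// ler_peMr ?pi_ge0// ler1n.
have hd := is_derive_cos_expR.
have : 0 <= 1 - cos x * expR (x ^+ 2 / 2).
  apply: (ge0_of_derive hd (b := pi / 2)) => [y hy||]; last by rewrite x0.
    by rewrite mulr_ge0 ?expR_ge0// h1.
  by rewrite cos0 expr0n/= mul0r expR0 mulr1 subrr.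
by rewrite subr_ge0 expRN -ler_pdivlMr ?expR_gt0// div1r.
Qed.

(** The contraction estimate for [Phi] uses pi >= 3.1. It follows from cos(pi/6)^2 = 3/4 and cos x
    >= 1 - x^2/2. *)
Lemma pi_ge31 : 31 / 10 <= pi :> R.
Proof.
pose x : R := pi / 6; have x0 : 0 <= x by rewrite divr_ge0// pi_ge0.
have c3 : cos (x *+ 2) = 1 / 2.
  have p3 : cos (x *+ 2 + x *+ 2 *+ 2) = -1.
    by rewrite (_ : x *+ 2 + _ = pi) ?cospi// /x -!mulrnA -mulrnDr -mulr_natr; field.
  have c0 : 0 < cos (x *+ 2).
    apply: cos_gt0_pihalf; rewrite /x -mulr_natr; have := pi_gt0 R; lra.
  move: p3 c0; rewrite (cosD (x *+ 2)) (cos_mulr2n (x *+ 2)) (sin_mulr2n (x *+ 2)); have := cos2Dsin2 (x *+ 2).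
  set c := cos _; set s := sin _ => h1 h2 c0.
  (* With c = cos(pi/3), the triple angle formula turns cos pi = -1 into 4c^3 - 3c + 1 = 0, which
     factors in this way. *)
  have : (c + 1) * (2 * c - 1) ^+ 2 = 0.
    have -> : (c + 1) * (2 * c - 1) ^+ 2 = (c * (c ^+ 2 *+ 2 - 1) - s * (c * s *+ 2)) +
      1 + 2 * c * (c ^+ 2 + s ^+ 2 - 1) by ring.
    by rewrite h2 h1; ring.
  move/eqP; rewrite mulf_eq0 sqrf_eq0 => /orP[] /eqP; lra.
have h := cos_ge_quad x0.
have c2 : cos x ^+ 2 = 3 / 4.
  have := cos_mulr2n x; rewrite c3 => h1; lra.
rewrite leNgt; apply/negP => pi31.
have x1 : x < 31 / 60 by rewrite /x; lra.
have x2 : x ^+ 2 < (31 / 60) * (31 / 60) by rewrite expr2 ltr_pM.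
(* 97/112 lies just above half the square root of 3, since 97^2 = 3 * 56^2 + 1. *)
have h3 : 97 / 112 < cos x by apply: lt_le_trans h; lra.
have := sqr_ge0 (cos x - 97 / 112).
rewrite sqrrB c2 -mulr_natr; lra.
Qed.
End Trig.

(** * Zeros of uniform limits of polynomials *)

Section Order.
Context {R : realType}.
Local Notation C := R[i].
Implicit Types (z w : C) (x y r e : R) (p : {poly R}) (f g : C -> C) (c : nat -> R).

Lemma coefs_lead r f c i : 0 < r -> calA r f -> coefs r f c ->
  (forall j, (j < i)%N -> c j = 0) ->
  exists2 D, 0 <= D & forall z, normc z <= r / 2 ->
    normc (f z - (c i)%:C%C * z ^+ i) <= D * normc z ^+ i.+1.
Proof.
move=> r0 cf hc c0; have [M M0 hM] := calA_bounded cf.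
have hM' z : normc z = r -> normc (f z) <= M by move=> zr; rewrite hM// zr.
exists (M / r ^+ i.+1 * 2) => [|z zr].
  by rewrite mulr_ge0// divr_ge0 ?exprn_ge0// ltW.
have zr' : normc z < r by rewrite (le_lt_trans zr)// ltr_pdivrMr// ltr_pMr// ltr1n.
have := coefs_tail i.+1 r0 cf hc hM' zr'.
rewrite big_ord_recr/= big1 ?add0r => [|j _]; last by rewrite c0// mul0r.
move=> /le_trans; apply.
have h : 0 < 1 - normc z / r by rewrite subr_gt0 ltr_pdivrMr// mul1r.
have -> : M / r ^+ i.+1 * 2 * normc z ^+ i.+1 = M * (normc z / r) ^+ i.+1 * 2.
  by rewrite exprMn exprVn; ring.
rewrite ler_pdivrMr// -[leRHS]mulrA ler_peMr//.
  by rewrite mulr_ge0 ?exprn_ge0 ?divr_ge0 ?normc_ge0// ltW.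
have : normc z / r <= 1 / 2 by rewrite ler_pdivrMr// mulrC mul1r.
lra.
Qed.

(** A bound along a real segment is enough: if c_i with i < k0 were the first nonzero coefficient,
    c_i x^i would exceed B x^k0 for small x. *)
Lemma coefs_zero_order r f c k0 B d : 0 < r -> calA r f -> coefs r f c ->
  0 < d -> (forall x, 0 < x < d -> normc (f x%:C%C) <= B * x ^+ k0) ->
  forall i, (i < k0)%N -> c i = 0.
Proof.
move=> r0 cf hc d0 hB; elim/ltn_ind => i ih ik.
have [j ji|D D0 hD] := @coefs_lead r f c i r0 cf hc; first by apply: ih => //; exact: ltn_trans ik.
pose d' := Num.min (1 / 2) (Num.min (d / 2) (r / 2)).
have d'0 : 0 < d' by rewrite !lt_min !divr_gt0.
have d'1 : d' <= 1 / 2 by rewrite ge_min lexx.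
have d'd : d' < d.
  by apply: le_lt_trans (_ : d / 2 < _); [rewrite !ge_min lexx ?orbT|rewrite ltr_pdivrMr// ltr_pMr// ltr1n].
have d'r : d' <= r / 2 by rewrite !ge_min lexx ?orbT.
apply/eqP; rewrite -normr_le0; apply: (@lim_le _ _ _ ((`|B| + D) * d')) => e e0 e1.
rewrite add0r; pose x := e * d'.
have x0 : 0 < x by rewrite mulr_gt0.
have xd' : x <= d' by rewrite -[leRHS]mul1r ler_wpM2r// ltW.
have h1 : normc (f x%:C%C) <= `|B| * x ^+ i.+1.
  apply: le_trans (hB _ _) _; first by rewrite x0 (le_lt_trans xd').
  apply: (@le_trans _ _ (`|B| * x ^+ k0)).
    by rewrite ler_wpM2r ?ler_norm// exprn_ge0// ltW.
  by rewrite ler_wpM2l// ler_wiXn2l// ltW//; lra.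
have nx : normc (x%:C)%C = x by rewrite normc_real gtr0_norm.
have h2 : normc ((c i)%:C%C * x%:C%C ^+ i) <= `|B| * x ^+ i.+1 + D * x ^+ i.+1.
  have -> : (c i)%:C%C * x%:C%C ^+ i = f x%:C%C - (f x%:C%C - (c i)%:C%C * x%:C%C ^+ i) by ring.
  apply: le_trans (le_normcD _ _) _; rewrite normcN lerD//.
  by have := hD (x%:C)%C; rewrite nx; apply; apply: le_trans xd' d'r.
move: h2; rewrite normcM normc_real normcX nx -mulrDl exprSr mulrA.
rewrite [X in _ <= X -> _]mulrAC ler_pM2r ?exprn_gt0// /x.
by rewrite mulrCA mulrC.
Qed.

Lemma coefs_eq0 r f c : 0 < r -> calA r f -> coefs r f c -> (forall i, c i = 0) ->
  forall z, normc z < r -> f z = 0.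
Proof.
move=> r0 cf hc c0 z zr; have [M M0 hM] := calA_bounded cf.
have hM' w : normc w = r -> normc (f w) <= M by move=> wr; rewrite hM// wr.
apply: eq0_normc; apply/eqP; rewrite eq_le normc_ge0 andbT.
apply: (@lim_le _ _ _ (M / (1 - normc z / r))) => e e0 _; rewrite add0r.
have rho : 0 <= normc z / r < 1.
  by rewrite divr_ge0 ?normc_ge0 ?(ltW r0)//= ltr_pdivrMr// mul1r.
have [K hK] := expn_lt_eps rho e0.
have := coefs_tail K r0 cf hc hM' zr.
rewrite big1 ?subr0 => [|k _]; last by rewrite c0 mul0r.
move=> /le_trans; apply; rewrite -mulrA mulrCA ler_wpM2r ?(ltW hK)//.
by rewrite divr_ge0 ?(ltW M0)// subr_ge0 ltW//; case/andP: rho.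
Qed.

Lemma calA_identity r f d : 0 < r -> calA r f -> 0 < d ->
  (forall x, 0 < x < d -> f x%:C%C = 0) -> forall z, normc z < r -> f z = 0.
Proof.
move=> r0 cf d0 h; have [c hc] := calA_coefs r0 cf.
apply: (coefs_eq0 r0 cf hc) => i.
apply: (@coefs_zero_order r f c i.+1 0 d) => // x xd.
by rewrite h// normc0 mul0r.
Qed.

(** Serves to cancel a factor of a vanishing product: close to 0 the first nonzero Taylor term
    outweighs the rest. *)
Lemma calA_isolated r f : 0 < r -> calA r f ->
  (forall z, normc z < r -> f z = 0) \/
  exists2 d, 0 < d & forall z, 0 < normc z < d -> f z != 0.
Proof.
move=> r0 cf; have [c hc] := calA_coefs r0 cf.
have [c0|] := pselect (forall i, c i = 0); first by left; exact: (coefs_eq0 r0 cf hc).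
move=> /existsNP[i0 /eqP ci0]; right.
have ex : exists i, c i != 0 by exists i0.
case: (ex_minnP ex) => i ci hi.
have [j ji|D D0 hD] := @coefs_lead r f c i r0 cf hc.
  by apply/eqP; apply: contraTT ji => /hi; rewrite -leqNgt.
have D1 : 0 < D + 1 by rewrite ltr_wpDl.
exists (Num.min (r / 2) (`|c i| / (D + 1))).
  by rewrite lt_min !divr_gt0// normr_gt0.
move=> z /andP[z0]; rewrite lt_min => /andP[/ltW zr zc].
apply/eqP => fz; have := hD z zr; rewrite fz sub0r normcN normcM normc_real normcX.
rewrite exprSr mulrA mulrAC ler_pM2r ?exprn_gt0// => h.
move: zc; rewrite ltr_pdivlMr// ltNge => /negP; apply.
by rewrite (le_trans h)// mulrC ler_wpM2l ?normc_ge0// lerDl.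
Qed.

End Order.

(** * Power series with nonnegative coefficients *)

Section Complexify.
Context {R : realType}.
Local Notation C := R[i].
Implicit Types (z w : C) (x y r e : R) (f g : C -> C) (c : nat -> R).

Definition analytic f := forall r, r < 1 -> calA r f.

Lemma normc_le_ReIm z : normc z <= `|complex.Re z| + `|complex.Im z|.
Proof.
case: z => a b /=; rewrite -(@ler_pXn2r _ 2%N) ?nnegrE ?sqrtr_ge0 ?addr_ge0//.
rewrite sqr_sqrtr ?addr_ge0 ?sqr_ge0// sqrrD !real_normK ?num_real//.
by rewrite addrAC lerDl mulrn_wge0// mulr_ge0.
Qed.

Lemma Re_le_normc z : `|complex.Re z| <= normc z.
Proof.
case: z => a b /=; rewrite -(@ler_pXn2r _ 2%N) ?nnegrE ?sqrtr_ge0//.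
by rewrite sqr_sqrtr ?addr_ge0 ?sqr_ge0// real_normK ?num_real// lerDl sqr_ge0.
Qed.

Lemma Im_le_normc z : `|complex.Im z| <= normc z.
Proof.
case: z => a b /=; rewrite -(@ler_pXn2r _ 2%N) ?nnegrE ?sqrtr_ge0//.
by rewrite sqr_sqrtr ?addr_ge0 ?sqr_ge0// real_normK ?num_real// lerDr sqr_ge0.
Qed.

Definition is_sup_sum (v : nat -> R) S :=
  (forall n, \sum_(k < n) v k <= S) /\
  (forall e, 0 < e -> exists n, S - e < \sum_(k < n) v k).

(** Let U and V be the partial sums of u and of its majorant. The limit is the supremum of the lower
    bounds U_n - (S - V_n); none of them exceeds any of the upper bounds U_m + (S - V_m). *)
Lemma series_tail (u v : nat -> R) (S : R) :
  (forall k, `|u k| <= v k) -> (forall n, \sum_(k < n) v k <= S) ->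
  exists s, forall n, `|s - \sum_(k < n) u k| <= S - \sum_(k < n) v k.
Proof.
move=> uv vS; pose U n := \sum_(k < n) u k; pose V n := \sum_(k < n) v k.
have UV n m : (n <= m)%N -> `|U m - U n| <= V m - V n.
  move=> nm; rewrite /U /V -!(big_mkord xpredT) !(@big_cat_nat _ _ _ n 0 m)//=.
  rewrite !(addrC (\sum_(0 <= i < n) _)) !addrK.
  by apply: le_trans (ler_norm_sum _ _ _) _; apply: ler_sum.
have cmp n m : U n - (S - V n) <= U m + (S - V m).
  have [nm|/ltnW mn] := leqP n m.
    have := UV _ _ nm; rewrite ler_norml => /andP[h _]; have := vS m.
    by rewrite -/(V m); lra.
  have := UV _ _ mn; rewrite ler_norml => /andP[_ h]; have := vS n.
  by rewrite -/(V n); lra.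
pose A := [set y | exists n, y = U n - (S - V n)]%classic.
have A0 : (A !=set0)%classic by exists (U 0%N - (S - V 0%N)), 0%N.
have Ab m : ubound A (U m + (S - V m)) by move=> _ [n ->]; exact: cmp.
exists (sup A) => n; rewrite ler_norml; apply/andP; split.
  suff : U n - (S - V n) <= sup A by rewrite /U /V; lra.
  by apply: ub_le_sup; [exists (U n + (S - V n))|exists n].
suff : sup A <= U n + (S - V n) by rewrite /U /V; lra.
by apply: ge_sup.
Qed.

(** With nonnegative coefficients the real series at |z| is a majorant of the complex one at z, so
    the partial sums converge uniformly on each disk of radius r < 1. *)
Lemma complexify c (S : R -> R) : (forall k, 0 <= c k) ->
  (forall x, 0 <= x < 1 -> is_sup_sum (fun k => c k * x ^+ k) (S x)) ->
  exists2 f, analytic f & forall x, 0 <= x < 1 -> f x%:C%C = (S x)%:C%C.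
Proof.
move=> c0 hS.
(* Tails grow with the radius, which makes the error bound at |z| uniform over |z| <= r. *)
have tailmono x y n : 0 <= x <= y -> y < 1 ->
    S x - \sum_(k < n) c k * x ^+ k <= S y - \sum_(k < n) c k * y ^+ k.
  move=> /andP[x0 xy] y1; apply: (@lim_le _ _ _ 1) => e e0 _.
  have [_ h2] := hS x (introT andP (conj x0 (le_lt_trans xy y1))).
  have [h1 _] := hS y (introT andP (conj (le_trans x0 xy) y1)).
  have [m hm] := h2 _ e0.
  pose N := maxn n m.
  have hm' : S x - e < \sum_(k < N) c k * x ^+ k.
    apply: lt_le_trans hm _; rewrite -!(big_mkord xpredT (fun k => c k * x ^+ k)).
    rewrite (@big_cat_nat _ _ _ m 0 N)//= ?/N; last by lia.
    by rewrite lerDl sumr_ge0// => i _; rewrite mulr_ge0// exprn_ge0.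
  have := h1 N; move: hm'.
  have hn : (n <= N)%N by rewrite /N; lia.
  rewrite -!(big_mkord xpredT (fun k => c k * x ^+ k)) -!(big_mkord xpredT (fun k => c k * y ^+ k)).
  rewrite !(@big_cat_nat _ _ _ n 0 N)//=.
  have : \sum_(n <= i < N) c i * x ^+ i <= \sum_(n <= i < N) c i * y ^+ i.
    by apply: ler_sum => i _; rewrite ler_wpM2l// lerXn2r// nnegrE// (le_trans x0).
  lra.
have tl z : exists s : C, normc z < 1 -> forall n,
    normc (s - \sum_(k < n) (c k)%:C%C * z ^+ k) <=
    2 * (S (normc z) - \sum_(k < n) c k * normc z ^+ k).
  (* [choice] asks for a value at every z; outside the open unit disk it is 0 and nothing is
     claimed. *)
  have [z1|z1] := ltP (normc z) 1; last by exists 0.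
  have [h1 _] := hS (normc z) (introT andP (conj (normc_ge0 z) z1)).
  have nE k : normc ((c k)%:C%C * z ^+ k) = c k * normc z ^+ k.
    by rewrite normcM normc_real normcX ger0_norm.
  have [a ha] := @series_tail (fun k => complex.Re ((c k)%:C%C * z ^+ k)) _ _
    (fun k => le_trans (Re_le_normc _) (eq_ind_r (fun t => t <= _) (lexx _) (nE k))) h1.
  have [b hb] := @series_tail (fun k => complex.Im ((c k)%:C%C * z ^+ k)) _ _
    (fun k => le_trans (Im_le_normc _) (eq_ind_r (fun t => t <= _) (lexx _) (nE k))) h1.
  exists (a +i* b)%C => _ n; apply: le_trans (normc_le_ReIm _) _.
  have Res : complex.Re (\sum_(k < n) (c k)%:C%C * z ^+ k) =
     \sum_(k < n) complex.Re ((c k)%:C%C * z ^+ k) by exact: (raddf_sum (@complex.Re R : Rcomplex R -> R)).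
  have Ims : complex.Im (\sum_(k < n) (c k)%:C%C * z ^+ k) =
     \sum_(k < n) complex.Im ((c k)%:C%C * z ^+ k) by exact: (raddf_sum (@complex.Im R : Rcomplex R -> R)).
  rewrite mulr_natl mulr2n lerD//.
    apply: le_trans (ha n); rewrite -Res.
    by case: (\sum_(k < n) _) => ? ? /=.
  apply: le_trans (hb n); rewrite -Ims.
  by case: (\sum_(k < n) _) => ? ? /=.
have [f hf] := choice tl; exists f.
  move=> r r1; have [r0|r0] := ltP r 0.
    move=> e e0; exists 0 => z zr; exfalso; move: (normc_ge0 z); rewrite leNgt.
    by rewrite (le_lt_trans zr r0).
  move=> e e0; have e2 : 0 < e / 2 by rewrite divr_gt0.
  have [_ h2] := hS r (introT andP (conj r0 r1)).
  have [n hn] := h2 _ e2.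
  exists (\poly_(k < n) c k) => z zr.
  rewrite (@pevE_wide _ _ _ n) ?size_poly//.
  rewrite (eq_bigr (fun k : 'I_n => (c k)%:C%C * z ^+ k)); last first.
    by move=> k _; rewrite coef_poly ltn_ord.
  apply: le_trans (hf z (le_lt_trans zr r1) n) _.
  have zrr : 0 <= normc z <= r by rewrite normc_ge0.
  have := tailmono _ _ n zrr r1; lra.
move=> x x01; have x0 : 0 <= x by case/andP: x01.
have nx : normc (x%:C)%C = x by rewrite normc_real ger0_norm.
have [_ h2] := hS x x01.
apply/eqP; rewrite -subr_eq0; apply/eqP/eq0_normc/eqP.
rewrite eq_le normc_ge0 andbT; apply: (@lim_le _ _ _ 3) => e e0 _; rewrite add0r.
have [n hn] := h2 _ e0.
have x1 : normc (x%:C)%C < 1 by rewrite nx; case/andP: x01.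
have := hf (x%:C)%C x1 n; rewrite nx.
have -> : \sum_(k < n) (c k)%:C%C * x%:C%C ^+ k = (\sum_(k < n) c k * x ^+ k)%:C%C.
  by rewrite rmorph_sum/=; apply: eq_bigr => k _; rewrite rmorphM rmorphXn.
set P := \sum_(k < n) _ in hn * => h.
have -> : f x%:C%C - (S x)%:C%C = (f x%:C%C - P%:C%C) + (P - S x)%:C%C.
  by rewrite rmorphB/=; ring.
apply: le_trans (le_normcD _ _) _; rewrite normc_real.
have PS : P <= S x by have [h1 _] := hS x x01; exact: h1.
rewrite distrC ger0_norm ?subr_ge0//; lra.
Qed.

End Complexify.

(** * Continuation from the positive half-axis *)

Section Exponential.
Context {R : realType}.
Local Notation C := R[i].
Implicit Types (z w s t h : C) (x y r e : R) (f g : C -> C).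

Lemma expR_quad x : `|x| <= 1 / 2 -> 0 <= expR x - 1 - x <= 2 * x ^+ 2.
Proof.
rewrite ler_norml => /andP[x1 x2]; have h1 := expR_ge1Dx x.
have h2 := expR_ge1Dx (- x); have h3 := expRxMexpNx_1 x.
have h4 := expR_gt0 x; apply/andP; split; first lra.
have h5 : expR x * (1 - x) <= 1.
  by rewrite -[leRHS]h3 ler_pM2l.
have h6 : 1 <= (1 + x + 2 * x ^+ 2) * (1 - x).
  have -> : (1 + x + 2 * x ^+ 2) * (1 - x) = 1 + x ^+ 2 * (1 - 2 * x) by ring.
  by rewrite lerDl mulr_ge0 ?sqr_ge0//; lra.
have h7 : expR x <= 1 + x + 2 * x ^+ 2.
  by rewrite -(@ler_pM2r _ (1 - x)) ?(le_trans h5)//; lra.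
lra.
Qed.

Lemma cos_norm_quad x : `|cos x - 1| <= x ^+ 2 / 2.
Proof.
wlog x0 : x / 0 <= x.
  move=> H; have [/H//|/ltW x0] := lerP 0 x.
  by have := H (- x); rewrite cosN sqrrN oppr_ge0; apply.
rewrite ler_norml; have := cos_ge_quad x0; have := cos_le1 x; have := sqr_ge0 x.
by move=> h1 h2 h3; apply/andP; split; lra.
Qed.

Lemma sin_norm_quad x : `|sin x - x| <= x ^+ 2.
Proof.
wlog x0 : x / 0 <= x.
  move=> H; have [/H//|/ltW x0] := lerP 0 x.
  by have := H (- x); rewrite sinN sqrrN oppr_ge0 -opprD normrN; apply.
rewrite ler_norml; have := sin_ge_quad x0; have := sin_lex x0; have := sqr_ge0 x.
by move=> h1 h2 h3; apply/andP; split; lra.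
Qed.

Lemma cexp_quad h : normc h <= 1 / 2 -> normc (cexp h - 1 - h) <= 4 * normc h ^+ 2.
Proof.
move=> h2; have ha := le_trans (Re_le_normc h) h2; have hb := le_trans (Im_le_normc h) h2.
have : normc h ^+ 2 = complex.Re h ^+ 2 + complex.Im h ^+ 2.
  by case: (h) => a b /=; rewrite sqr_sqrtr ?addr_ge0 ?sqr_ge0.
move=> ->; apply: le_trans (normc_le_ReIm _) _.
case: h {h2} ha hb => a b /= ha hb.
have /andP[e1 e2] := expR_quad ha.
have hc := cos_norm_quad b; have hs := sin_norm_quad b.
have a2 : a ^+ 2 = `|a| ^+ 2 by rewrite real_normK ?num_real.
have b2 : b ^+ 2 = `|b| ^+ 2 by rewrite real_normK ?num_real.
have A0 := normr_ge0 a; have B0 := normr_ge0 b.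
have E2 : expR a <= 2.
  have : a <= 1 / 2 by apply: le_trans (ler_norm _) ha.
  have : `|a| ^+ 2 <= 1 / 4.
    by have := ler_pM A0 A0 ha ha; rewrite -expr2; lra.
  lra.
have E0 := expR_ge0 a.
have h1 : `|expR a * cos b - 1 - a| <= 2 * a ^+ 2 + b ^+ 2.
  have -> : expR a * cos b - 1 - a = (expR a - 1 - a) + expR a * (cos b - 1) by ring.
  apply: le_trans (ler_normD _ _) _; rewrite lerD//; first by rewrite ger0_norm.
  rewrite normrM (ger0_norm E0); have := ler_pM E0 (normr_ge0 _) E2 hc; lra.
have h2 : `|expR a * sin b - b| <= a ^+ 2 + 3 * b ^+ 2.
  have -> : expR a * sin b - b = expR a * (sin b - b) + (expR a - 1) * b by ring.
  apply: le_trans (ler_normD _ _) _; rewrite !normrM (ger0_norm E0).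
  have k1 := ler_pM E0 (normr_ge0 _) E2 hs.
  have k2 : `|expR a - 1| <= 2 * `|a|.
    have -> : expR a - 1 = (expR a - 1 - a) + a by ring.
    apply: le_trans (ler_normD _ _) _; rewrite (ger0_norm e1).
    have : `|a| ^+ 2 <= 1 / 2 * `|a| by rewrite expr2 ler_wpM2r.
    lra.
  have k3 := ler_wpM2r B0 k2.
  have k4 := sqr_ge0 (`|a| - `|b|).
  rewrite sqrrB -mulr_natr in k4; rewrite -mulrA in k3; lra.
rewrite ?oppr0 ?addr0 ?subr0 in h1 h2 *; have := sqr_ge0 a; lra.
Qed.

Lemma normc_pow_sub (z w : C) (K : R) N : 0 <= K -> normc z <= K -> normc w <= K ->
  normc (z ^+ N.+1 - w ^+ N.+1) <= N.+1%:R * (normc (z - w) * K ^+ N).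
Proof.
move=> K0 zK wK; rewrite subrXX normcM mulrCA ler_wpM2l ?normc_ge0//.
apply: le_trans (normc_sum _ _ _) _.
rewrite -[N.+1 in leRHS]card_ord mulr_natl -sumr_const; apply: ler_sum => i _.
rewrite normcM !normcX /=.
rewrite -[in leRHS](subnK (ltnSE (ltn_ord i))) exprD.
by rewrite ler_pM ?exprn_ge0 ?normc_ge0// lerXn2r// nnegrE normc_ge0.
Qed.

(** Euler's limit (1 + g/N)^N is a polynomial in g. By [cexp_quad] and telescoping of the N-th
    powers its error is at most 4 M^2 e^M / N; the two summands of X make this at most e and |g|/N
    at most 1/2. *)
Lemma calA_cexp r g : calA r g -> calA r (fun z => cexp (g z)).
Proof.
move=> cg; have [M M0 hM] := calA_bounded cg.
apply: calA_lim => e e0.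
pose X := 4 * M ^+ 2 * expR M / e + 2 * M.
pose N := Num.truncn X.
have NX : X < N.+1%:R by rewrite /N truncnS_gt.
have X0 : 0 < X by rewrite addr_gt0 ?divr_gt0 ?mulr_gt0 ?exprn_gt0 ?expR_gt0.
have n0 : (0 : R) < N.+1%:R by rewrite ltr0n.
exists (fun z => (1 + (N.+1%:R^-1)%:C%C * g z) ^+ N.+1).
  by apply: calA_exp; apply: calA_add; [exact: (calA_const r 1)|exact: calA_scale].
move=> z /hM gz; set h := (N.+1%:R^-1)%:C%C * g z.
have -> : cexp (g z) = cexp h ^+ N.+1.
  rewrite -cexpMn; congr cexp; rewrite /h -mulrnAl -rmorphMn/=.
  by rewrite -[X in X%:C%C]mulr_natr mulVf ?gt_eqF// rmorph1 mul1r.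
have hM' : normc h <= M / N.+1%:R.
  rewrite normcM normc_real gtr0_norm ?invr_gt0// mulrC.
  by rewrite ler_wpM2r// invr_ge0 ltW.
have MN : M / N.+1%:R <= 1 / 2.
  rewrite ler_pdivrMr//; move: NX; rewrite /X.
  have : 0 < 4 * M ^+ 2 * expR M / e by rewrite divr_gt0 ?mulr_gt0 ?exprn_gt0 ?expR_gt0.
  lra.
have k1 := cexp_quad (le_trans hM' MN).
have K1 : normc (cexp h) <= expR (M / N.+1%:R).
  rewrite normc_cexp ler_expR (le_trans (ler_norm _))// (le_trans (Re_le_normc _))//.
have K2 : normc (1 + h) <= expR (M / N.+1%:R).
  apply: le_trans (le_normcD _ _) _; rewrite normc1.
  by apply: le_trans (expR_ge1Dx _); rewrite lerD2l.
apply: le_trans (normc_pow_sub _ (expR_ge0 _) K1 K2) _.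
rewrite opprD addrA in k1 *.
apply: le_trans (_ : N.+1%:R * (4 * (M / N.+1%:R) ^+ 2 * expR M) <= _).
  rewrite ler_wpM2l ?(ltW n0)// ler_pM ?normc_ge0 ?exprn_ge0 ?expR_ge0//.
    apply: le_trans k1 _; rewrite ler_wpM2l// lerXn2r ?nnegrE ?normc_ge0//.
    by rewrite divr_ge0 ?(ltW M0)// ltW.
  rewrite -expRM_natl ler_expR mulrCA -[leRHS]mulr1 ler_wpM2l ?(ltW M0)//.
  by rewrite ler_pdivrMr// mul1r ler_nat.
have -> : N.+1%:R * (4 * (M / N.+1%:R) ^+ 2 * expR M) = 4 * M ^+ 2 * expR M / N.+1%:R.
  by field; rewrite gt_eqF.
have : 4 * M ^+ 2 * expR M / e <= N.+1%:R.
  by rewrite ltW// (le_lt_trans _ NX)// /X lerDl mulr_ge0// ltW.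
by move=> hN; rewrite ler_pdivrMr// [e * _]mulrC -ler_pdivrMr.
Qed.

End Exponential.

(** * Cayley transform: from the unit disk to the right half-plane *)

Section Cayley.
Context {R : realType}.
Local Notation C := R[i].
Implicit Types (z w s t h : C) (x y r e : R) (f g A B : C -> C).

(** Carries the unit disk onto Re t > 0, where the functional equations live. The inversion of t
    becomes s -> -s, which preserves every disk. *)
Definition cayley s : C := (1 + s) / (1 - s).

Lemma normc_1sub r s : normc s <= r -> 1 - r <= normc (1 - s).
Proof.
move=> sr; rewrite lerBlDr -[leLHS](@normc1 R) -[X in normc X](subrK s).
by apply: le_trans (le_normcD _ _) _; rewrite lerD2l.
Qed.

Lemma sub1_neq0 s : normc s < 1 -> 1 - s != 0.
Proof.
move=> s1; apply/eqP => h; have := normc_1sub (lexx (normc s)).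
by rewrite h normc0 subr_le0 leNgt s1.
Qed.

Lemma calA_inv1sub r : r < 1 -> calA r (fun s => (1 - s)^-1).
Proof.
move=> r1; have [r0|r0] := ltP r 0.
  apply: calA_ext (@calA_const _ r 0) => z zr; exfalso.
  by move: (normc_ge0 z); rewrite leNgt (le_lt_trans zr r0).
apply: calA_lim => e e0.
have r1' : 0 < 1 - r by rewrite subr_gt0.
have [n hn] := @expn_lt_eps R r (e * (1 - r)) (introT andP (conj r0 r1)) (mulr_gt0 e0 r1').
exists (fun s => pev (\poly_(k < n) 1) s); first by apply: calA_pev; exact: calA_id.
move=> z zr; have z1 := sub1_neq0 (le_lt_trans zr r1).
rewrite (@pevE_wide _ _ _ n) ?size_poly//.
rewrite (eq_bigr (fun k : 'I_n => z ^+ k)) => [|k _]; last first.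
  by rewrite coef_poly ltn_ord rmorph1 mul1r.
have -> : (1 - z)^-1 - \sum_(k < n) z ^+ k = z ^+ n / (1 - z).
  apply: (mulIf z1); rewrite mulrBl mulVf// divfK// -[z ^+ n]opprK.
  apply/eqP; rewrite subr_eq addrC -subr_eq opprK.
  have := subrX1 z n => h; rewrite [X in _ == X](_ : _ = - ((z - 1) * \sum_(i < n) z ^+ i)); last by ring.
  by rewrite -h; apply/eqP; ring.
have rz := normc_1sub zr.
rewrite normcM normcV normcX ler_pdivrMr; last exact: lt_le_trans rz.
apply: le_trans (_ : e * (1 - r) <= _); last by rewrite ler_pM2l.
by apply: le_trans (ltW hn); rewrite lerXn2r// nnegrE ?normc_ge0.
Qed.

Lemma cayleyE s : normc s < 1 -> cayley s = 2 * (1 - s)^-1 - 1.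
Proof. by move=> /sub1_neq0 h; rewrite /cayley; field. Qed.

Lemma calA_cayley r : r < 1 -> calA r cayley.
Proof.
move=> r1; apply: (@calA_ext _ r (fun s => 2%:C%C * (1 - s)^-1 - 1%:C%C)).
  by move=> z zr; rewrite cayleyE ?(le_lt_trans zr)// rmorph1 rmorph_nat.
by apply: calA_sub2; [apply: calA_scale; exact: calA_inv1sub|exact: calA_const].
Qed.

Lemma Re_inv1sub r s : 0 <= r < 1 -> normc s <= r -> 1 / (1 + r) <= complex.Re ((1 - s)^-1).
Proof.
move=> /andP[r0 r1]; case: s => a b sr.
have h : a ^+ 2 + b ^+ 2 <= r ^+ 2.
  have : normc (a +i* b)%C ^+ 2 <= r ^+ 2.
    by rewrite lerXn2r ?nnegrE ?normc_ge0.
  by rewrite /= sqr_sqrtr// addr_ge0 ?sqr_ge0.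
have ra : `|a| <= r by apply: le_trans sr; exact: (Re_le_normc (a +i* b)%C).
rewrite ler_norml in ra; case/andP: ra => ra1 ra2.
rewrite /= sub0r sqrrN.
have d0 : 0 < (1 - a) ^+ 2 + b ^+ 2.
  by rewrite ltr_wpDr ?sqr_ge0// exprn_gt0//; lra.
rewrite ler_pdivrMr; last lra.
rewrite mulrAC ler_pdivlMr// mul1r.
have : 0 <= (r + a) * (1 - r) by rewrite mulr_ge0; lra.
rewrite !expr2 in h *; lra.
Qed.

Lemma Re_cayley r s : 0 <= r < 1 -> normc s <= r ->
  (1 - r) / (1 + r) <= complex.Re (cayley s).
Proof.
move=> r01 sr; have := Re_inv1sub r01 sr; case/andP: r01 => r0 r1.
rewrite cayleyE ?(le_lt_trans sr)//.
have -> : complex.Re (2 * (1 - s)^-1 - 1) = 2 * complex.Re (1 - s)^-1 - 1.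
  by case: ((1 - s)^-1) => a b /=; rewrite ?mul0r ?subr0; ring.
have -> : (1 - r) / (1 + r) = 2 * (1 / (1 + r)) - 1 by field; apply/eqP => h; lra.
lra.
Qed.

Lemma calA_exp_cayley r y : r < 1 -> calA r (fun s => cexp (y%:C%C * cayley s)).
Proof. by move=> r1; apply: calA_cexp; apply: calA_scale; exact: calA_cayley. Qed.

(** On |s| <= r the real part of [cayley s] is at least (1-r)/(1+r), so the argument of f stays in a
    disk of radius q < 1. *)
Lemma analytic_exp_cayley r y f : r < 1 -> 0 < y -> analytic f ->
  calA r (fun s => f (cexp (- (y%:C%C * cayley s)))).
Proof.
move=> r1 y0 hf; have [r0|r0] := ltP r 0.
  apply: calA_ext (@calA_const _ r 0) => z zr; exfalso.
  by move: (normc_ge0 z); rewrite leNgt (le_lt_trans zr r0).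
pose q := expR (- (y * ((1 - r) / (1 + r)))).
have q1 : q < 1.
  by rewrite expR_lt1 oppr_lt0 mulr_gt0// divr_gt0 ?subr_gt0// ltr_wpDr.
apply: (@calA_comp _ r q).
- exact: hf.
- apply: calA_ext (calA_exp_cayley (- y) r1) => z _.
  by rewrite rmorphN/= mulNr.
- move=> z zr; rewrite normc_cexp /q ler_expR.
  have -> : complex.Re (- (y%:C%C * cayley z)) = - (y * complex.Re (cayley z)).
    by case: (cayley z) => a b /=; rewrite mul0r subr0.
  by rewrite lerN2 ler_pM2l// Re_cayley// r0.
Qed.

Lemma cayleyN s : cayley (- s) = (cayley s)^-1.
Proof. by rewrite /cayley opprK invf_div. Qed.

Lemma cayley_ex t : 0 < complex.Re t -> exists2 s, normc s < 1 & cayley s = t.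
Proof.
case: t => a b /= a0; set t := (a +i* b)%C.
have t1 : t + 1 != 0 by rewrite eq_complex /= gt_eqF// ltr_wpDr.
exists ((t - 1) / (t + 1)); last first.
  have two : (2 : C) != 0 by rewrite pnatr_eq0.
  have h : 1 - (t - 1) / (t + 1) = 2 / (t + 1) by field.
  by rewrite /cayley h; field; rewrite t1.
rewrite normcM normcV ltr_pdivrMr; last first.
  by rewrite lt_neqAle normc_ge0 andbT eq_sym; apply: contra t1 => /eqP/eq0_normc ->.
rewrite mul1r /= ltr_sqrt; last first.
  by rewrite ltr_wpDr ?sqr_ge0// exprn_gt0// ltr_wpDr.
rewrite oppr0 !addr0 ltrD2r !expr2; nra.
Qed.

(** The equation is squared because y^(n/2) would call for a branch when n is odd; B is taken at
    e^(-pi y/4) because shadow series run in powers of q^(1/4). Multiplied by (1 - s)^n, the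
    difference E of the two sides is analytic in s and vanishes on a real segment. *)
Lemma analytic_continuation A B n : analytic A -> analytic B ->
  (forall y, 0 < y -> A (expR (- (pi / y)))%:C%C ^+ 2 =
      (y%:C%C) ^+ n * B (expR (- (pi / 4 * y)))%:C%C ^+ 2) ->
  forall t, 0 < complex.Re t -> A (cexp (- (pi%:C%C / t))) ^+ 2 =
      t ^+ n * B (cexp (- ((pi / 4)%:C%C * t))) ^+ 2.
Proof.
move=> hA hB h t /cayley_ex[s s1 <-].
pose r := (normc s + 1) / 2.
have sr : normc s < r by rewrite /r ltr_pdivlMr// mulr_natr mulr2n ltrD2l.
have r1 : r < 1 by rewrite /r ltr_pdivrMr// mul1r; have := s1; lra.
have r0 : 0 < r by apply: le_lt_trans sr; exact: normc_ge0.
pose E s := A (cexp (- (pi%:C%C * cayley (- s)))) ^+ 2 * (1 - s) ^+ n -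
  (1 + s) ^+ n * B (cexp (- ((pi / 4)%:C%C * cayley s))) ^+ 2.
have cE : calA r E.
  have c1 : calA r (fun s => A (cexp (- (pi%:C%C * cayley (- s))))).
    apply: (@calA_comp _ r r (fun s => A (cexp (- (pi%:C%C * cayley s)))) (fun s => - s)).
    - by apply: analytic_exp_cayley; rewrite ?pi_gt0.
    - by apply: calA_opp; exact: calA_id.
    - by move=> z; rewrite normcN.
  have p4 : 0 < (pi : R) / 4 by rewrite divr_gt0 ?pi_gt0.
  have c2 := analytic_exp_cayley r1 p4 hB.
  have c3 : calA r (fun s => 1 - s).
    by apply: calA_sub2; [exact: (calA_const r 1)|exact: calA_id].
  have c4 : calA r (fun s => 1 + s).
    by apply: calA_add; [exact: (calA_const r 1)|exact: calA_id].
  by apply: calA_sub2; apply: calA_mul; apply: calA_exp.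
have E0 : E s = 0.
  apply: (calA_identity r0 cE r0) => // x /andP[x0 xr].
  have x1 : x < 1 := lt_trans xr r1.
  pose y := (1 + x) / (1 - x).
  have y0 : 0 < y by rewrite divr_gt0//; lra.
  have cy : cayley x%:C%C = y%:C%C.
    by rewrite /cayley /y rmorphM fmorphV rmorphB rmorphD rmorph1.
  rewrite /E cayleyN cy -fmorphV -!rmorphM -!rmorphN/= !cexp_real h//.
  have x1C : 1 - x%:C%C != 0 :> C.
    by apply: sub1_neq0; rewrite normc_real gtr0_norm.
  have -> : 1 + x%:C%C = y%:C%C * (1 - x%:C%C) :> C by rewrite -cy /cayley divfK.
  by rewrite exprMn rmorphN [X in X - _]mulrAC subrr.
have s1n : (1 - s) ^+ n != 0 by rewrite expf_neq0// sub1_neq0.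
move/eqP: E0; rewrite subr_eq0 => /eqP E0; apply: (mulIf s1n).
rewrite -cayleyN E0 /cayley expr_div_n mulrAC divfK//.
Qed.

End Cayley.

(** * Moduli of the continued equations, and numerical estimates *)

Section Vanishing.
Context {R : realType}.
Local Notation C := R[i].
Implicit Types (z w t : C) (x y r e : R) (f : C -> C).

(** The nome e^(pi i tau) at tau = i t: Re t plays the role of Im tau, and real shifts of tau are
    imaginary shifts of t. *)
Definition qpi t : C := cexp (- (pi%:C%C * t)).

Lemma Re_rmul x t : complex.Re (x%:C%C * t) = x * complex.Re t.
Proof. by case: t => a b /=; rewrite mul0r subr0. Qed.

Lemma normc_qpi t : normc (qpi t) = expR (- (pi * complex.Re t)).
Proof. by rewrite normc_cexp raddfN/= Re_rmul. Qed.

Lemma qpi_real x : qpi x%:C%C = (expR (- (pi * x)))%:C%C.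
Proof. by rewrite /qpi -rmorphM -rmorphN cexp_real. Qed.

Lemma qpi_quarter t : cexp (- ((pi / 4)%:C%C * t)) ^+ 4 = qpi t.
Proof.
rewrite -cexpMn /qpi; congr cexp; rewrite mulNrn -mulrnAl -rmorphMn/=.
by congr (- (_%:C%C * t)); rewrite -[_ *+ 4]mulr_natr divfK// pnatr_eq0.
Qed.

Lemma Re_invc t : complex.Re t^-1 = complex.Re t / normc t ^+ 2.
Proof. by case: t => a b /=; rewrite sqr_sqrtr// addr_ge0// sqr_ge0. Qed.

Lemma neq0_of_Re t : 0 < complex.Re t -> t != 0.
Proof. by move=> t0; apply: contraTneq t0 => -> /=; rewrite ltxx. Qed.

Lemma normc_gt0_Re t : 0 < complex.Re t -> 0 < normc t.
Proof.
by move=> t0; apply: lt_le_trans (le_trans (ler_norm _) (Re_le_normc t)).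
Qed.

Lemma Re_inv_gt0 t : 0 < complex.Re t -> 0 < complex.Re t^-1.
Proof. by move=> t0; rewrite Re_invc divr_gt0// exprn_gt0// normc_gt0_Re. Qed.

(** Only moduli are kept from here on; they do not see roots of unity, and they are what the
    invariance of [Phi] is about. *)
Lemma analytic_normc f g n : analytic f -> analytic g ->
  (forall y, 0 < y -> f (expR (- (pi / y)))%:C%C ^+ 2 =
      (y%:C%C) ^+ n * g (expR (- (pi / 4 * y)))%:C%C ^+ 2) ->
  forall t, 0 < complex.Re t -> normc (f (qpi t^-1)) ^+ 2 =
      normc t ^+ n * normc (g (cexp (- ((pi / 4)%:C%C * t)))) ^+ 2.
Proof.
move=> hf hg h t t0; have := analytic_continuation hf hg h t0.
by move/(congr1 (@normc R)); rewrite normcX => ->; rewrite [LHS]normcM !normcX.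
Qed.

Lemma analytic_pow f k : analytic f -> analytic (fun z => f (z ^+ k.+1)).
Proof.
move=> hf r r1; have [r0|r0] := ltP r 0.
  apply: calA_ext (@calA_const _ r 0) => z zr; exfalso.
  by move: (normc_ge0 z); rewrite leNgt (le_lt_trans zr r0).
apply: (@calA_comp _ r r f (fun z => z ^+ k.+1)); first exact: hf.
  by apply: calA_exp; exact: calA_id.
move=> z zr; rewrite normcX; apply: le_trans (_ : r ^+ k.+1 <= _).
  by rewrite lerXn2r// nnegrE normc_ge0.
by rewrite exprS ler_piMr// exprn_ile1// ltW.
Qed.

Lemma analyticN f : analytic f -> analytic (fun z => f (- z)).
Proof.
move=> hf r r1; apply: (@calA_comp _ r r f (fun z => - z)); first exact: hf.
  by apply: calA_opp; exact: calA_id.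
by move=> z; rewrite normcN.
Qed.

Lemma analyticM f g : analytic f -> analytic g -> analytic (fun z => f z * g z).
Proof. by move=> hf hg r r1; apply: calA_mul; [exact: hf|exact: hg]. Qed.

Lemma analytic_id : analytic (fun z => z).
Proof. by move=> r _; exact: calA_id. Qed.

Lemma analyticX f k : analytic f -> analytic (fun z => f z ^+ k).
Proof. by move=> hf r r1; apply: calA_exp; exact: hf. Qed.

Lemma analyticD f g : analytic f -> analytic g -> analytic (fun z => f z + g z).
Proof. by move=> hf hg r r1; apply: calA_add; [exact: hf|exact: hg]. Qed.

Lemma analyticB f g : analytic f -> analytic g -> analytic (fun z => f z - g z).
Proof. by move=> hf hg r r1; apply: calA_sub2; [exact: hf|exact: hg]. Qed.

Lemma analyticZ x f : analytic f -> analytic (fun z => x%:C%C * f z).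
Proof. by move=> hf r r1; apply: calA_scale; exact: hf. Qed.

Lemma polar z : exists u, z = (normc z)%:C%C * cis u.
Proof.
have [->|z0] := eqVneq z 0; first by exists 0; rewrite normc0 mul0r.
have n0 : 0 < normc z.
  by rewrite lt_neqAle normc_ge0 andbT eq_sym; apply: contra z0 => /eqP/eq0_normc ->.
have n2 : normc z ^+ 2 = complex.Re z ^+ 2 + complex.Im z ^+ 2.
  by case: (z) => a b /=; rewrite sqr_sqrtr ?addr_ge0 ?sqr_ge0.
pose a := complex.Re z / normc z; pose b := complex.Im z / normc z.
have ab : a ^+ 2 + b ^+ 2 = 1.
  by rewrite /a /b !expr_div_n -mulrDl -n2 divff// expf_neq0// gt_eqF.
have zE : z = (normc z)%:C%C * (a +i* b)%C.
  rewrite /a /b; case: (z) n0 => c d n0; apply/eqP; rewrite eq_complex /=.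
  by rewrite !mul0r subr0 addr0 !(mulrC _ (_ / _)) !divfK ?eqxx ?gt_eqF.
have a1 : -1 <= a <= 1.
  have : a ^+ 2 <= 1 by rewrite -ab lerDl sqr_ge0.
  rewrite -(real_normK (num_real a)) => h; rewrite -ler_norml.
  by rewrite -(@ler_pXn2r _ 2%N) ?nnegrE// expr1n.
suff [u hu] : exists u, cos u = a /\ sin u = b.
  by exists u; rewrite cisE hu.1 hu.2.
have [b0|b0] := leP 0 b.
  exists (acos a); rewrite acosK ?in_itv//= sin_acos//; split=> //.
  by rewrite (_ : 1 - a ^+ 2 = b ^+ 2) ?sqrtr_sqr ?ger0_norm// -ab; ring.
exists (- acos a); rewrite cosN sinN acosK ?in_itv//= sin_acos//; split=> //.
rewrite (_ : 1 - a ^+ 2 = b ^+ 2) ?sqrtr_sqr ?ltr0_norm ?opprK// -ab; ring.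
Qed.

(** 0.1275 is a lower bound for (3.1 / 4) * 0.19 * 0.866, the exponent occurring in [Phi_contract];
    0.882 results from (1 + x/8)^8 <= e^x. *)
Lemma expR_neg_le x : (12 / 100 + 75 / 100 / 100) <= x -> expR (- x) <= (88 / 100 + 2 / 10 / 100).
Proof.
move=> hx; have h : 1 + x / 8 <= expR (x / 8) := expR_ge1Dx _.
have h0 : (101 / 100 + 59 / 100 / 100) <= expR (x / 8) by apply: le_trans h; lra.
have h2 : (103 / 100 + 2 / 10 / 100) <= expR (x / 8) ^+ 2.
  by rewrite expr2; apply: le_trans (ler_pM _ _ h0 h0); lra.
have h4 : (106 / 100 + 5 / 10 / 100) <= expR (x / 8) ^+ 4.
  by rewrite (exprM _ 2 2) [X in _ <= X]expr2; apply: le_trans (ler_pM _ _ h2 h2); lra.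
have h8 : (113 / 100 + 4 / 10 / 100) <= expR x.
  have -> : expR x = expR (x / 8) ^+ 8 by rewrite -expRM_natr divfK// pnatr_eq0.
  by rewrite (exprM _ 4 2) [X in _ <= X]expr2; apply: le_trans (ler_pM _ _ h4 h4); lra.
rewrite expRN -[leLHS]mul1r ler_pdivrMr ?expR_gt0//; lra.
Qed.

(** The square of this factor is what [Phi] shrinks by in one step. As (10/9)^3 D^2 may exceed 1,
    the worst case is n = 23, where the bounds below give 0.621 against 0.625; hence the close
    rounding. *)
Lemma contraction_factor (D : R) n : (16 <= n <= 23)%N -> 0 <= D <= (88 / 100 + 2 / 10 / 100) ->
  (10 / 9) ^+ (3 * n) * D ^+ (2 * n + 16) <= 99 / 100 * (1 - D ^+ 8).
Proof.
move=> /andP[n16 n23] /andP[D0 D1].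
have d2 : D ^+ 2 <= (77 / 100 + 8 / 10 / 100).
  by rewrite expr2; apply: le_trans (ler_pM D0 D0 D1 D1) _; lra.
have D20 : 0 <= D ^+ 2 by rewrite exprn_ge0.
have d4 : D ^+ 4 <= (60 / 100 + 6 / 10 / 100).
  by rewrite (exprM _ 2 2) [X in X <= _]expr2; apply: le_trans (ler_pM D20 D20 d2 d2) _; lra.
have D40 : 0 <= D ^+ 4 by rewrite exprn_ge0.
have d8 : D ^+ 8 <= (36 / 100 + 8 / 10 / 100).
  by rewrite (exprM _ 4 2) [X in X <= _]expr2; apply: le_trans (ler_pM D40 D40 d4 d4) _; lra.
have D80 : 0 <= D ^+ 8 by rewrite exprn_ge0.
have d16 : D ^+ 16 <= (13 / 100 + 6 / 10 / 100).
  by rewrite (exprM _ 8 2) [X in X <= _]expr2; apply: le_trans (ler_pM D80 D80 d8 d8) _; lra.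
pose a : R := (106 / 100 + 8 / 10 / 100); have a0 : 0 <= a by rewrite /a; lra.
have a2 : a ^+ 2 <= (114 / 100 + 1 / 10 / 100) by rewrite /a expr2; lra.
have a20 : 0 <= a ^+ 2 by rewrite exprn_ge0.
have a4 : a ^+ 4 <= (130 / 100 + 2 / 10 / 100).
  by rewrite (exprM _ 2 2) [X in X <= _]expr2; apply: le_trans (ler_pM a20 a20 a2 a2) _; lra.
have a40 : 0 <= a ^+ 4 by rewrite exprn_ge0.
have a8 : a ^+ 8 <= (169 / 100 + 6 / 10 / 100).
  by rewrite (exprM _ 4 2) [X in X <= _]expr2; apply: le_trans (ler_pM a40 a40 a4 a4) _; lra.
have a80 : 0 <= a ^+ 8 by rewrite exprn_ge0.
have a16 : a ^+ 16 <= (287 / 100 + 7 / 10 / 100).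
  by rewrite (exprM _ 8 2) [X in X <= _]expr2; apply: le_trans (ler_pM a80 a80 a8 a8) _; lra.
have a160 : 0 <= a ^+ 16 by rewrite exprn_ge0.
have a20' : a ^+ 20 <= (374 / 100 + 6 / 10 / 100).
  by rewrite (exprD _ 16 4); apply: le_trans (ler_pM a160 a40 a16 a4) _; lra.
have a200 : 0 <= a ^+ 20 by rewrite exprn_ge0.
have a22 : a ^+ 22 <= (427 / 100 + 5 / 10 / 100).
  by rewrite (exprD _ 20 2); apply: le_trans (ler_pM a200 a20 a20' a2) _; lra.
have a23 : a ^+ 23 <= (456 / 100 + 6 / 10 / 100) by rewrite exprSr /a in a22 *; lra.
have hA : (10 / 9) ^+ 3 * D ^+ 2 <= a by rewrite /a !exprS expr0; lra.
have hA0 : 0 <= (10 / 9) ^+ 3 * D ^+ 2 by rewrite mulr_ge0// exprn_ge0//; lra.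
have -> : (10 / 9) ^+ (3 * n) * D ^+ (2 * n + 16) = ((10 / 9) ^+ 3 * D ^+ 2) ^+ n * D ^+ 16.
  by rewrite exprD !exprM mulrA -exprMn.
have h1 : ((10 / 9) ^+ 3 * D ^+ 2) ^+ n <= (456 / 100 + 6 / 10 / 100).
  apply: le_trans a23; apply: le_trans (_ : a ^+ n <= _).
    by rewrite lerXn2r// nnegrE.
  by rewrite ler_weXn2l// /a; lra.
have D160 : 0 <= D ^+ 16 by rewrite exprn_ge0.
have := ler_pM (exprn_ge0 n hA0) D160 h1 d16; lra.
Qed.

End Vanishing.

(** * Vanishing of a form with too many zeros *)

(** Here m = |t| and y = Re t; a, b, g are the moduli of the three transforms at t, and e that of
    the power of q^(1/4) attached to the third; primes refer to 1/t. Inversion fixes the first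
    transform and exchanges the other two. *)
Lemma inversion_algebra (F : fieldType) (m y a b g e a' b' g' e' : F) n : m != 0 ->
  a' ^+ 2 = m ^+ n * a ^+ 2 -> b' ^+ 2 = m ^+ n * (e * g) ^+ 2 ->
  b ^+ 2 = m^-1 ^+ n * (e' * g') ^+ 2 ->
  (y / m ^+ 2) ^+ (3 * n) * (a' * b' * g') ^+ 4 * e' ^+ 4 =
  y ^+ (3 * n) * (a * b * g) ^+ 4 * e ^+ 4.
Proof.
move=> m0 h1 h2 h3.
have -> : (y / m ^+ 2) ^+ (3 * n) * (a' * b' * g') ^+ 4 * e' ^+ 4 =
  (y / m ^+ 2) ^+ (3 * n) * (a' ^+ 2 * b' ^+ 2 * (e' * g') ^+ 2) ^+ 2 by ring.
have h3' : (e' * g') ^+ 2 = m ^+ n * b ^+ 2.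
  by rewrite h3 mulrA exprVn divff ?mul1r// expf_neq0.
rewrite h1 h2 h3' expr_div_n -exprM.
have -> : (m ^+ n * a ^+ 2 * (m ^+ n * (e * g) ^+ 2) * (m ^+ n * b ^+ 2)) ^+ 2 =
  m ^+ (2 * (3 * n)) * ((a * b * g) ^+ 4 * e ^+ 4).
  by rewrite [m ^+ (2 * (3 * n))](_ : _ = (m ^+ n) ^+ 6); [ring|rewrite -exprM; congr (_ ^+ _); lia].
by rewrite mulrA divfK ?expf_neq0// mulrA.
Qed.

Section Contraction.
Context {R : realType}.
Local Notation C := R[i].
Implicit Types (z w t : C) (x y r e : R) (f : C -> C).

Variables (n : nat) (G1 G3 : C -> C) (B d : R).
Hypothesis n1623 : (16 <= n <= 23)%N.
Hypothesis aG1 : analytic G1.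
Hypothesis aG3 : analytic G3.
Hypothesis d0 : 0 < d.
Hypothesis G1_order : forall x, 0 < `|x| < d -> normc (G1 x%:C%C) <= B * `|x| ^+ 3.
Hypothesis G1_inv : forall y, 0 < y ->
  G1 (expR (- (pi / y)))%:C%C ^+ 2 = y%:C%C ^+ n * G1 (expR (- (pi * y)))%:C%C ^+ 2.
Hypothesis G1N_inv : forall y, 0 < y ->
  G1 (- (expR (- (pi / y)))%:C%C) ^+ 2 = y%:C%C ^+ n *
   ((expR (- (pi / 4 * y)))%:C%C ^+ (n - 16) * G3 (expR (- (pi * y)))%:C%C) ^+ 2.
Hypothesis G3_even : forall z, G3 (- z) = G3 z.

(** One factor for each coset of the theta group in the modular group. Inversion fixes the first and
    exchanges the other two, up to q^((n-16)/4); translation exchanges the first two and fixes the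
    third. *)
Let P z := G1 z * G1 (- z) * G3 z.

Let aP : analytic P.
Proof. by apply: analyticM => //; apply: analyticM => //; exact: analyticN. Qed.

Let PN z : P (- z) = P z.
Proof. by rewrite /P opprK G3_even [X in X * _]mulrC. Qed.

Let P_order : exists B' d', 0 < d' /\
  forall x, 0 < x < d' -> normc (P x%:C%C) <= B' * x ^+ 6.
Proof.
have [M M0 hM] := calA_bounded (@aG3 (1 / 2) ltac:(lra)).
exists (B * B * M), (Num.min d (1 / 2)); split; first by rewrite lt_min d0/=; lra.
move=> x /andP[x0]; rewrite lt_min => /andP[xd x2].
have h1 := @G1_order x; rewrite gtr0_norm// x0 xd in h1.
have h2 := @G1_order (- x); rewrite normrN gtr0_norm// x0 xd in h2.
have h3 : normc (G3 x%:C%C) <= M by apply: hM; rewrite normc_real gtr0_norm// ltW.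
rewrite /P normcM normcM -rmorphN/=.
have -> : B * B * M * x ^+ 6 = (B * x ^+ 3) * (B * x ^+ 3) * M by ring.
by rewrite ler_pM ?mulr_ge0 ?normc_ge0// ler_pM ?normc_ge0//; [exact: h1|exact: h2].
Qed.

Let P_bound r M z : 0 < r < 1 -> (forall w, normc w = r -> normc (P w) <= M) ->
  normc z < r ->
  normc (P z) ^+ 2 <= M ^+ 2 * ((normc z / r) ^+ 2) ^+ 6 / (1 - (normc z / r) ^+ 2).
Proof.
move=> /andP[r0 r1] hM zr; have [c hc] := calA_coefs r0 (aP r1).
apply: (max_vanish r0 (aP r1) hc) => // i i6.
have [B' [d' [d'0 h]]] := P_order.
exact: (coefs_zero_order r0 (aP r1) hc d'0 h).
Qed.

(** For a form f of weight k, (Im tau)^(k/2) |f| is invariant. Here k = 3n/2, and the fourth power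
    turns the factor q^((n-16)/4) of the third transform into an integral power of |q|. *)
Definition Phi t := complex.Re t ^+ (3 * n) * normc (P (qpi t)) ^+ 4 *
  expR (- (pi * complex.Re t)) ^+ (n - 16).

Let Phi_ge0 t : 0 <= complex.Re t -> 0 <= Phi t.
Proof.
move=> t0; rewrite /Phi mulr_ge0 ?exprn_ge0 ?expR_ge0//.
by rewrite mulr_ge0// exprn_ge0// normc_ge0.
Qed.

Let qpiD t (b : bool) : qpi (t + (0 +i* (if b then 1 else -1))%C) = - qpi t.
Proof.
rewrite /qpi mulrDr opprD cexpD.
pose u : R := if b then - pi else pi.
have -> : cexp (- (pi%:C%C * (0 +i* (if b then 1 else -1))%C)) = cis u :> C.
  rewrite /cis; congr cexp; apply/eqP; rewrite eq_complex /= /u; clear u.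
  by case: b; rewrite ?mulr1 ?mulrN1 ?opprK !mul0r mulr0 ?subrr ?subr0 ?addr0 ?oppr0 ?opprK !eqxx.
suff -> : cis u = -1 :> C by rewrite mulrN1.
rewrite /u; clear u.
by case: b; rewrite cisE ?cosN ?sinN cospi sinpi ?oppr0; apply/eqP; rewrite eq_complex /= ?oppr0 !eqxx.
Qed.

Let Phi_shift1 t (b : bool) : Phi (t + (0 +i* (if b then 1 else -1))%C) = Phi t.
Proof. by rewrite /Phi qpiD PN; congr (_ ^+ _ * _ * expR (- (_ * _)) ^+ _); case: t => a c /=; rewrite addr0. Qed.

Let Phi_shift t : exists2 t', `|complex.Im t'| <= 1 / 2 &
  complex.Re t' = complex.Re t /\ Phi t' = Phi t.
Proof.
have iter (b : bool) (m : nat) s : Phi (s + (0 +i* ((if b then 1 else -1) *+ m))%C) = Phi s.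
  elim: m => [|m ih]; first by rewrite mulr0n addr0.
  rewrite mulrSr.
  have -> : s + (0 +i* ((if b then 1 else -1) *+ m + (if b then 1 else -1)))%C =
    (s + (0 +i* ((if b then 1 else -1) *+ m))%C) + (0 +i* (if b then 1 else -1))%C.
    by rewrite -addrA; congr (_ + _); apply/eqP; rewrite eq_complex /= addr0 !eqxx.
  by rewrite Phi_shift1.
have iterz (m : int) s : Phi (s + (0 +i* m%:~R)%C) = Phi s.
  case: m => m; first by have := iter true m s.
  by have := iter false m.+1 s; rewrite mulNrn NegzE mulrNz.
pose m := - Num.floor (complex.Im t + 1 / 2).
exists (t + (0 +i* m%:~R)%C); last first.
  by rewrite iterz; split=> //; case: (t) => a b /=; rewrite addr0.
have -> : complex.Im (t + (0 +i* m%:~R)%C) = complex.Im t + m%:~R by case: (t).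
rewrite /m mulrNz; have := floor_itv (complex.Im t + 1 / 2).
by rewrite intrD => /andP[h1 h2]; rewrite ler_norml; apply/andP; split; lra.
Qed.

Let G1_normc t : 0 < complex.Re t ->
  normc (G1 (qpi t^-1)) ^+ 2 = normc t ^+ n * normc (G1 (qpi t)) ^+ 2.
Proof.
move=> t0; have := @analytic_normc _ G1 (fun z => G1 (z ^+ 4)) n aG1 _ _ t t0.
rewrite qpi_quarter; apply; first exact: analytic_pow.
move=> y y0; rewrite G1_inv//; congr (_ * G1 _ ^+ 2).
by rewrite -rmorphXn/= -expRM_natr; congr (expR _)%:C%C; field.
Qed.

Let G1N_normc t : 0 < complex.Re t ->
  normc (G1 (- qpi t^-1)) ^+ 2 = normc t ^+ n *
   (normc (cexp (- ((pi / 4)%:C%C * t))) ^+ (n - 16) * normc (G3 (qpi t))) ^+ 2.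
Proof.
move=> t0; rewrite -[normc (cexp _) ^+ _]normcX -normcM.
have := @analytic_normc _ (fun z => G1 (- z)) (fun z => z ^+ (n - 16) * G3 (z ^+ 4)) n
  (analyticN aG1) _ _ t t0.
rewrite qpi_quarter; apply.
  by apply: analyticM; [apply: analyticX; exact: analytic_id|exact: analytic_pow].
move=> y y0; rewrite G1N_inv//; congr (_ * (_ * G3 _) ^+ 2).
by rewrite -rmorphXn/= -expRM_natr; congr (expR _)%:C%C; field.
Qed.

Let Phi_inv t : 0 < complex.Re t -> Phi t^-1 = Phi t.
Proof.
move=> t0; have t0' := Re_inv_gt0 t0; have nt := lt0r_neq0 (normc_gt0_Re t0).
have h1 := G1_normc t0; have h2 := G1N_normc t0.
have h3 := G1N_normc t0'; rewrite invrK normcV in h3.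
have nc s : normc (cexp (- ((pi / 4)%:C%C * s))) ^+ (n - 16) ^+ 4 =
    expR (- (pi * complex.Re s)) ^+ (n - 16).
  rewrite exprAC; congr (_ ^+ _).
  by rewrite normc_cexp -expRM_natr raddfN/= Re_rmul; congr expR; field.
by rewrite /Phi -!nc Re_invc /P !normcM; exact: inversion_algebra.
Qed.

(** The zero of order 6 gives |P|^4 = O(e^(-24 pi y)), which beats y^(3n) <= (3n)! e^y. The circle
    belonging to 6/10 serves to estimate P on the disk belonging to 7/10. *)
Let Phi_bounded : exists M, forall t, 7 / 10 <= complex.Re t -> Phi t <= M.
Proof.
have pi0 := pi_gt0 R.
pose r : R := expR (- (pi * (6 / 10))); pose r0 : R := expR (- (pi * (7 / 10))).
have r1 : 0 < r < 1.
  by rewrite expR_gt0 expR_lt1 oppr_lt0 mulr_gt0//; lra.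
have rr0 : r0 < r by rewrite ltr_expR ltrN2 ltr_pM2l//; lra.
case/andP: (r1) => rp rl.
have [M M0 hM] := calA_bounded (aP rl).
have hMr w : normc w = r -> normc (P w) <= M by move=> wr; rewrite hM// wr.
pose K := M ^+ 2 / (r ^+ 12 * (1 - (r0 / r) ^+ 2)).
have r0r : 0 <= r0 / r < 1.
  by rewrite divr_ge0 ?expR_ge0 ?(ltW rp)//= ltr_pdivrMr// mul1r.
have r0r2 : 0 < 1 - (r0 / r) ^+ 2.
  by rewrite subr_gt0 exprn_ilt1//; case/andP: r0r.
have K0 : 0 <= K by rewrite divr_ge0 ?sqr_ge0// mulr_ge0 ?exprn_ge0 ?(ltW rp)// ltW.
exists (K ^+ 2 * (3 * n)`!%:R) => t ty; set y := complex.Re t in ty *.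
have y0 : 0 < y by lra.
have zr0 : normc (qpi t) <= r0 by rewrite normc_qpi ler_expR lerN2 ler_pM2l.
have hP : normc (P (qpi t)) ^+ 2 <= K * expR (- (pi * y)) ^+ 12.
  have := @P_bound r M (qpi t) r1 hMr (le_lt_trans zr0 rr0).
  move=> /le_trans; apply; rewrite normc_qpi -/y.
  set e := expR _.
  have er0 : e <= r0 by rewrite /e /r0 ler_expR lerN2 ler_pM2l.
  have e0 : 0 <= e by exact: expR_ge0.
  rewrite -exprM expr_div_n (_ : (2 * 6)%N = 12%N)//.
  have -> : K * e ^+ 12 = M ^+ 2 * (e ^+ 12 / r ^+ 12) / (1 - (r0 / r) ^+ 2).
    rewrite /K; field; rewrite !gt_eqF//= subr_gt0 ltr_pXn2r ?nnegrE ?expR_ge0//.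
  rewrite ler_wpM2l//.
    by rewrite mulr_ge0 ?sqr_ge0// divr_ge0 ?exprn_ge0// ltW.
  rewrite lef_pV2 ?posrE//.
    by rewrite lerB// lerXn2r ?nnegrE ?divr_ge0 ?expR_ge0 ?(ltW rp)// ler_pM2r ?invr_gt0.
  by rewrite subr_gt0 exprn_ilt1 ?divr_ge0 ?(ltW rp)// ltr_pdivrMr// mul1r (le_lt_trans er0).
have hP4 : normc (P (qpi t)) ^+ 4 <= K ^+ 2 * expR (- (pi * y)) ^+ 24.
  rewrite (exprM _ 2 2) (exprM _ 12 2) -exprMn lerXn2r ?nnegrE ?sqr_ge0//.
  by rewrite mulr_ge0// exprn_ge0// expR_ge0.
have hy : y ^+ (3 * n) <= (3 * n)`!%:R * expR y.
  have n0 : (0 < 3 * n)%N by rewrite muln_gt0/=; case/andP: n1623 => h _; exact: leq_trans h.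
  have := expR_ge1Dxn (3 * n).-1 (ltW y0); rewrite prednK// => h.
  rewrite -ler_pdivrMl ?ltr0n ?fact_gt0// mulrC.
  by apply: le_trans h; rewrite lerDr.
apply: le_trans (_ : (3 * n)`!%:R * expR y * (K ^+ 2 * expR (- (pi * y)) ^+ 24) * 1 <= _).
  have q0 : 0 <= expR (- (pi * y)) by exact: expR_ge0.
  have y3 : 0 <= y ^+ (3 * n) by rewrite exprn_ge0// ltW.
  have P4 : 0 <= normc (P (qpi t)) ^+ 4 by rewrite exprn_ge0// normc_ge0.
  rewrite /Phi -/y; apply: ler_pM; [exact: mulr_ge0|exact: exprn_ge0| |].
    exact: ler_pM.
  by rewrite exprn_ile1// expR_le1 oppr_le0 mulr_ge0 ?(ltW y0) ?(ltW pi0).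
rewrite mulr1 mulrACA [X in X * _]mulrC -[leRHS]mulr1 ler_wpM2l//.
  by rewrite mulr_ge0// sqr_ge0.
rewrite -expRM_natr -expRD expR_le1.
have : 1 <= (pi : R) * 24 by have := pi_ge2 R; lra.
by move=> /(ler_wpM2r (ltW y0)); lra.
Qed.

(** Every point of the circle |q| = e^(-pi y1), y1 = 0.81 y, is [qpi t'] with Re t' = y1 >= 0.81 *
    0.866 > 0.7, so M controls P there, and [max_vanish] with order 6 carries the bound inwards to
    t. The loss (y/y1)^(3n) = (10/9)^(6n) must stay below the gain from the zero. *)
Let Phi_contract t M : 866 / 10 / 100 <= complex.Re t ->
  (forall t', 7 / 10 <= complex.Re t' -> Phi t' <= M) ->
  Phi t <= (99 / 100) ^+ 2 * M.
Proof.
move=> ty hM; have pi0 := pi_gt0 R; set y := complex.Re t in ty *.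
have y0 : 0 < y by lra.
pose y1 := 81 / 100 * y; have y10 : 0 < y1 by rewrite mulr_gt0//; lra.
pose r := expR (- (pi * y1)).
have r1 : 0 < r < 1 by rewrite expR_gt0 expR_lt1 oppr_lt0 mulr_gt0.
have r0 : 0 < r by case/andP: r1.
pose W := M / (y1 ^+ (3 * n) * r ^+ (n - 16)).
have den0 : 0 < y1 ^+ (3 * n) * r ^+ (n - 16) by rewrite mulr_gt0 ?exprn_gt0.
have hW z : normc z = r -> normc (P z) ^+ 4 <= W.
  move=> zr; have [u zE] := polar z; pose t' := (y1 +i* (- (u / pi)))%C.
  have qt' : qpi t' = z.
    rewrite zE zr /qpi.
    have -> : - (pi%:C%C * t') = (- (pi * y1))%:C%C + (0 +i* u)%C.
      apply/eqP; rewrite eq_complex /= !mul0r subr0 !addr0 add0r mulrN opprK.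
      by rewrite [pi * (u / pi)]mulrC divfK ?eqxx// gt_eqF.
    by rewrite cexpD cexp_real.
  have := hM t'; rewrite /Phi qt' /= -/r => /(_ ltac:(rewrite /y1; lra)).
  by move=> h; rewrite /W ler_pdivlMr// mulrA [normc (P z) ^+ 4 * _]mulrC.
have W0 : 0 <= W.
  apply: le_trans (hW (r%:C)%C _); first by rewrite exprn_ge0// normc_ge0.
  by rewrite normc_real gtr0_norm.
have hM1 z : normc z = r -> normc (P z) <= Num.sqrt (Num.sqrt W).
  move=> /hW h; rewrite -(@ler_pXn2r _ 4) ?nnegrE ?normc_ge0 ?sqrtr_ge0//.
  by rewrite [X in _ <= X](exprM _ 2 2) !sqr_sqrtr ?sqrtr_ge0.
(* The fourth root of |q| / r; in this variable all gains become integral powers. *)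
pose D := expR (- (pi * (y - y1) / 4)).
have D0 : 0 <= D by exact: expR_ge0.
have D1 : D <= (88 / 100 + 2 / 10 / 100).
  apply: expR_neg_le; have p31 : 31 / 10 <= (pi : R) := pi_ge31.
  have yy : 19 / 100 * (866 / 10 / 100) <= y - y1 by rewrite /y1; lra.
  have h1 : 0 <= 31 / 10 :> R by lra.
  have h2 : 0 <= 19 / 100 * (866 / 10 / 100) :> R by lra.
  have := ler_pM h1 h2 p31 yy; lra.
have D8 : 0 < 1 - D ^+ 8.
  rewrite subr_gt0 exprn_ilt1//; lra.
have qD : normc (qpi t) = r * D ^+ 4.
  by rewrite normc_qpi /D -expRM_natr -expRD -/y; congr expR; field.
have tr : normc (qpi t) < r.
  rewrite qD gtr_pMr// exprn_ilt1//; lra.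
have rho : normc (qpi t) / r = D ^+ 4 by rewrite qD mulrC mulKf// gt_eqF.
have hP := P_bound r1 hM1 tr; rewrite rho sqr_sqrtr ?sqrtr_ge0// -!exprM in hP.
have hP4 : normc (P (qpi t)) ^+ 4 <= W * (D ^+ 48 / (1 - D ^+ 8)) ^+ 2.
  rewrite -{1}(sqr_sqrtr W0) -exprMn (exprM _ 2 2) mulrA lerXn2r ?nnegrE ?sqr_ge0//.
  by rewrite !mulr_ge0 ?sqrtr_ge0 ?exprn_ge0// invr_ge0 ltW.
have [n16 n23] := andP n1623.
have cf := contraction_factor n1623 (introT andP (conj D0 D1)).
rewrite -ler_pdivrMr// in cf.
have cf0 : 0 <= (10 / 9) ^+ (3 * n) * D ^+ (2 * n + 16) / (1 - D ^+ 8).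
  by rewrite !mulr_ge0 ?exprn_ge0 ?invr_ge0 ?(ltW D8)//; lra.
have M0 : 0 <= M.
  by move: W0; rewrite /W pmulr_lge0// invr_gt0.
apply: le_trans (_ : ((10 / 9) ^+ (3 * n) * D ^+ (2 * n + 16) / (1 - D ^+ 8)) ^+ 2 * M <= _); last first.
  rewrite ler_wpM2r// lerXn2r// nnegrE//; lra.
rewrite /Phi -/y -normc_qpi qD.
apply: le_trans (_ : y ^+ (3 * n) * (W * (D ^+ 48 / (1 - D ^+ 8)) ^+ 2) * (r * D ^+ 4) ^+ (n - 16) <= _).
  rewrite ler_wpM2r ?exprn_ge0 ?mulr_ge0 ?exprn_ge0 ?(ltW r0)//.
  by rewrite ler_wpM2l// exprn_ge0// ltW.
rewrite le_eqVlt; apply/orP; left; apply/eqP.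
have yE : y ^+ (3 * n) = y1 ^+ (3 * n) * ((10 / 9) ^+ (3 * n)) ^+ 2.
  by rewrite exprAC -exprMn; congr (_ ^+ _); rewrite /y1; field.
have DE : (D ^+ 48) ^+ 2 * (D ^+ 4) ^+ (n - 16) = (D ^+ (2 * n + 16)) ^+ 2.
  by rewrite -!exprM -exprD; congr (_ ^+ _); move: n16; clear; lia.
rewrite [(r * _) ^+ _]exprMn /W yE.
have -> : y1 ^+ (3 * n) * (10 / 9) ^+ (3 * n) ^+ 2 * (M / (y1 ^+ (3 * n) * r ^+ (n - 16)) *
   (D ^+ 48 / (1 - D ^+ 8)) ^+ 2) * (r ^+ (n - 16) * D ^+ 4 ^+ (n - 16)) =
   (10 / 9) ^+ (3 * n) ^+ 2 * M * ((D ^+ 48) ^+ 2 * (D ^+ 4) ^+ (n - 16)) / (1 - D ^+ 8) ^+ 2 *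
   ((y1 ^+ (3 * n) * r ^+ (n - 16)) / (y1 ^+ (3 * n) * r ^+ (n - 16))).
  rewrite [(D ^+ 48 / _) ^+ 2]exprMn exprVn.
  move: ((_ * r ^+ _)^-1) ((1 - D ^+ 8) ^- 2) ((10 / 9) ^+ (3 * n) ^+ 2) (D ^+ 4 ^+ _) => u v w v'; ring.
rewrite DE divff ?gt_eqF// mulr1; move: ((10 / 9) ^+ (3 * n)) (D ^+ (2 * n + 16)) => u v.
by rewrite !exprMn exprVn; ring.
Qed.

(** A bound M on Re t >= 0.7 improves to 0.9801 M. High points contract directly; the others are
    first shifted to |Im t| <= 1/2 and inverted, which lifts them to Re t >= 0.866, a value just
    under half the square root of 3. Iteration forces 0. *)
Let Phi_eq0 t : 7 / 10 <= complex.Re t -> Phi t = 0.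
Proof.
have step M : (forall t', 7 / 10 <= complex.Re t' -> Phi t' <= M) ->
    forall t', 7 / 10 <= complex.Re t' -> Phi t' <= (99 / 100) ^+ 2 * M.
  move=> hM t' ht'; have [h|h] := lerP (866 / 10 / 100) (complex.Re t').
    exact: Phi_contract.
  have [s s1 [s2 <-]] := Phi_shift t'.
  rewrite -s2 in ht' h.
  have s0 : 0 < complex.Re s by lra.
  rewrite -(Phi_inv s0); apply: Phi_contract => //.
  rewrite Re_invc ler_pdivlMr ?exprn_gt0 ?normc_gt0_Re//.
  have -> : normc s ^+ 2 = complex.Re s ^+ 2 + complex.Im s ^+ 2.
    by case: (s) => a b /=; rewrite sqr_sqrtr ?addr_ge0 ?sqr_ge0.
  have i2 : complex.Im s ^+ 2 <= 1 / 4.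
    rewrite -(real_normK (num_real _)).
    by have := ler_pM (normr_ge0 _) (normr_ge0 _) s1 s1; rewrite -expr2; lra.
  move: (complex.Re s) (complex.Im s ^+ 2) ht' h i2 => y b h1 h2 h3.
  (* 0.866 and 0.2887 are nearly the roots of 0.866 (y^2 + 1/4) = y; between them the inverted point
     is high enough. *)
  have k1 : 0 <= 866 / 10 / 100 - y by lra.
  have k2 : 0 <= y - (28 / 100 + 87 / 100 / 100) by lra.
  have k3 := mulr_ge0 k1 k2.
  rewrite expr2; lra.
have [M0 hM0] := Phi_bounded.
have iter k t' : 7 / 10 <= complex.Re t' -> Phi t' <= (99 / 100) ^+ 2 ^+ k * M0.
  elim: k t' => [|k ih] t' ht'; first by rewrite expr0 mul1r hM0.
  by rewrite exprS -mulrA; apply: step.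
move=> ht; apply/eqP; rewrite eq_le Phi_ge0 ?andbT; last lra.
apply: (@lim_le _ _ _ `|M0|) => e e0 _; rewrite add0r.
have c1 : 0 <= ((99 / 100 : R) ^+ 2) < 1 by rewrite expr2; lra.
have [K hK] := expn_lt_eps c1 e0.
apply: le_trans (iter K t ht) _.
apply: le_trans (_ : (99 / 100) ^+ 2 ^+ K * `|M0| <= _).
  by rewrite ler_wpM2l ?ler_norm// exprn_ge0//; case/andP: c1.
by rewrite ler_wpM2r// ltW.
Qed.

Lemma triple_product_vanishes : exists2 e, 0 < e &
  forall x, 0 < x < e -> G1 x%:C%C * G1 (- x%:C%C) * G3 x%:C%C = 0.
Proof.
have pi0 := pi_gt0 R.
exists (expR (- (pi * (7 / 10)))) => [|x /andP[x0 xe]]; first exact: expR_gt0.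
pose y := - ln x / pi.
have yE : expR (- (pi * y)) = x.
  by rewrite /y mulrC divfK ?gt_eqF// opprK lnK.
have y7 : 7 / 10 <= y.
  by rewrite -yE ltr_expR ltrN2 ltr_pM2l// in xe; exact: ltW.
have := @Phi_eq0 (y%:C)%C y7; rewrite /Phi qpi_real (_ : complex.Re (y%:C)%C = y)// yE.
move/eqP; rewrite !mulf_eq0 !expf_eq0 (gt_eqF x0) [y == 0]gt_eqF; last lra.
by rewrite !andbF orbF !orbb => /eqP h; exact: eq0_normc h.
Qed.

End Contraction.

Section Vanish2.
Context {R : realType}.
Local Notation C := R[i].
Implicit Types (z w t : C) (x y r e : R).

(** If G1 is not identically zero, it has no zero near 0 other than 0 itself, so the vanishing
    product forces G3 = 0 near 0, hence on ]0, 1[. The equation linking G1(-q) to G3 then gives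
    zeros of G1 arbitrarily close to 0. *)
Lemma modular_vanishing (n : nat) (G1 G3 : C -> C) (B d : R) :
  (16 <= n <= 23)%N -> analytic G1 -> analytic G3 -> 0 < d ->
  (forall x, 0 < `|x| < d -> normc (G1 x%:C%C) <= B * `|x| ^+ 3) ->
  (forall y, 0 < y ->
     G1 (expR (- (pi / y)))%:C%C ^+ 2 = y%:C%C ^+ n * G1 (expR (- (pi * y)))%:C%C ^+ 2) ->
  (forall y, 0 < y ->
     G1 (- (expR (- (pi / y)))%:C%C) ^+ 2 = y%:C%C ^+ n *
     ((expR (- (pi / 4 * y)))%:C%C ^+ (n - 16) * G3 (expR (- (pi * y)))%:C%C) ^+ 2) ->
  (forall z, G3 (- z) = G3 z) ->
  forall x, 0 < x < 1 -> G1 x%:C%C = 0.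
Proof.
move=> n1623 aG1 aG3 d0 ord G1S G1NS G3N.
have [e0 e00 h] := triple_product_vanishes n1623 aG1 aG3 d0 ord G1S G1NS G3N.
have r1 : 1 / 2 < 1 :> R by lra.
have r0 : 0 < 1 / 2 :> R by lra.
have ext (f : C -> C) e : analytic f -> 0 < e -> (forall x, 0 < x < e -> f x%:C%C = 0) ->
    forall x, 0 < x < 1 -> f x%:C%C = 0.
  move=> af e1 hf x /andP[x0 x1]; pose r := (x + 1) / 2.
  have rx : x < r by rewrite /r; lra.
  have rl : r < 1 by rewrite /r; lra.
  have rp : 0 < r by rewrite (lt_trans x0).
  by apply: (calA_identity rp (af _ rl) e1 hf); rewrite normc_real gtr0_norm.
have [z0|[e1 e10 hne]] := calA_isolated r0 (aG1 _ r1).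
  apply: (ext _ _ aG1 r0) => x /andP[x0 x2].
  by apply: z0; rewrite normc_real gtr0_norm.
exfalso.
have G30 : forall x, 0 < x < 1 -> G3 x%:C%C = 0.
  have e2 : 0 < Num.min e0 e1 by rewrite lt_min e00.
  apply: (ext _ _ aG3 e2) => x /andP[x0]; rewrite lt_min => /andP[xe0 xe1].
  have := h x; rewrite x0 xe0 => /(_ isT)/eqP; rewrite !mulf_eq0.
  have k1 : G1 x%:C%C != 0 by apply: hne; rewrite normc_real gtr0_norm// x0.
  have k2 : G1 (- x%:C%C) != 0 by apply: hne; rewrite normcN normc_real gtr0_norm// x0.
  by rewrite (negPf k1) (negPf k2) /= => /eqP.
pose x := Num.min (e1 / 2) (1 / 2).
have x0 : 0 < x by rewrite lt_min divr_gt0.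
have x1 : x < 1 by rewrite gt_min r1 orbT.
have xe : x < e1 by rewrite gt_min; apply/orP; left; lra.
have pi0 := pi_gt0 R.
have lx : 0 < - ln x by rewrite oppr_gt0 ln_lt0// x0.
pose y := pi / - ln x; have y0 : 0 < y by rewrite divr_gt0.
have xE : expR (- (pi / y)) = x.
  have -> : - (pi / y) = ln x.
    by rewrite /y invf_div mulrCA divff ?mulr1 ?opprK// gt_eqF.
  by rewrite lnK.
have := G1NS y y0; rewrite xE G30; last first.
  by rewrite expR_gt0 expR_lt1 oppr_lt0 mulr_gt0.
rewrite mulr0 expr0n /= mulr0 => /eqP; rewrite sqrf_eq0; apply/negP.
by apply: hne; rewrite normcN normc_real gtr0_norm// x0.
Qed.

End Vanish2.

(** * Unordered sums of nonnegative terms *)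

Local Open Scope classical_set_scope.
Local Open Scope ring_scope.

Section RealSums.
Context {R : realType}.

Section OneType.
Context {T : choiceType}.
Implicit Types (S A : set T) (f g : T -> R) (X : {fset T}).

(** [fine] sends an infinite sum to 0, so finiteness is carried separately by [summ]. *)
Definition rsum S f : R := fine (\esum_(x in S) (f x)%:E).
Definition summ S f : Prop := (\esum_(x in S) (f x)%:E < +oo)%E.

Lemma esum_fin_num S f : (forall x, 0 <= f x) -> summ S f ->
  (\esum_(x in S) (f x)%:E = (rsum S f)%:E)%E.
Proof.
move=> f0 sf; rewrite fineK// ge0_fin_numE//.
by apply: esum_ge0 => x _; rewrite lee_fin.
Qed.

Lemma rsum_ge0 S f : (forall x, 0 <= f x) -> 0 <= rsum S f.
Proof. by move=> f0; rewrite fine_ge0// esum_ge0// => x _; rewrite lee_fin. Qed.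

Lemma rsum_fset_le S f X : (forall x, 0 <= f x) -> summ S f -> [set` X] `<=` S ->
  \sum_(x <- X) f x <= rsum S f.
Proof.
move=> f0 sf XS; rewrite -lee_fin -esum_fin_num// -sumEFin.
apply: esum_ge; exists [set` X]; first by split.
by rewrite fsbig_finite//= set_fsetK.
Qed.

Lemma summ_ub S f M : (forall x, 0 <= f x) ->
  (forall X, [set` X] `<=` S -> \sum_(x <- X) f x <= M) -> summ S f /\ rsum S f <= M.
Proof.
move=> f0 h.
have hM : (\esum_(x in S) (f x)%:E <= M%:E)%E.
  apply: ge_ereal_sup => _ [A [finA AS] <-].
  rewrite fsbig_finite// sumEFin lee_fin; apply: h => x /=.
  by rewrite in_fset_set// inE => /AS.
split; first by rewrite /summ (le_lt_trans hM)// ltry.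
by rewrite /rsum -lee_fin fineK// ge0_fin_numE ?(le_lt_trans hM) ?ltry//
  esum_ge0// => x _; rewrite lee_fin.
Qed.

Lemma rsum_approx S f e : (forall x, 0 <= f x) -> summ S f -> 0 < e ->
  exists2 X : {fset T}, [set` X] `<=` S & rsum S f - e < \sum_(x <- X) f x.
Proof.
move=> f0 sf e0; apply: contrapT => h.
have [] := @summ_ub S f (rsum S f - e) f0.
  move=> X XS; rewrite leNgt; apply/negP => hX; apply: h; by exists X.
by move=> _; lra.
Qed.

Lemma summ_le S f g : (forall x, 0 <= f x) -> (forall x, S x -> f x <= g x) -> summ S g ->
  summ S f.
Proof.
move=> f0 fg; apply: le_lt_trans; apply: le_esum => x Sx; rewrite ?lee_fin ?fg//.
Qed.

Lemma summ_sub S A f : (forall x, 0 <= f x) -> A `<=` S -> summ S f -> summ A f.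
Proof.
move=> f0 AS sf; apply: (proj1 (@summ_ub A f (rsum S f) f0 _)) => X XA.
by apply: rsum_fset_le => // x /XA /AS.
Qed.

Lemma rsum_le S f g : (forall x, 0 <= f x) -> (forall x, 0 <= g x) ->
  (forall x, S x -> f x <= g x) -> summ S g -> rsum S f <= rsum S g.
Proof.
move=> f0 g0 fg sg; apply: (proj2 (@summ_ub S f (rsum S g) f0 _)) => X XS.
apply: le_trans (rsum_fset_le g0 sg XS); rewrite big_seq [leRHS]big_seq.
by apply: ler_sum => x /XS; exact: fg.
Qed.

Lemma eq_rsum S f g : (forall x, S x -> f x = g x) -> rsum S f = rsum S g.
Proof. by move=> fg; rewrite /rsum; congr fine; apply: eq_esum => x /fg ->. Qed.

Lemma eq_summ S f g : (forall x, S x -> f x = g x) -> summ S f = summ S g.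
Proof.
by move=> fg; rewrite /summ; congr (_ < _)%E; apply: eq_esum => x /fg ->.
Qed.

Lemma summZ S f c : (forall x, 0 <= f x) -> 0 <= c -> summ S f ->
  summ S (fun x => c * f x) /\ rsum S (fun x => c * f x) = c * rsum S f.
Proof.
move=> f0 c0 sf.
have cf0 x : 0 <= c * f x by rewrite mulr_ge0.
have [s1 h1] := @summ_ub S (fun x => c * f x) (c * rsum S f) cf0
  (fun X XS => eq_ind _ (fun t => t <= c * rsum S f)
     (ler_wpM2l c0 (rsum_fset_le f0 sf XS)) _ (mulr_sumr _ _ _ _)).
split=> //; apply/eqP; rewrite eq_le h1/=.
have [->|cn0] := eqVneq c 0; first by rewrite mul0r rsum_ge0// => x; rewrite mul0r.
have {cn0} cp : 0 < c by rewrite lt_neqAle eq_sym cn0.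
rewrite -ler_pdivlMl//; apply: (proj2 (@summ_ub S f _ f0 _)) => X XS.
by rewrite ler_pdivlMl// mulr_sumr; apply: (rsum_fset_le _ s1 XS).
Qed.

Lemma rsum_set1 x f : (forall x, 0 <= f x) -> summ [set x] f /\ rsum [set x] f = f x.
Proof. by move=> f0; rewrite /summ /rsum esum_set1 ?lee_fin//= ltry. Qed.

Lemma rsum_setU S A f : (forall x, 0 <= f x) -> S `&` A = set0 ->
  summ S f -> summ A f -> summ (S `|` A) f /\ rsum (S `|` A) f = rsum S f + rsum A f.
Proof.
move=> f0 SA sS sA.
have h : (\esum_(x in S `|` A) (f x)%:E = (rsum S f + rsum A f)%:E)%E.
  rewrite (esumID S) => [|x _]; last by rewrite lee_fin.
  rewrite EFinD -!esum_fin_num//; congr (_ + _)%E; congr esum; apply/seteqP; split => x /=.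
  - by case.
  - by move=> Sx; split; [left|].
  - by case=> -[].
  - by move=> Ax; split; [right|move=> Sx; have : (S `&` A) x by []; rewrite SA].
by rewrite /summ /rsum h ltry.
Qed.

Lemma summ_bigcup (I : finType) (P : pred I) (F : I -> set T) f : (forall x, 0 <= f x) ->
  (forall i j x, F i x -> F j x -> i = j) -> (forall i, P i -> summ (F i) f) ->
  summ [set x | exists2 i, P i & F i x] f /\
  rsum [set x | exists2 i, P i & F i x] f = \sum_(i | P i) rsum (F i) f.
Proof.
move=> f0 dis sf.
suff h : (\esum_(x in [set x | exists2 i, P i & F i x]) (f x)%:E =
   (\sum_(i | P i) rsum (F i) f)%:E)%E by rewrite /summ /rsum h ltry.
rewrite -sumEFin.
have -> : (\sum_(i | P i) (rsum (F i) f)%:E)%E =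
   (\sum_(i | P i) \esum_(x in F i) (f x)%:E)%E.
  by apply: eq_bigr => i Pi; rewrite esum_fin_num//; exact: sf.
under eq_bigr do rewrite esum_mkcond.
rewrite -esum_sum; last by move=> i j _ _; case: ifP => // _; rewrite lee_fin.
rewrite esum_mkcond; apply: eq_esum => x _.
case: ifPn => [/set_mem/= [i Pi Fix]|/negP hx].
  rewrite (bigD1 i)//= mem_set// big1 ?adde0// => j /andP[_ ji].
  by case: ifPn => // /set_mem Fj; move: ji; rewrite (dis _ _ _ Fj Fix) eqxx.
rewrite big1// => i Pi; case: ifPn => // /set_mem Fi.
by exfalso; apply: hx; apply: mem_set; exists i.
Qed.

Lemma rsum_fset f X : (forall x, 0 <= f x) ->
  summ [set` X] f /\ rsum [set` X] f = \sum_(x <- X) f x.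
Proof.
move=> f0; rewrite /summ /rsum esum_fset//; last by move=> x _; rewrite lee_fin.
by rewrite fsbig_finite// set_fsetK sumEFin ltry.
Qed.

Lemma rsum_split S f X : (forall x, 0 <= f x) -> [set` X] `<=` S -> summ S f ->
  rsum S f = \sum_(x <- X) f x + rsum (S `\` [set` X]) f.
Proof.
move=> f0 XS sf; have [s1 <-] := rsum_fset X f0.
rewrite -(proj2 (rsum_setU f0 _ s1 _)) ?setDUK//; first by rewrite setDIK.
by apply: summ_sub sf => // x [].
Qed.

Lemma rsum_tail_le S f g X : (forall x, 0 <= f x) -> (forall x, 0 <= g x) ->
  (forall x, S x -> f x <= g x) -> summ S g -> [set` X] `<=` S ->
  rsum S f - \sum_(x <- X) f x <= rsum S g - \sum_(x <- X) g x.
Proof.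
move=> f0 g0 fg sg XS; rewrite (rsum_split f0 XS (summ_le f0 fg sg)).
rewrite (rsum_split g0 XS sg) !(addrC (\sum_(x <- X) _)) !addrK.
apply: rsum_le => //; first by move=> x [Sx _]; exact: fg.
by apply: summ_sub sg => // x [].
Qed.

(** A finite X carries all but e/4 of the majorant g, so the tails of u_J and f outside X are below
    e/4; on X the convergence is that of a finite sum. *)
Lemma tannery S (u : nat -> T -> R) f g :
  (forall J x, 0 <= u J x) -> (forall x, 0 <= g x) -> (forall x, 0 <= f x) ->
  (forall J x, S x -> u J x <= g x) -> summ S g ->
  (forall x, S x -> (u ^~ x) @ \oo --> f x) ->
  summ S f /\ (fun J => rsum S (u J)) @ \oo --> rsum S f.
Proof.
move=> u0 g0 f0 ug sg uf.
have fg x : S x -> f x <= g x.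
  by move=> Sx; apply: (cvgr_to_le (uf x Sx)); near=> J; exact: ug.
have sf := summ_le f0 fg sg; split=> //.
apply/cvgrPdist_le => e e0; have e4 : 0 < e / 4 by rewrite divr_gt0.
have [X XS hX] := rsum_approx g0 sg e4.
have hs : (fun J => \sum_(x <- X) u J x) @ \oo --> \sum_(x <- X) f x.
  have : {in (X : seq T), forall x, S x} by move=> x; exact: XS.
  elim: (X : seq T) => [|x s ih] h.
    by under eq_fun do rewrite big_nil; rewrite big_nil; exact: cvg_cst.
  under eq_fun do rewrite big_cons; rewrite big_cons; apply: cvgD.
    by apply: uf; apply: h; rewrite mem_head.
  by apply: ih => y ys; apply: h; rewrite inE ys orbT.
move/cvgrPdist_le : hs => /(_ _ e4) hs; near=> J.
have h1 := rsum_tail_le f0 g0 fg sg XS.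
have h2 := rsum_tail_le (u0 J) g0 (ug J) sg XS.
have h3 := rsum_fset_le f0 sf XS.
have h4 := rsum_fset_le (u0 J) (summ_le (u0 J) (ug J) sg) XS.
have : `|\sum_(x <- X) f x - \sum_(x <- X) u J x| <= e / 4 by near: J.
rewrite !ler_norml => /andP[h5 h6]; apply/andP; split; lra.
Unshelve. all: end_near. Qed.

End OneType.

Lemma fset_nat_sum_le (f : nat -> R) (X : {fset nat}) : (forall k, 0 <= f k) ->
  exists n, \sum_(k <- X) f k <= \sum_(k < n) f k.
Proof.
move=> f0; exists (\max_(k <- X) k).+1.
rewrite -(big_mkord xpredT f) -lee_fin -!sumEFin.
apply: (lee_sum_fset_nat X _ xpredT) => [k _|k /= kX]; first by rewrite lee_fin.
by rewrite ltnS; exact: leq_bigmax_seq.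
Qed.

Lemma summ_nat (f : nat -> R) M : (forall k, 0 <= f k) ->
  (forall n, \sum_(k < n) f k <= M) -> summ setT f /\ rsum setT f <= M.
Proof.
move=> f0 h; apply: summ_ub => // X _.
by have [n /le_trans] := fset_nat_sum_le X f0; apply.
Qed.

Lemma summ_geo_int (q : R) : 0 <= q < 1 -> summ [set: int] (fun k => q ^+ `|k|%N).
Proof.
move=> /andP[q0 q1]; have f0 (k : int) : 0 <= q ^+ `|k|%N by rewrite exprn_ge0.
have hq n : \sum_(k < n) q ^+ k <= 1 / (1 - q).
  by rewrite -(big_mkord xpredT (fun k => q ^+ k)) -[1](expr0 q); apply: geo_tail; rewrite q0.
have sP : summ (range Posz) (fun k => q ^+ `|k|%N).
  rewrite /summ esum_image; last by move=> x y _ _ [].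
  exact: (proj1 (summ_nat (fun k => exprn_ge0 k q0) hq)).
have sN : summ (range Negz) (fun k => q ^+ `|k|%N).
  rewrite /summ esum_image; last by move=> x y _ _ [].
  have hN n : \sum_(k < n) q ^+ k.+1 <= 1 / (1 - q).
    apply: le_trans (hq n); apply: ler_sum => k _.
    by rewrite exprS ler_piMl ?exprn_ge0// ltW.
  exact: (proj1 (summ_nat (fun k => exprn_ge0 k.+1 q0) hN)).
have -> : [set: int] = range Posz `|` range Negz.
  by apply/seteqP; split=> // -[k|k] _; [left|right]; exists k.
by apply: (proj1 (rsum_setU f0 _ sP sN)); apply/seteqP; split=> // _ [[x _ <-] [y _]].
Qed.

Section TwoTypes.
Context {T T' : choiceType}.

Lemma rsum_bij (P : set T) (Q : set T') (e : T -> T') (f : T' -> R) :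
  set_bij P Q e -> rsum Q f = rsum P (f \o e) /\ (summ Q f <-> summ P (f \o e)).
Proof. by move=> h; rewrite /rsum /summ (reindex_esum P Q e). Qed.

Lemma rsum_finite_image (I : finType) (P : pred I) (e : I -> T) (S : set T) (f : T -> R) :
  (forall x, 0 <= f x) -> {in P &, injective e} -> (forall i, P i -> S (e i)) ->
  (forall x, S x -> f x != 0 -> exists2 i, P i & e i = x) ->
  summ S f /\ rsum S f = \sum_(i | P i) f (e i).
Proof.
move=> f0 ei eS ef.
have [] := @summ_bigcup _ I P (fun i => [set x | P i /\ x = e i]) f f0.
- move=> i j x [Pi ->] [Pj]; exact: ei.
- move=> i Pi; have [] := rsum_set1 (e i) f0.
  by rewrite (_ : [set e i] = [set x | P i /\ x = e i])//; apply/seteqP; split=> x /= [].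
set A := [set x | _] => s1 h1.
have AS : A `<=` S by move=> x [i Pi [_ ->]]; exact: eS.
have -> : \sum_(i | P i) f (e i) = rsum A f.
  rewrite h1; apply: eq_bigr => i Pi; have [_ <-] := rsum_set1 (e i) f0.
  by congr rsum; apply/seteqP; split=> x /= [].
rewrite /summ /rsum.
suff -> : (\esum_(x in S) (f x)%:E = \esum_(x in A) (f x)%:E)%E by [].
rewrite esum_mkcond [RHS]esum_mkcond; apply: eq_esum => x _.
case: ifPn => [/set_mem Sx|/negP Sx]; case: ifPn => [/set_mem Ax|/negP Ax] //.
  have [->//|fx] := eqVneq (f x) 0; exfalso; apply: Ax; apply: mem_set.
  by have [i Pi <-] := ef x Sx fx; exists i.
by exfalso; apply: Sx; apply: mem_set; exact: AS.
Qed.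

Lemma rsum_prod (S : set T) (S' : set T') (f : T -> R) (g : T' -> R) :
  (forall x, 0 <= f x) -> (forall x, 0 <= g x) -> summ S f -> summ S' g ->
  summ (S `*` S') (fun k => f k.1 * g k.2) /\
  rsum (S `*` S') (fun k => f k.1 * g k.2) = rsum S f * rsum S' g.
Proof.
move=> f0 g0 sf sg.
have h : (\esum_(k in S `*` S') (f k.1 * g k.2)%:E = (rsum S f * rsum S' g)%:E)%E.
  rewrite -(@esum_esum _ _ _ S (fun=> S') (fun i j => (f i * g j)%:E)); last first.
    by move=> i j _ _; rewrite lee_fin mulr_ge0.
  transitivity (\esum_(i in S) (rsum S' g * f i)%:E)%E.
    apply: eq_esum => i _; have [s1 h1] := summZ g0 (f0 i) sg.
    by rewrite esum_fin_num// ?h1 1?mulrC// => x; rewrite mulr_ge0.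
  have r0 := rsum_ge0 S' g0.
  have [s1 h1] := summZ f0 r0 sf.
  by rewrite esum_fin_num// ?h1 1?mulrC// => x; rewrite mulr_ge0.
by rewrite /summ /rsum h ltry.
Qed.

End TwoTypes.

End RealSums.

(** * Poisson summation for Gaussians *)

Section Polya.
Context {R : realType}.
Local Notation C := R[i].

Lemma cis_int (d : int) : cis (pi *+ 2 * d%:~R) = 1 :> C.
Proof.
case: d => d; first by rewrite -pmulrn cis2pi_nat.
rewrite NegzE mulrNz mulrN -pmulrn /cis.
have -> : (0 +i* (- (pi *+ 2 * d.+1%:R)))%C = - (0 +i* (pi *+ 2 * d.+1%:R))%C :> C.
  by apply/eqP; rewrite eq_complex /= oppr0 !eqxx.
by rewrite cexpN -/(cis _) cis2pi_nat invr1.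
Qed.

Lemma sum_cis (l : nat) (d : int) : (0 < l)%N ->
  \sum_(v < l) cis (pi *+ 2 * d%:~R / l%:R) ^+ v =
  if (l%:Z %| d)%Z then l%:R else 0 :> C.
Proof.
move=> l0; have l0' : l%:Z != 0 by rewrite -lt0n in l0 *; case: l l0.
pose e := `|(d %% l)%Z|%N.
have eE : (d %% l)%Z = e%:Z by rewrite gez0_abs// modz_ge0.
have -> : cis (pi *+ 2 * d%:~R / l%:R) = unity l ^+ e :> C.
  rewrite {1}(divz_eq d l) eE rmorphD rmorphM/= -!pmulrn mulrDr mulrDl cisD.
  have -> : pi *+ 2 * ((d %/ l)%Z%:~R * l%:R) / l%:R = pi *+ 2 * (d %/ l)%Z%:~R :> R.
    by rewrite mulrA mulfK// pnatr_eq0 -lt0n.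
  rewrite cis_int mul1r /unity -cisMn; congr cis.
  by rewrite -[RHS]mulr_natr mulrAC.
rewrite sum_unity//; congr (if _ then _ else _).
have -> : (l %| e)%N = (l%:Z %| e%:Z)%Z by [].
apply/idP/idP => h; last by rewrite -eE; apply/dvdz_mod0P; rewrite modz_mod; exact/dvdz_mod0P.
by rewrite (divz_eq d l) eE rpredD// dvdz_mull.
Qed.

Lemma one_add_cis (x : R) : 1 + cis (x *+ 2) = (2 * cos x)%:C%C * cis x.
Proof.
rewrite !cisE cos_mulr2n sin_mulr2n; apply/eqP; rewrite eq_complex /=.
by rewrite !mul0r subr0 add0r addr0; apply/andP; split; apply/eqP; ring.
Qed.

(** (2 cos x)^(2m) = (1 + e^(2ix))^(2m) e^(-2imx), expanded by the binomial theorem. *)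
Lemma cos_pow_expand (m : nat) (x : R) : ((2 * cos x) ^+ m.*2)%:C%C =
  \sum_(j < m.*2.+1) 'C(m.*2, j)%:R * cis (x *+ 2 * (j%:R - m%:R)) :> C.
Proof.
have -> : ((2 * cos x) ^+ m.*2)%:C%C = (1 + cis (x *+ 2)) ^+ m.*2 * cis (- (x *+ m.*2)) :> C.
  by rewrite one_add_cis [in RHS]exprMn [in LHS]rmorphXn/= -mulrA -cisMn -cisD addrN cis0 mulr1.
rewrite exprDn mulr_suml; apply: eq_bigr => j _.
rewrite expr1n mul1r -cisMn -mulr_natl -mulrA -cisD; congr (_ * cis _).
by rewrite mulrBr !mulr_natr -[x *+ 2 *+ m]mulrnA mul2n.
Qed.

(* Both sides evaluate a power of z^(1/2) + z^(-1/2) summed over the l-th roots of unity. *)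
Lemma polya_identity (m J b a : nat) : (0 < J)%N -> (0 < b)%N ->
  \sum_(v < J * b) (2 * cos (pi * v%:R / (J * b)%:R)) ^+ m.*2 * cos (pi *+ 2 * (v%:R * a%:R / b%:R)) =
  (J * b)%:R * \sum_(j < m.*2.+1 | ((J * b)%:Z %| j%:Z - m%:Z - (J * a)%:Z)%Z) 'C(m.*2, j)%:R :> R.
Proof.
move=> J0 b0; set l := (J * b)%N; have l0 : (0 < l)%N by rewrite muln_gt0 J0.
have lR : l%:R != 0 :> R by rewrite pnatr_eq0 -lt0n.
have bR : b%:R != 0 :> R by rewrite pnatr_eq0 -lt0n.
pose X : C := \sum_(v < l) ((2 * cos (pi * v%:R / l%:R)) ^+ m.*2)%:C%C * cis (- (pi *+ 2 * (v%:R * a%:R / b%:R))).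
have XRe : complex.Re X = \sum_(v < l) (2 * cos (pi * v%:R / l%:R)) ^+ m.*2 *
    cos (pi *+ 2 * (v%:R * a%:R / b%:R)).
  rewrite (raddf_sum (@complex.Re R : Rcomplex R -> R)); apply: eq_bigr => v _.
  by rewrite cisE cosN /= mul0r subr0.
rewrite -XRe; have -> : X = (l%:R * \sum_(j < m.*2.+1 | (l%:Z %| j%:Z - m%:Z - (J * a)%:Z)%Z) 'C(m.*2, j)%:R : R)%:C%C.
  rewrite /X; under eq_bigr => v _.
    rewrite cos_pow_expand mulr_suml.
    under eq_bigr => j _.
      rewrite -mulrA -cisD.
      have -> : (pi * v%:R / l%:R) *+ 2 * (j%:R - m%:R) - pi *+ 2 * (v%:R * a%:R / b%:R) =
          (pi *+ 2 * (j%:Z - m%:Z - (J * a)%:Z)%:~R / l%:R) *+ v :> R.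
        rewrite !intrB -!pmulrn /l !natrM -[RHS]mulr_natr -[pi *+ 2]mulr_natr.
        rewrite -[(pi * _ / _) *+ 2]mulr_natr; field.
        by rewrite bR pnatr_eq0 -lt0n.
      rewrite cisMn.
      over.
    over.
  rewrite exchange_big/= [RHS]rmorphM/= [X in _ = _ * X]rmorph_sum/= [X in _ = X * _]rmorph_nat mulr_sumr.
  rewrite [RHS]big_mkcond/=; apply: eq_bigr => j _.
  rewrite -mulr_sumr sum_cis//; case: ifP => _; last by rewrite mulr0.
  by rewrite rmorph_nat mulrC.
by [].
Qed.

End Polya.

(** * Ratios of binomial coefficients tend to Gaussians *)

Section BinomialGauss.
Context {R : realType}.
Implicit Types (x y t : R).

Lemma one_sub_ge_expR x : x < 1 -> expR (- (x / (1 - x))) <= 1 - x.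
Proof.
move=> x1; have h0 : 0 < 1 - x by lra.
rewrite expRN -[leRHS]invrK lef_pV2 ?posrE ?invr_gt0 ?expR_gt0//.
apply: le_trans (expR_ge1Dx _).
by rewrite le_eqVlt; apply/orP; left; apply/eqP; field; rewrite gt_eqF.
Qed.

Definition binr (m j : nat) : R := 'C(m.*2, m + j)%:R / 'C(m.*2, m)%:R.

Lemma binr0 m : binr m 0 = 1.
Proof.
by rewrite /binr addn0 divff// pnatr_eq0 -lt0n bin_gt0 -addnn leq_addr.
Qed.

Lemma binrS m j : (j < m)%N -> binr m j.+1 = binr m j * ((m - j)%:R / (m + j).+1%:R).
Proof.
move=> jm; rewrite /binr addnS; have := mul_bin_left m.*2 (m + j).
have -> : (m.*2 - (m + j) = m - j)%N by lia.
move=> /(congr1 (fun k : nat => k%:R : R)); rewrite !natrM => h.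
have h0 : (m + j).+1%:R != 0 :> R by rewrite pnatr_eq0.
rewrite mulrAC; congr (_ / _); apply: (mulfI h0); rewrite h.
by field.
Qed.

Lemma binr_ge0 m j : 0 <= binr m j.
Proof. by rewrite divr_ge0. Qed.

(** Each factor 1 - (2i+1)/(m+i+1) is at most exp(-(2i+1)/(m+j)), and the first j odd numbers add up
    to j^2. The denominator m + j stays fixed during the induction on i. *)
Lemma binr_le m j : (j <= m)%N -> binr m j <= expR (- (j%:R ^+ 2 / (m + j)%:R)).
Proof.
move=> jm; suff h i : (i <= j)%N -> binr m i <= expR (- (i%:R ^+ 2 / (m + j)%:R)) by exact: h.
elim: i => [|i ih] ij; first by rewrite binr0 expr0n/= mul0r oppr0 expR0.
have mj : 0 < (m + j)%:R :> R by rewrite ltr0n; lia.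
rewrite binrS; last lia.
have -> : - (i.+1%:R ^+ 2 / (m + j)%:R) = - (i%:R ^+ 2 / (m + j)%:R) - (2 * i + 1)%:R / (m + j)%:R :> R.
  move: ((m + j)%:R : R) (lt0r_neq0 mj) => d d0.
  by rewrite natrD natrM -[i.+1%:R]natr1; field.
rewrite expRD ler_pM ?binr_ge0 ?divr_ge0 ?ih 1?ltnW//.
apply: le_trans (expR_ge1Dx _); rewrite natrB; last lia.
have mi : 0 < (m + i).+1%:R :> R by rewrite ltr0n.
have -> : (m%:R - i%:R) / (m + i).+1%:R = 1 - (2 * i + 1)%:R / (m + i).+1%:R :> R.
  apply: (mulIf (lt0r_neq0 mi)); rewrite [LHS]divfK ?gt_eqF// [RHS]mulrBl mul1r divfK ?gt_eqF//.
  by rewrite -[(m + i).+1%:R]natr1 natrD [(2 * i + 1)%:R]natrD natrM; ring.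
rewrite lerD2l lerN2 ler_wpM2l// lef_pV2 ?posrE// ler_nat; lia.
Qed.

(** The reciprocal factors 1 + (2i+1)/(m-i) are at most exp((2i+1)/(m-j+1)); again the odd numbers
    add up to j^2. *)
Lemma binr_ge m j : (j <= m)%N -> expR (- (j%:R ^+ 2 / (m - j).+1%:R)) <= binr m j.
Proof.
move=> jm; suff h i : (i <= j)%N -> expR (- (i%:R ^+ 2 / (m - j).+1%:R)) <= binr m i by exact: h.
elim: i => [|i ih] ij; first by rewrite binr0 expr0n/= mul0r oppr0 expR0.
have mj : 0 < (m - j).+1%:R :> R by rewrite ltr0n.
rewrite binrS; last lia.
have -> : - (i.+1%:R ^+ 2 / (m - j).+1%:R) = - (i%:R ^+ 2 / (m - j).+1%:R) - (2 * i + 1)%:R / (m - j).+1%:R :> R.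
  move: ((m - j).+1%:R : R) (lt0r_neq0 mj) => d d0.
  by rewrite natrD natrM -[i.+1%:R]natr1; field.
rewrite expRD ler_pM ?expR_ge0 ?ih 1?ltnW//.
have mi : 0 < (m - i)%:R :> R by rewrite ltr0n; lia.
rewrite expRN -[leRHS]invrK lef_pV2 ?posrE ?invr_gt0 ?divr_gt0 ?expR_gt0// invf_div.
apply: le_trans (_ : expR ((2 * i + 1)%:R / (m - i)%:R) <= _); last first.
  by rewrite ler_expR ler_wpM2l// lef_pV2 ?posrE// ler_nat; lia.
apply: le_trans (expR_ge1Dx _).
have -> : (m + i).+1%:R = (m - i)%:R + (2 * i + 1)%:R :> R by rewrite -natrD; congr (_%:R); lia.
by rewrite mulrDl divff// gt_eqF.
Qed.

Lemma squeeze_expR (w x y : nat -> R) (l : R) :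
  (\forall J \near \oo, expR (- x J) <= w J <= expR (- y J)) ->
  x @ \oo --> l -> y @ \oo --> l -> w @ \oo --> expR (- l).
Proof.
move=> h xl yl.
have exp_cvg (z : nat -> R) : z @ \oo --> l -> (expR \o (fun J => - z J)) @ \oo --> expR (- l).
  by move=> zl; apply: continuous_cvg; [exact: continuous_expR|exact: cvgN].
exact: (squeeze_cvgr h (exp_cvg _ xl) (exp_cvg _ yl)).
Qed.

Variable (mu : R).
Hypothesis mu0 : 0 < mu.

(** The exponent grows like mu J^2, so that steps of length J among the binomial coefficients see a
    Gaussian of fixed width. The successors keep J and the exponent positive. *)
Definition polm (J : nat) : nat := (Num.truncn (J.+1%:R ^+ 2 * mu)).+1.

Lemma polm_bounds J : J.+1%:R ^+ 2 * mu <= (polm J)%:R <= J.+1%:R ^+ 2 * (mu + 1).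
Proof.
have h0 : 0 <= J.+1%:R ^+ 2 * mu by rewrite mulr_ge0 ?exprn_ge0// ltW.
have /andP[h1 h2] := truncn_itv h0.
apply/andP; split; first exact: ltW.
rewrite /polm -natr1 mulrDr mulr1 lerD//.
by rewrite -natrX ler1n expn_gt0.
Qed.

Lemma polm_cvg : (fun J => (polm J)%:R / J.+1%:R ^+ 2 : R) @ \oo --> mu.
Proof.
apply: (@squeeze_cvgr _ _ _ _ (fun=> mu) (fun J => mu + harmonic J)).
- near=> J; have K0 : (0 : R) < J.+1%:R ^+ 2 by rewrite exprn_gt0.
  have /andP[h1 h2] := polm_bounds J.
  rewrite ler_pdivlMr// mulrC h1 ler_pdivrMr// mulrDl /harmonic/=.
  have h0 : 0 <= J.+1%:R ^+ 2 * mu by rewrite mulr_ge0 ?exprn_ge0// ltW.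
  have /andP[h3 h4] := truncn_itv h0.
  have h5 : 1 <= J.+1%:R^-1 * J.+1%:R ^+ 2 :> R by rewrite expr2 mulKf ?pnatr_eq0// ler1n.
  by rewrite /polm -natr1 [mu * _]mulrC lerD.
- exact: cvg_cst.
- by rewrite -[X in _ --> X]addr0; apply: cvgD; [exact: cvg_cst|exact: cvg_harmonic].
Unshelve. all: end_near. Qed.

Definition gbin (J : nat) (k : int) : R :=
  if (J.+1 * `|k| <= polm J)%N then binr (polm J) (J.+1 * `|k|) else 0.

Lemma gbin_ge0 J k : 0 <= gbin J k.
Proof. by rewrite /gbin; case: ifP => // _; exact: binr_ge0. Qed.

(** A majorant independent of J, as [tannery] requires; k^2 >= |k| turns the Gaussian bound into a
    geometric one. *)
Lemma gbin_le J k : gbin J k <= expR (- ((2 * (mu + 1))^-1 * `|k|%N%:R)).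
Proof.
rewrite /gbin; case: ifPn => [h|_]; last exact: expR_ge0.
apply: le_trans (binr_le h) _; rewrite ler_expR lerN2.
have m0 : 0 < 2 * (mu + 1) by rewrite mulr_gt0// addr_gt0.
have /andP[_ h2] := polm_bounds J.
set K := `|k|%N in h *; set m := polm J in h h2 *.
have mK : 0 < (m + J.+1 * K)%:R :> R by rewrite ltr0n /m /polm.
rewrite ler_pdivlMr// -mulrA ler_pdivrMl//.
apply: le_trans (_ : K%:R * (2 * (J.+1%:R ^+ 2 * (mu + 1))) <= _).
  rewrite ler_wpM2l// natrD.
  have : (J.+1 * K)%:R <= m%:R :> R by rewrite ler_nat.
  lra.
rewrite natrM exprMn.
have : K%:R <= K%:R ^+ 2 :> R.
  rewrite -natrX ler_nat; clear; case: K => // K.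
  by rewrite expnS expn1 leq_pmulr.
rewrite -(@ler_pM2l _ (J.+1%:R ^+ 2 * (2 * (mu + 1)))) ?mulr_gt0 ?exprn_gt0 ?addr_gt0//.
lra.
Qed.

Lemma gbin_cvg k : (fun J => gbin J k) @ \oo --> expR (- (k%:~R ^+ 2 / mu)).
Proof.
set K := `|k|%N; have kK : k%:~R ^+ 2 = K%:R ^+ 2 :> R.
  by rewrite /K; case: (k) => j //; rewrite NegzE mulrNz sqrrN.
have hK : (fun J => K%:R * harmonic J : R) @ \oo --> (0 : R).
  by rewrite -(mulr0 K%:R); apply: cvgM; [exact: cvg_cst|exact: cvg_harmonic].
have hm := polm_cvg.
have mun0 : mu != 0 by rewrite gt_eqF.
apply: (@squeeze_expR _
  (fun J => k%:~R ^+ 2 / ((polm J)%:R / J.+1%:R ^+ 2 - K%:R * harmonic J + harmonic J * harmonic J))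
  (fun J => k%:~R ^+ 2 / ((polm J)%:R / J.+1%:R ^+ 2 + K%:R * harmonic J))).
- have : \forall J \near \oo, K%:R * harmonic J <= mu.
    by apply: (cvgr_le _ hK).
  apply: filterS => J hJ.
  have J0 : J.+1%:R != 0 :> R by rewrite pnatr_eq0.
  have /andP[h1 h2] := polm_bounds J.
  have Jm : (J.+1 * K <= polm J)%N.
    rewrite -(ler_nat R); apply: le_trans h1; rewrite natrM expr2 -mulrA ler_pM2l ?ltr0n//.
    by rewrite mulrC -ler_pdivrMr ?ltr0n//.
  rewrite /gbin -/K Jm; apply/andP; split.
    apply: le_trans (binr_ge Jm); rewrite ler_expR lerN2 kK natrM.
    have -> : (polm J - J.+1 * K).+1%:R = (polm J)%:R - J.+1%:R * K%:R + 1 :> R.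
      by rewrite -[LHS]natr1 natrB// natrM.
    rewrite /harmonic/=.
    have -> : (polm J)%:R / J.+1%:R ^+ 2 - K%:R / J.+1%:R + J.+1%:R^-1 / J.+1%:R =
       ((polm J)%:R - J.+1%:R * K%:R + 1) / J.+1%:R ^+ 2 :> R by field.
    by rewrite invf_div le_eqVlt; apply/orP; left; apply/eqP; ring.
  apply: le_trans (binr_le Jm) _; rewrite ler_expR lerN2 kK natrD natrM /harmonic/=.
  have -> : (polm J)%:R / J.+1%:R ^+ 2 + K%:R / J.+1%:R =
     ((polm J)%:R + J.+1%:R * K%:R) / J.+1%:R ^+ 2 :> R by field.
  by rewrite invf_div le_eqVlt; apply/orP; left; apply/eqP; ring.
- apply: cvgM; first exact: cvg_cst.
  apply: cvgV => //; rewrite -[X in _ --> X]addr0 -[X in X + _]subr0.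
  apply: cvgD; first exact: cvgB.
  by rewrite -(mulr0 0); apply: cvgM; exact: cvg_harmonic.
- apply: cvgM; first exact: cvg_cst.
  by apply: cvgV => //; rewrite -[X in _ --> X]addr0; exact: cvgD.
Qed.

End BinomialGauss.

(** * Powers of cosines tend to Gaussians; Polya's identity by residue classes *)

Section CosGauss.
Context {R : realType}.
Implicit Types (x y t : R).
Variables (mu : R) (b : nat).
Hypothesis mu0 : 0 < mu.
Hypothesis b0 : (0 < b)%N.
Local Notation polm := (polm mu).

Let bR : (0 : R) < b%:R. Proof. by rewrite ltr0n. Qed.

Definition congr_set (a : int) : set int := [set k : int | (b%:Z %| k - a)%Z].

(** v runs over symmetric residues modulo l = (J+1) b. The second condition drops v = -l/2, so that
    for even l the class of l/2 is counted once. *)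
Definition gcos (J : nat) (v : int) : R :=
  if (2 * `|v| <= J.+1 * b)%N && (- (J.+1 * b)%:Z != 2 * v)
  then cos (pi * v%:~R / (J.+1 * b)%:R) ^+ (polm J).*2 else 0.

Lemma gcos_ge0 J v : 0 <= gcos J v.
Proof. by rewrite /gcos; case: ifP => // _; rewrite -mul2n exprM exprn_ge0// sqr_ge0. Qed.

Let A (v : int) : R := (pi * v%:~R / b%:R) ^+ 2.

Let A_abs v : A v = (pi * `|v|%N%:R / b%:R) ^+ 2.
Proof.
rewrite /A; case: v => j //.
by rewrite NegzE mulrNz mulrN mulNr sqrrN.
Qed.

Let cos_abs v (l : R) : cos (pi * v%:~R / l) = cos (pi * `|v|%N%:R / l).
Proof. by case: v => j //; rewrite NegzE mulrNz mulrN mulNr cosN. Qed.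

Let theta_sqr J (k : nat) :
  (pi * k%:R / (J.+1 * b)%:R) ^+ 2 = (pi * k%:R / b%:R) ^+ 2 / J.+1%:R ^+ 2 :> R.
Proof.
have j1 : J.+1%:R != 0 :> R by rewrite pnatr_eq0.
rewrite natrM; move: (J.+1%:R : R) j1 (lt0r_neq0 bR) => j j1 b1.
by field; rewrite ?b1 ?j1.
Qed.

Let gcos_le_sharp J v : gcos J v <= expR (- ((polm J)%:R / J.+1%:R ^+ 2 * A v)).
Proof.
rewrite /gcos; case: ifPn => [/andP[h _]|_]; last exact: expR_ge0.
rewrite cos_abs A_abs; set k := `|v|%N in h *.
have l0 : (0 : R) < (J.+1 * b)%:R by rewrite ltr0n muln_gt0.
have th : 0 <= (pi : R) * k%:R / (J.+1 * b)%:R <= pi / 2.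
  apply/andP; split; first by rewrite divr_ge0 ?(ltW l0)// mulr_ge0// pi_ge0.
  rewrite -mulrA ler_wpM2l ?pi_ge0//.
  have : 2 * k%:R <= (J.+1 * b)%:R :> R by rewrite -natrM ler_nat.
  rewrite ler_pdivrMr//; lra.
have c0 : 0 <= cos ((pi : R) * k%:R / (J.+1 * b)%:R).
  apply: cos_ge0_pihalf; case/andP: th => t1 t2; rewrite t2 andbT.
  by apply: le_trans t1; rewrite oppr_le0 divr_ge0// pi_ge0.
apply: le_trans (lerXn2r _ _ _ (cos_le_expR th)) _; rewrite ?nnegrE ?expR_ge0//.
rewrite -expRM_natr ler_expR theta_sqr -muln2 natrM.
by rewrite le_eqVlt; apply/orP; left; apply/eqP; rewrite /A -A_abs; field.
Qed.

Lemma gcos_le J v : gcos J v <= expR (- (mu * (pi / b%:R) ^+ 2 * `|v|%N%:R)).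
Proof.
apply: le_trans (gcos_le_sharp J v) _; rewrite ler_expR lerN2 A_abs.
have /andP[h1 _] := polm_bounds mu0 J.
set k := `|v|%N.
have kk : k%:R <= k%:R ^+ 2 :> R.
  rewrite -natrX ler_nat; clear; case: k => // k.
  by rewrite expnS expn1 leq_pmulr.
have -> : pi * k%:R / b%:R = (pi / b%:R) * k%:R :> R by ring.
have s0 : 0 <= mu * (pi / b%:R) ^+ 2 by rewrite mulr_ge0 ?sqr_ge0 ?(ltW mu0).
rewrite [X in _ <= _ * X]exprMn [leRHS]mulrA; apply: (ler_pM s0 _ _ kk) => //.
rewrite ler_wpM2r ?sqr_ge0// ler_pdivlMr ?exprn_gt0//.
by rewrite mulrC.
Qed.

Lemma gcos_cvg v : (fun J => gcos J v) @ \oo --> expR (- (mu * (pi * v%:~R / b%:R) ^+ 2)).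
Proof.
rewrite -/(A v).
have hh : (fun J => A v / 2 * (harmonic J * harmonic J) : R) @ \oo --> (0 : R).
  rewrite -(mulr0 (A v / 2)); apply: cvgM; first exact: cvg_cst.
  by rewrite -(mulr0 0); apply: cvgM; exact: cvg_harmonic.
have hm := polm_cvg mu0.
apply: (@squeeze_expR _ _ (fun J => (polm J)%:R / J.+1%:R ^+ 2 * A v /
    (1 - A v / 2 * (harmonic J * harmonic J)))
  (fun J => (polm J)%:R / J.+1%:R ^+ 2 * A v)).
- have e1 : \forall J \near \oo, A v / 2 * (harmonic J * harmonic J) < 1.
    by apply: (cvgr_lt _ hh).
  have e2 : \forall J \near \oo, (2 * `|v| < J.+1)%N.
    by exists (2 * `|v|)%N => // J /= hJ; rewrite ltnS.
  near=> J.
  rewrite gcos_le_sharp andbT.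
  have h1 : A v / 2 * (harmonic J * harmonic J) < 1 by near: J.
  have h2 : (2 * `|v| < J.+1)%N by near: J.
  have lb : (J.+1 <= J.+1 * b)%N by rewrite leq_pmulr.
  rewrite /gcos (leq_trans (ltnW h2) lb)/= ifT; last first.
    apply/eqP => h; move: h2 lb; clear -h; lia.
  rewrite cos_abs; set k := `|v|%N.
  have j1 : J.+1%:R != 0 :> R by rewrite pnatr_eq0.
  pose th : R := pi * k%:R / (J.+1 * b)%:R.
  have thA : th ^+ 2 / 2 = A v / 2 * (harmonic J * harmonic J).
    rewrite theta_sqr -A_abs /harmonic/=.
    by move: (J.+1%:R : R) (A v) j1 => j a j1; field.
  have th0 : 0 <= th by rewrite divr_ge0// mulr_ge0// pi_ge0.
  have c1 := cos_ge_quad th0.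
  have c2 := one_sub_ge_expR (eq_ind_r (fun u : R => u < 1) h1 thA).
  have := lerXn2r (polm J).*2 _ _ (le_trans c2 c1); rewrite !nnegrE.
  rewrite expR_ge0 (le_trans (expR_ge0 _) (le_trans c2 c1)) => /(_ isT isT).
  apply: le_trans; rewrite -expRM_natr ler_expR thA -muln2 natrM.
  have p1 : 1 - A v / 2 * (harmonic J * harmonic J) != 0 by rewrite gt_eqF// subr_gt0.
  rewrite le_eqVlt; apply/orP; left; apply/eqP.
  rewrite /harmonic/=; move: (1 - _) p1 => d d0; move: (J.+1%:R : R) (A v) j1 => j a j1.
  by field; rewrite d0.
- rewrite -[X in _ --> X]divr1; apply: cvgM.
    by apply: cvgM => //; exact: cvg_cst.
  apply: cvgV; first exact: oner_neq0.
  by rewrite -[X in _ --> X]subr0; apply: cvgB => //; exact: cvg_cst.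
- by apply: cvgM => //; exact: cvg_cst.
Unshelve. all: end_near. Qed.

Lemma congr_set_mod (a : nat) (k : int) : congr_set a k <-> (`|(k %% b)%Z|%N = a %% b)%N.
Proof.
have bn0 : b%:Z != 0 by rewrite eqz_nat -lt0n.
rewrite /congr_set /= -eqz_mod_dvd; split.
  by move/eqP => ->; rewrite modz_nat absz_nat.
by move=> h; rewrite modz_nat -h gez0_abs ?eqxx// modz_ge0.
Qed.

Lemma sum_gcos J (c : nat) : rsum (congr_set c) (gcos J) =
  \sum_(v < J.+1 * b | (b%:Z %| v%:Z - c%:Z)%Z)
    cos (pi * v%:R / (J.+1 * b)%:R) ^+ (polm J).*2.
Proof.
set l := (J.+1 * b)%N; have l0 : (0 < l)%N by rewrite muln_gt0.
pose e (v : 'I_l) : int := if (2 * v <= l)%N then v%:Z else v%:Z - l%:Z.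
have bl : (b%:Z %| l%:Z)%Z by rewrite /l PoszM dvdz_mull.
have [] := @rsum_finite_image R _ _ (fun v : 'I_l => (b%:Z %| v%:Z - c%:Z)%Z) e (congr_set c) (gcos J).
- exact: gcos_ge0.
- move=> i j _ _ eij; apply/val_inj => /=; move: eij; rewrite /e.
  by have := ltn_ord i; have := ltn_ord j; clear; case: ifP; case: ifP; lia.
- move=> v hv; rewrite /congr_set /= /e; case: ifP => // _.
  by rewrite addrAC rpredB.
- move=> k; rewrite /congr_set /= => hk; rewrite /gcos -/l.
  case: ifP => [/andP[h1 h2] _|]; last by rewrite eqxx.
  have [k0|k0] := leP 0 k.
    have kl : (`|k| < l)%N by move: h1 l0 k0; clear; lia.
    exists (Ordinal kl); first by rewrite /= gez0_abs.
    by rewrite /e /= h1 gez0_abs.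
  have kl : (`|(k + l%:Z)%R| < l)%N by move: h1 h2 l0 k0; clear; lia.
  have ka : `|(k + l%:Z)%R|%N = k + l%:Z :> int by rewrite gez0_abs//; move: h1 l0 k0; clear; lia.
  exists (Ordinal kl); first by rewrite /= ka addrAC rpredD.
  rewrite /e /= ifF; last by move: h1 h2 l0 k0; clear; lia.
  by rewrite ka addrK.
move=> _ ->; apply: eq_bigr => v _; rewrite /gcos -/l /e.
have vl := ltn_ord v; have [hv|hv] := leqP (2 * v) l.
  by rewrite ifT//; apply/andP; split=> //; apply/eqP; move: l0; clear; lia.
rewrite ifT; last by apply/andP; split; [|apply/eqP]; move: hv vl; clear; lia.
have -> : pi * (v%:Z - l%:Z)%:~R / l%:R = pi * v%:R / l%:R - pi :> R.
  by rewrite intrB -!pmulrn; field; rewrite pnatr_eq0 -lt0n.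
(* Moving v by l changes the cosine by a sign, which the even exponent removes. *)
have -> x : cos (x - pi) = - cos x :> R by rewrite -[x in RHS](subrK pi) cosDpi opprK.
by rewrite -mul2n !exprM sqrrN.
Qed.

(** The divisibility selects the indices j = m + (J+1) k with k = a mod b. *)
Lemma sum_gbin J (a : nat) :
  (J.+1 * b)%:R * \sum_(j < (polm J).*2.+1 |
     ((J.+1 * b)%:Z %| j%:Z - (polm J)%:Z - (J.+1 * a)%:Z)%Z) 'C((polm J).*2, j)%:R =
  (J.+1 * b)%:R * 'C((polm J).*2, polm J)%:R * rsum (congr_set a) (gbin mu J) :> R.
Proof.
set m := polm J; rewrite -mulrA; congr (_ * _).
have K0 : J.+1%:Z != 0 by [].
pose e (j : 'I_m.*2.+1) : int := ((j%:Z - m%:Z) %/ J.+1%:Z)%Z.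
pose P (j : 'I_m.*2.+1) := ((J.+1 * b)%:Z %| j%:Z - m%:Z - (J.+1 * a)%:Z)%Z.
have eK j : P j -> j%:Z - m%:Z = J.+1%:Z * e j.
  move=> /dvdzP[q hq]; rewrite /e.
  have -> : j%:Z - m%:Z = (q * b%:Z + a%:Z) * J.+1%:Z.
    by rewrite -[LHS](subrK (J.+1 * a)%:Z) hq !PoszM; ring.
  by rewrite mulzK// mulrC.
have [] := @rsum_finite_image R _ _ P e (congr_set a) (gbin mu J).
- exact: gbin_ge0.
- move=> i j Pi Pj eij; apply/val_inj => /=.
  have : i%:Z - m%:Z = j%:Z - m%:Z by rewrite (eK _ Pi) (eK _ Pj) eij.
  by clear; lia.
- move=> j Pj; have := Pj; rewrite /P /congr_set /= eK// !PoszM -mulrBr.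
  by rewrite dvdz_mul2l.
- move=> k; rewrite /congr_set /= => hk; rewrite /gbin -/m.
  case: ifP => [h _|]; last by rewrite eqxx.
  have kl : (`|(m%:Z + J.+1%:Z * k)%R| < m.*2.+1)%N.
    have E : `|(J.+1%:Z * k)%R|%N = (J.+1 * `|k|)%N by rewrite abszM.
    by move: h E; clear; lia.
  have ka : `|(m%:Z + J.+1%:Z * k)%R|%N = m%:Z + J.+1%:Z * k :> int.
    rewrite gez0_abs//.
    have E : `|(J.+1%:Z * k)%R|%N = (J.+1 * `|k|)%N by rewrite abszM.
    by move: h E; clear; lia.
  exists (Ordinal kl).
    by rewrite /P /= ka (addrC m%:Z) addrK !PoszM -mulrBr dvdz_mul2l.
  by rewrite /e /= ka (addrC m%:Z) addrK mulKz.
move=> _ ->; rewrite mulr_sumr; apply: eq_bigr => j Pj.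
have jm := ltn_ord j.
have Ke : (J.+1 * `|e j| = `|(j%:Z - m%:Z)%R|)%N by rewrite eK// abszM.
rewrite /gbin -/m Ke ifT; last by move: jm; clear; lia.
rewrite /binr mulrC divfK; last by rewrite pnatr_eq0 -lt0n bin_gt0 -addnn leq_addr.
congr (_%:R); have [mj|/ltnW mj] := leqP m j.
  by congr 'C(_, _); move: mj; clear; lia.
rewrite -bin_sub; last by move: jm; clear; lia.
by congr 'C(_, _); move: mj; clear; lia.
Qed.

(** [polya_identity] with its left side sorted by the residue of v modulo b, on which alone the
    twisting cosine depends, and divided by 4^m. *)
Lemma polya_regrouped J (a : nat) :
  \sum_(c < b) cos (pi *+ 2 * (c%:R * a%:R / b%:R)) * rsum (congr_set c) (gcos J) =
  (J.+1 * b)%:R * ('C((polm J).*2, polm J)%:R / 4 ^+ polm J) * rsum (congr_set a) (gbin mu J) :> R.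
Proof.
have h4 : (4 : R) ^+ polm J != 0 by rewrite expf_neq0// pnatr_eq0.
apply: (mulfI h4).
transitivity ((J.+1 * b)%:R * 'C((polm J).*2, polm J)%:R * rsum (congr_set a) (gbin mu J) : R); last first.
  by field.
rewrite -sum_gbin -polya_identity// mulr_sumr.
rewrite [RHS](partition_big (fun v : 'I_(J.+1 * b) => Ordinal (ltn_pmod v b0)) xpredT)//=.
apply: eq_bigr => c _; rewrite sum_gcos !mulr_sumr; apply: eq_big.
  move=> v; rewrite -eqz_mod_dvd !modz_nat eqz_nat [in X in _ == X]modn_small//.
move=> v /dvdzP[q hq].
have -> : cos (pi *+ 2 * (v%:R * a%:R / b%:R)) = cos (pi *+ 2 * (c%:R * a%:R / b%:R)) :> R.
  have -> : pi *+ 2 * (v%:R * a%:R / b%:R) = pi *+ 2 * (c%:R * a%:R / b%:R) + pi *+ 2 * (q * a%:Z)%:~R :> R.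
    have -> : v%:R = c%:R + q%:~R * b%:R :> R.
      have := congr1 (fun z : int => z%:~R : R) hq.
      by rewrite intrB intrM -!pmulrn => /eqP; rewrite subr_eq addrC => /eqP.
    by rewrite intrM -pmulrn; field; rewrite gt_eqF.
  have := @cis_int R (q * a%:Z); rewrite cisE => -[hc hs].
  by rewrite cosD hc hs mulr1 mulr0 subr0.
have -> : (4 : R) = 2 ^+ 2 by rewrite -natrX.
by rewrite -exprM mul2n [in RHS]exprMn -[RHS]mulrA [X in _ = _ * X]mulrC.
Qed.

End CosGauss.

(** * Asymptotics of the central binomial coefficient *)

Section Wallis.
Context {R : realType}.

Definition cbin (m : nat) : R := 'C(m.*2, m)%:R / 4 ^+ m.

Lemma cbinS m : cbin m.+1 = cbin m * ((2 * m + 1)%:R / (2 * m + 2)%:R).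
Proof.
have h : ('C(m.+1.*2, m.+1) * m.+1 = 2 * ((2 * m + 1) * 'C(m.*2, m)))%N.
  have h1 : ((m.*2).+2 * 'C((m.*2).+1, m) = m.+1 * 'C((m.*2).+2, m.+1))%N := mul_bin_diag _ _.
  have h4 : ((m.*2).+1 * 'C(m.*2, m) = ((m.*2).+1 - m) * 'C((m.*2).+1, m))%N := mul_bin_down _ _.
  have e : ((m.*2).+1 - m = m.+1)%N by rewrite -addnn; lia.
  rewrite e in h4; rewrite doubleS; move: h1 h4; rewrite -mul2n.
  move: ('C((2 * m).+2, m.+1)) ('C((2 * m).+1, m)) ('C(2 * m, m)) => X Y Z h1 h4; nia.
have m1 : m.+1%:R != 0 :> R by rewrite pnatr_eq0.
have h' : 'C(m.+1.*2, m.+1)%:R * m.+1%:R = 2 * ((2 * m + 1)%:R * 'C(m.*2, m)%:R) :> R.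
  by rewrite -!natrM h.
rewrite /cbin; have -> : (2 * m + 2)%:R = 2 * m.+1%:R :> R by rewrite -natrM; congr _%:R; lia.
rewrite exprS; apply: (mulIf m1).
rewrite mulrAC h'; move: (m.+1%:R : R) m1 => u u0.
have f4 : 4 ^+ m != 0 :> R by rewrite expf_neq0// pnatr_eq0.
by field; rewrite u0 f4.
Qed.

Lemma cbin_gt0 m : 0 < cbin m.
Proof. by rewrite divr_gt0 ?exprn_gt0// ltr0n bin_gt0 -addnn leq_addr. Qed.

Let wpM2l_sqr (c q k l : R) : k <= q ^+ 2 * l -> c ^+ 2 * k <= (c * q) ^+ 2 * l.
Proof. by move=> h; rewrite exprMn -(mulrA (c ^+ 2)) ler_wpM2l ?sqr_ge0. Qed.

Let wpM2l_sqr' (c q k l : R) : q ^+ 2 * l <= k -> (c * q) ^+ 2 * l <= c ^+ 2 * k.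
Proof. by move=> h; rewrite exprMn -(mulrA (c ^+ 2)) ler_wpM2l ?sqr_ge0. Qed.

(** With c_m = [cbin m], c_m^2 m increases while c_m^2 (m + 1/2) decreases. The value 1/pi of the
    limit is left open here; [gaussian_class_dual] extracts it from the functional equation
    itself. *)
Lemma cbin_sqr_cvg : exists2 L : R, 0 < L & (fun m => cbin m ^+ 2 * m%:R) @ \oo --> L.
Proof.
pose w m := cbin m ^+ 2 * m%:R.
have nd : nondecreasing_seq w.
  apply/nondecreasing_seqP => m; rewrite /w cbinS; apply: wpM2l_sqr.
  rewrite expr_div_n mulrAC ler_pdivlMr ?exprn_gt0// -!natrX -!natrM ler_nat.
  by rewrite !expnS expn0; nia.
have ub m : w m <= 1 / 2.
  have : cbin m ^+ 2 * (m%:R + 1 / 2) <= 1 / 2.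
    elim: m => [|m ih]; first by rewrite /cbin double0 bin0 expr0 divr1 expr1n mul1r add0r.
    apply: le_trans ih; rewrite cbinS; apply: wpM2l_sqr'.
    rewrite expr_div_n mulrAC ler_pdivrMr ?exprn_gt0//.
    rewrite -[m.+1%:R]natr1 (natrD _ (2 * m) 1) (natrD _ (2 * m) 2) (natrM _ 2 m); have : (0 : R) <= m%:R by []; nra.
  rewrite /w mulrDr; have := sqr_ge0 (cbin m); lra.
have cw : cvgn w.
  by apply: nondecreasing_is_cvgn => //; exists (1 / 2) => _ [m _ <-].
exists (limn w) => //.
apply: lt_le_trans (_ : w 1%N <= _); first by rewrite /w mulr1 exprn_gt0// cbin_gt0.
exact: nondecreasing_cvgn_le.
Qed.

End Wallis.

(** * Functional equation of Gaussian sums over residue classes *)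

Section ThetaTransform.
Context {R : realType}.
Implicit Types (x y t : R).

(** The theta series of a coset of sqrt(b) Z in its dual lattice: k / sqrt(b) has norm k^2 / b. *)
Definition gaussian_class (b a : nat) t : R :=
  rsum (congr_set b a) (fun k => expR (- (pi * t * k%:~R ^+ 2 / b%:R))).

Lemma summ_exp_abs (S : set int) (c : R) : 0 < c -> summ S (fun k => expR (- (c * `|k|%N%:R))).
Proof.
move=> c0; apply: (@summ_sub _ _ setT) => //.
have q1 : 0 <= expR (- c) < 1 by rewrite expR_ge0 expR_lt1 oppr_lt0.
rewrite (eq_summ (g := fun k => expR (- c) ^+ `|k|%N)); first exact: summ_geo_int.
by move=> k _; rewrite -expRM_natr mulNr.
Qed.

Lemma summ_gaussian_class b a t : (0 < b)%N -> 0 < t ->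
  summ (congr_set b a) (fun k => expR (- (pi * t * k%:~R ^+ 2 / b%:R))).
Proof.
move=> b0 t0; have bR : (0 : R) < b%:R by rewrite ltr0n.
have c0 : 0 < pi * t / b%:R by rewrite divr_gt0// mulr_gt0// pi_gt0.
apply: summ_le (summ_exp_abs _ c0) => [k|k _]; first exact: expR_ge0.
rewrite ler_expR lerN2 [leRHS]mulrAC ler_wpM2l ?(ltW c0)//.
have -> : k%:~R ^+ 2 = `|k|%N%:R ^+ 2 :> R.
  by case: (k) => j //; rewrite NegzE mulrNz sqrrN.
rewrite -natrX ler_nat; case: `|k|%N => // j.
by rewrite expnS expn1 leq_pmulr.
Qed.

Lemma gaussian_class_gt0 b t : (0 < b)%N -> 0 < t -> 0 < gaussian_class b 0 t.
Proof.
move=> b0 t0.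
have h := @rsum_fset_le _ _ (congr_set b 0) _ [fset 0%R]%fset
  (fun k => expR_ge0 _) (summ_gaussian_class 0 b0 t0).
apply: lt_le_trans (h _); last first.
  by move=> k; rewrite /= inE => /eqP ->; rewrite /congr_set/= subr0 dvdz0.
by rewrite big_seq_fset1 expR_gt0.
Qed.

Section Limit.
Variables (b : nat) (t : R).
Hypothesis b0 : (0 < b)%N.
Hypothesis t0 : 0 < t.
Let mu := b%:R / (pi * t).

Let bR : (0 : R) < b%:R. Proof. by rewrite ltr0n. Qed.

Let mu0 : 0 < mu. Proof. by rewrite divr_gt0// mulr_gt0// pi_gt0. Qed.

Let gbin_sum_cvg (a : nat) : (fun J => rsum (congr_set b a) (gbin mu J)) @ \oo --> gaussian_class b a t.
Proof.
have c0 : 0 < (2 * (mu + 1))^-1 by rewrite invr_gt0 mulr_gt0// addr_gt0.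
have := @tannery R _ (congr_set b a) (gbin mu)
  (fun k => expR (- (pi * t * k%:~R ^+ 2 / b%:R))) (fun k => expR (- ((2 * (mu + 1))^-1 * `|k|%N%:R))).
move=> /(_ (gbin_ge0 _) (fun k => expR_ge0 _) (fun k => expR_ge0 _)
  (fun J k _ => gbin_le mu0 J k) (summ_exp_abs _ c0)) h.
apply: (proj2 (h _)) => k _.
have -> : pi * t * k%:~R ^+ 2 / b%:R = k%:~R ^+ 2 / mu :> R.
  rewrite /mu; move: (pi : R) (pi_gt0 R) => P p0; field; by rewrite !gt_eqF.
exact: gbin_cvg.
Qed.

Let gcos_sum_cvg (c : nat) : (fun J => rsum (congr_set b c) (gcos mu b J)) @ \oo --> gaussian_class b c t^-1.
Proof.
have c0 : 0 < mu * (pi / b%:R) ^+ 2 by rewrite mulr_gt0// exprn_gt0// divr_gt0// pi_gt0.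
have := @tannery R _ (congr_set b c) (gcos mu b)
  (fun k => expR (- (pi * t^-1 * k%:~R ^+ 2 / b%:R))) (fun k => expR (- (mu * (pi / b%:R) ^+ 2 * `|k|%N%:R))).
move=> /(_ (gcos_ge0 _ _) (fun k => expR_ge0 _) (fun k => expR_ge0 _)
  (fun J k _ => gcos_le mu0 b0 J k) (summ_exp_abs _ c0)) h.
apply: (proj2 (h _)) => k _.
have -> : pi * t^-1 * k%:~R ^+ 2 / b%:R = mu * (pi * k%:~R / b%:R) ^+ 2 :> R.
  rewrite /mu; move: (pi : R) (pi_gt0 R) => P p0; field; by rewrite !gt_eqF.
exact: gcos_cvg.
Qed.

Let polm_oo : polm mu @ \oo --> \oo.
Proof.
apply/cvgnyPge => N.
exists (Num.truncn (N%:R / mu)).+1 => // J /= hJ.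
have /andP[h1 _] := polm_bounds mu0 J.
rewrite -(ler_nat R); apply: le_trans h1.
have h2 := truncnS_gt (N%:R / mu).
rewrite -ler_pdivrMr//; apply: le_trans (ltW h2) _.
rewrite -natrX ler_nat; apply: leq_trans (leqW hJ) _.
by rewrite expnS expn1 leq_pmulr.
Qed.

(** The limit of [polya_regrouped] as J grows. The common factor d_J converges because the two sums
    do for a = 0, where the sum on the right has a positive limit; its limit is identified through
    its square, L / mu. *)
Lemma gaussian_class_dual_const (L : R) : 0 < L -> (fun m => cbin m ^+ 2 * m%:R) @ \oo --> L ->
  forall a, \sum_(c < b) cos (pi *+ 2 * (c%:R * a%:R / b%:R)) * gaussian_class b c t^-1 =
     Num.sqrt (L * pi) * Num.sqrt (t * b%:R) * gaussian_class b a t.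
Proof.
move=> L0 hL.
pose d J : R := J.+1%:R * cbin (polm mu J).
pose F a J : R := \sum_(c < b) cos (pi *+ 2 * (c%:R * a%:R / b%:R)) * rsum (congr_set b c) (gcos mu b J).
have FE a J : F a J = b%:R * d J * rsum (congr_set b a) (gbin mu J).
  by rewrite /F polya_regrouped// /d /cbin natrM; ring.
have Fcvg a : F a @ \oo --> \sum_(c < b) cos (pi *+ 2 * (c%:R * a%:R / b%:R)) * gaussian_class b c t^-1.
 rewrite /F; apply: (cvg_big add_continuous) => c _; apply: cvgM; first exact: cvg_cst.
  exact: gcos_sum_cvg.
have G0 := gaussian_class_gt0 b0 t0.
pose dl := (\sum_(c < b) cos (pi *+ 2 * (c%:R * 0%:R / b%:R)) * gaussian_class b c t^-1) /
  gaussian_class b 0 t / b%:R.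
have d0 J : 0 <= d J by rewrite mulr_ge0// ltW// cbin_gt0.
have dcvg : d @ \oo --> dl.
  have h : (fun J => F 0%N J / rsum (congr_set b 0%N) (gbin mu J) / b%:R) @ \oo --> dl.
    apply: cvgM; last exact: cvg_cst.
    by apply: (cvgM (Fcvg 0%N)); apply: cvgV; [rewrite gt_eqF|].
  have e : \forall J \near \oo, 0 < rsum (congr_set b 0%N) (gbin mu J).
    have /cvgrPdist_lt /(_ _ G0) := @gbin_sum_cvg 0%N; apply: filterS => J.
    by rewrite ltr_norml => /andP[_]; lra.
  apply: cvg_trans h; apply: near_eq_cvg; apply: filterS e => J hJ.
  by rewrite FE mulfK ?gt_eqF// mulrC mulKf// gt_eqF.
have d2 : (fun J => d J ^+ 2) @ \oo --> L / mu.
  have h : (fun J => (cbin (polm mu J) ^+ 2 * (polm mu J)%:R) / ((polm mu J)%:R / J.+1%:R ^+ 2)) @ \oo --> L / mu.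
    apply: cvgM; first exact: (cvg_comp _ _ polm_oo hL).
    by apply: cvgV; [rewrite gt_eqF|exact: polm_cvg].
  apply: cvg_trans h; apply: near_eq_cvg; apply: nearW => J.
  have p0 : (polm mu J)%:R != 0 :> R by rewrite pnatr_eq0.
  have j0 : J.+1%:R != 0 :> R by rewrite pnatr_eq0.
  rewrite /d; move: ((polm mu J)%:R : R) (J.+1%:R : R) p0 j0 => u v u0 v0.
  by field; rewrite u0 v0.
have dl2 : dl ^+ 2 = L / mu.
  have h : (fun J => d J ^+ 2) @ \oo --> dl ^+ 2.
    by rewrite expr2; under eq_fun do rewrite expr2; exact: cvgM.
  by have := cvg_unique _ h d2; apply.
have dl0 : 0 <= dl by apply: (cvgr_to_ge dcvg); apply: nearW.
have dlE : b%:R * dl = Num.sqrt (L * pi) * Num.sqrt (t * b%:R).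
  move: dl0 dl2; generalize dl => D D0 D2.
  apply: (@pexpIrn _ 2) => //; rewrite ?nnegrE ?mulr_ge0 ?sqrtr_ge0 ?ler0n//.
  rewrite !exprMn !sqr_sqrtr ?mulr_ge0 ?pi_ge0 ?ler0n ?(ltW L0) ?(ltW t0)// D2 /mu.
  by move: (pi : R) (pi_gt0 R) => P p0; field; rewrite !gt_eqF.
move=> a; rewrite -dlE.
have h : F a @ \oo --> b%:R * dl * gaussian_class b a t.
  rewrite (_ : F a = fun J => b%:R * d J * rsum (congr_set b a) (gbin mu J)); last by apply/funext => J; exact: FE.
  by apply: cvgM => //; apply: cvgM => //; exact: cvg_cst.
by have := cvg_unique _ (Fcvg a) h; apply.
Qed.
End Limit.

(** For b = 1, t = 1, a = 0 both sides contain the same positive sum, which forces sqrt(L pi) =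
    1. *)
Theorem gaussian_class_dual (b : nat) t (a : nat) : (0 < b)%N -> 0 < t ->
  \sum_(c < b) cos (pi *+ 2 * (c%:R * a%:R / b%:R)) * gaussian_class b c t^-1 =
  Num.sqrt (t * b%:R) * gaussian_class b a t.
Proof.
move=> b0 t0; have [L L0 hL] := @cbin_sqr_cvg R.
have h1 := gaussian_class_dual_const (ltn0Sn 0) (@ltr01 R) L0 hL 0.
rewrite (gaussian_class_dual_const b0 t0 L0 hL).
suff -> : Num.sqrt (L * pi) = 1 by rewrite mul1r.
have G0 := gaussian_class_gt0 (ltn0Sn 0) (@ltr01 R).
move: h1; rewrite big_ord_recl big_ord0 mul0r mul0r mulr0 cos0 mul1r addr0 invr1 mulr1 sqrtr1 mulr1.
by rewrite -[X in X = _ -> _]mul1r => /(mulIf (lt0r_neq0 G0)).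
Qed.

End ThetaTransform.

(** * Jacobi theta constants *)

Section Thetas.
Context {R : realType}.
Implicit Types (x y t : R).

(** The three constants are sums over residue classes modulo 1 and 2, so that their inversion
    formulas come from [gaussian_class_dual]. In [th2] the terms are e^(-pi y k^2 / 4) for odd k. *)
Definition th3 y : R := gaussian_class 1 0 y.
Definition th2 y : R := gaussian_class 2 1 (y / 2).
Definition th4 y : R := gaussian_class 2 0 (2 * y) - gaussian_class 2 1 (2 * y).

Lemma th3_gt0 y : 0 < y -> 0 < th3 y.
Proof. exact: gaussian_class_gt0. Qed.

Lemma th2_gt0 y : 0 < y -> 0 < th2 y.
Proof.
move=> y0; have y2 : 0 < y / 2 by rewrite divr_gt0.
have h := @rsum_fset_le _ _ (congr_set 2 1) _ [fset 1%R]%fset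
  (fun k => expR_ge0 _) (summ_gaussian_class 1 (ltn0Sn 1) y2).
apply: lt_le_trans (h _); last first.
  by move=> k; rewrite /= inE => /eqP ->; rewrite /congr_set/= subrr dvdz0.
by rewrite big_seq_fset1 expR_gt0.
Qed.

Lemma th3_dual y : 0 < y -> th3 y^-1 = Num.sqrt y * th3 y.
Proof.
move=> y0; have := gaussian_class_dual 0 (ltn0Sn 0) y0.
by rewrite big_ord_recl big_ord0 !mul0r mulr0 cos0 mul1r addr0 mulr1.
Qed.

Lemma th4_dual y : 0 < y -> th4 y^-1 = Num.sqrt y * th2 y.
Proof.
move=> y0; have y2 : 0 < y / 2 by rewrite divr_gt0.
have := gaussian_class_dual 1 (ltn0Sn 1) y2.
rewrite !big_ord_recl big_ord0 /bump/= !mul0r mulr0 cos0 mul1r addr0 divfK//.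
rewrite (_ : pi *+ 2 * (1 * 1 / 2) = pi); last by field.
by rewrite cospi mulN1r invfM invrK mulrC.
Qed.

Lemma th2_dual y : 0 < y -> th2 y^-1 = Num.sqrt y * th4 y.
Proof.
move=> y0; have yi0 : 0 < y^-1 by rewrite invr_gt0.
have := th4_dual yi0; rewrite invrK => ->; rewrite mulrA -sqrtrM ?ltW// mulfV ?gt_eqF//.
by rewrite sqrtr1 mul1r.
Qed.

Lemma even_class y : gaussian_class 2 0 (2 * y) = th3 (4 * y).
Proof.
have bij : set_bij (congr_set 1 0) (congr_set 2 0) (fun k : int => 2 * k).
  split => [k _|k k' _ _ /=|k].
  - by rewrite /congr_set/= subr0 dvdz_mulr.
  - by apply: mulfI.
  - by rewrite /congr_set/= subr0 => /dvdzP[q ->]; exists q; rewrite ?dvd1z// mulrC.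
rewrite /th3 /gaussian_class.
rewrite (proj1 (rsum_bij (fun k : int => expR (- (pi * (2 * y) * k%:~R ^+ 2 / 2%:R)) : R) bij)).
by apply: eq_rsum => k _ /=; rewrite rmorphM/=; congr (expR (- _)); field.
Qed.

Lemma odd_class y : gaussian_class 2 1 (2 * y) = th2 (4 * y).
Proof. by rewrite /th2; congr gaussian_class; field. Qed.

Lemma parity_cover : congr_set 1 0 = congr_set 2 0 `|` congr_set 2 1.
Proof.
apply/seteqP; split => k; rewrite /congr_set/= ?dvd1z// subr0 => _.
have [h|h] : (2 %| k)%Z \/ (2 %| k - 1)%Z by lia.
  by left. by right.
Qed.

Lemma th3_split y : 0 < y -> th3 y = th3 (4 * y) + th2 (4 * y).
Proof.
move=> y0; have y2 : 0 < 2 * y by rewrite mulr_gt0.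
rewrite -even_class -odd_class /gaussian_class.
have e (S : set int) : rsum S (fun k => expR (- (pi * (2 * y) * k%:~R ^+ 2 / 2%:R)) : R) =
    rsum S (fun k => expR (- (pi * y * k%:~R ^+ 2 / 1%:R))).
  by apply: eq_rsum => k _; congr (expR (- _)); field.
rewrite -(proj2 (rsum_setU _ _ (summ_gaussian_class 0 (ltn0Sn 1) y2) (summ_gaussian_class 1 (ltn0Sn 1) y2))).
- by rewrite -parity_cover e.
- by move=> k; exact: expR_ge0.
- by apply/seteqP; split => k // -[]; rewrite /congr_set/=; lia.
Qed.

Lemma th4_split y : th4 y = th3 (4 * y) - th2 (4 * y).
Proof. by rewrite -even_class -odd_class. Qed.

Definition gexp y (k : int) : R := expR (- (pi * y * k%:~R ^+ 2)).

Lemma th3E y : th3 y = rsum (congr_set 1 0) (gexp y).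
Proof. by apply: eq_rsum => k _; rewrite /gexp divr1. Qed.

Lemma th2E y : th2 (4 * y) = rsum (congr_set 2 1) (gexp y).
Proof.
by rewrite -odd_class; apply: eq_rsum => k _; rewrite /gexp; congr (expR (- _)); field.
Qed.

Lemma th3E4 y : th3 (4 * y) = rsum (congr_set 2 0) (gexp y).
Proof.
by rewrite -even_class; apply: eq_rsum => k _; rewrite /gexp; congr (expR (- _)); field.
Qed.

Lemma summ_gexp S y : 0 < y -> summ S (gexp y).
Proof.
move=> y0; have := summ_gaussian_class 0 (ltn0Sn 0) y0; rewrite parity_cover -parity_cover.
move=> h; apply: (@summ_sub _ _ (congr_set 1 0)) => [k|k _|]; first exact: expR_ge0.
  by rewrite /congr_set/= dvd1z.
by rewrite (eq_summ (g := fun k => expR (- (pi * y * k%:~R ^+ 2 / 1%:R)))) // => k _; rewrite /gexp divr1.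
Qed.

Let E := congr_set 2 0.
Let O := congr_set 2 1.

Definition gexp2 y (p : int * int) : R := gexp y p.1 * gexp y p.2.

Lemma gexp_ge0 y k : 0 <= gexp y k. Proof. exact: expR_ge0. Qed.

Lemma gexp2_prod S S' y : 0 < y -> summ (S `*` S') (gexp2 y) /\
  rsum (S `*` S') (gexp2 y) = rsum S (gexp y) * rsum S' (gexp y).
Proof. by move=> y0; apply: rsum_prod; try exact: gexp_ge0; exact: summ_gexp. Qed.

(* (a, b) |-> (a + b, a - b) doubles the norm on Z^2. *)
Lemma gexp2_rotate (P Q : set (int * int)) y :
  set_bij P Q (fun p : int * int => (p.1 + p.2, p.1 - p.2)) ->
  rsum Q (gexp2 y) = rsum P (gexp2 (2 * y)).
Proof.
move=> bij; rewrite (proj1 (rsum_bij (gexp2 y) bij)).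
apply: eq_rsum => -[a b] _; rewrite /gexp2/gexp /= -!expRD; congr expR.
by rewrite rmorphD rmorphB/=; ring.
Qed.

Lemma rotate_inj (P : set (int * int)) : set_inj P (fun p : int * int => (p.1 + p.2, p.1 - p.2)).
Proof.
move=> [a b] [a' b'] _ _ /= [h1 h2]; have h3 : a = a' by lia.
by rewrite h3; congr (_, _); lia.
Qed.

(** The square is a sum over Z^2, which (a, b) -> (a+b, a-b) maps onto the pairs of equal parity. *)
Lemma th3_double y : 0 < y -> th3 y ^+ 2 = th3 (2 * y) ^+ 2 + th2 (2 * y) ^+ 2.
Proof.
move=> y0; have z0 : 0 < y / 2 by rewrite divr_gt0.
have e : 2 * y = 4 * (y / 2) by field.
have ey : y = 2 * (y / 2) by field.
rewrite e th3E4 th2E {1}ey th3E.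
have bij : set_bij (congr_set 1 0 `*` congr_set 1 0) (E `*` E `|` O `*` O)
    (fun p : int * int => (p.1 + p.2, p.1 - p.2)).
  split; last 2 first.
  - exact: rotate_inj.
  - move=> [c d]; rewrite /E /O /congr_set/= => h; exists (((c + d) %/ 2)%Z, ((c - d) %/ 2)%Z).
      by split; rewrite /= dvd1z.
    by rewrite /=; congr (_, _); lia.
  - move=> [a b] _; rewrite /E /O /congr_set/=; lia.
have y2 : 0 < 2 * (y / 2) by rewrite mulr_gt0.
have [_ h] := gexp2_prod (congr_set 1 0) (congr_set 1 0) y2.
rewrite expr2 -h -(gexp2_rotate _ bij).
have [s1 h1] := gexp2_prod E E z0; have [s2 h2] := gexp2_prod O O z0.
have g0 p : 0 <= gexp2 (y / 2) p by rewrite mulr_ge0 ?gexp_ge0.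
have dis : (E `*` E) `&` (O `*` O) = set0.
  by apply/seteqP; split => -[a b] //; rewrite /E /O /congr_set/=; lia.
by rewrite (proj2 (rsum_setU g0 dis s1 s2)) h1 h2 -!expr2.
Qed.

Lemma th2_double y : 0 < y -> th2 y ^+ 2 = 2 * (th3 (2 * y) * th2 (2 * y)).
Proof.
move=> y0; have z0 : 0 < y / 4 by rewrite divr_gt0.
have z20 : 0 < 2 * (y / 4) by rewrite mulr_gt0.
have e : 2 * y = 4 * (2 * (y / 4)) by field.
have ey : y = 4 * (y / 4) by field.
rewrite e th3E4 th2E {1}ey th2E.
have bij : set_bij (E `*` O `|` O `*` E) (O `*` O)
    (fun p : int * int => (p.1 + p.2, p.1 - p.2)).
  split; last 2 first.
  - exact: rotate_inj.
  - move=> [c d]; rewrite /E /O /congr_set/= => h; exists (((c + d) %/ 2)%Z, ((c - d) %/ 2)%Z).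
      by rewrite /=; lia.
    by rewrite /=; congr (_, _); lia.
  - move=> [a b]; rewrite /E /O /congr_set/=; lia.
have [_ h] := gexp2_prod O O z0.
rewrite expr2 -h (gexp2_rotate _ bij).
have [s1 h1] := gexp2_prod E O z20; have [s2 h2] := gexp2_prod O E z20.
have g0 p : 0 <= gexp2 (2 * (y / 4)) p by rewrite mulr_ge0 ?gexp_ge0.
have dis : (E `*` O) `&` (O `*` E) = set0.
  by apply/seteqP; split => -[a b] //; rewrite /E /O /congr_set/=; lia.
rewrite (proj2 (rsum_setU g0 dis s1 s2)) h1 h2 /E /O; ring.
Qed.

Lemma th4_double y : 0 < y -> th4 y ^+ 2 = th3 (2 * y) ^+ 2 - th2 (2 * y) ^+ 2.
Proof.
move=> y0; have y2 : 0 < 2 * y by rewrite mulr_gt0.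
rewrite th4_split (th3_double y2) (th2_double y2) (_ : 2 * (2 * y) = 4 * y); last by ring.
by ring.
Qed.

(** With A and B the values of theta3 and theta2 at 2y, the squares of theta3, theta2, theta4 at y
    are A^2 + B^2, 2AB and A^2 - B^2, a Pythagorean triple. *)
Lemma jacobi y : 0 < y -> th3 y ^+ 4 = th2 y ^+ 4 + th4 y ^+ 4.
Proof.
move=> y0; rewrite (exprM (th3 y) 2 2) (exprM (th2 y) 2 2) (exprM (th4 y) 2 2).
by rewrite (th3_double y0) (th2_double y0) (th4_double y0); ring.
Qed.

Lemma th4_gt0 y : 0 < y -> 0 < th4 y.
Proof.
move=> y0; have yi0 : 0 < y^-1 by rewrite invr_gt0.
have := th2_dual yi0; rewrite invrK => h.
have := th4_dual yi0; rewrite invrK => ->.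
by rewrite mulr_gt0 ?sqrtr_gt0 ?th2_gt0.
Qed.

(** uv <= (u+v)^2 / 4 for u = theta2^4 and v = theta4^4, whose sum is theta3^4. *)
Lemma jacobi_ratio y : 0 < y -> (th2 y * th4 y) ^+ 4 / 16 / th3 y ^+ 8 <= 1 / 64.
Proof.
move=> y0; have h3 := th3_gt0 y0.
rewrite ler_pdivrMr ?exprn_gt0// exprMn (exprM _ 4 2) jacobi//.
move: (th2 y ^+ 4) (th4 y ^+ 4) => u v; have := sqr_ge0 (u - v); nra.
Qed.

Lemma jacobi_ratio1 : (th2 1 * th4 1) ^+ 4 / 16 / th3 1 ^+ 8 = 1 / 64.
Proof.
have h := th4_dual ltr01; rewrite invr1 sqrtr1 mul1r in h.
have h3 := th3_gt0 ltr01; have h2 := th2_gt0 ltr01.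
rewrite exprMn (exprM (th3 1) 4 2) (jacobi ltr01) h.
have : th2 1 ^+ 4 != 0 by rewrite expf_neq0// gt_eqF.
move: (th2 1 ^+ 4) => u u0; have -> : (u + u) ^+ 2 = 4 * (u * u) by ring.
by field.
Qed.

Definition isq (m : int) : nat := (`|m| ^ 2)%N.
(** Triangular numbers: (2m+1)^2 = 8 [itri m] + 1, so that theta2 is q^(1/4) times a series in q^2
    with these exponents. *)
Definition itri (m : int) : nat := (`|(m * (m + 1))%R|./2)%N.

Lemma isqE (m : int) : (isq m)%:R = m%:~R ^+ 2 :> R.
Proof. by rewrite /isq natrX; case: m => // k; rewrite NegzE rmorphN sqrrN. Qed.

Lemma itriE (m : int) : (2 * m + 1)%:~R ^+ 2 = (8 * itri m + 1)%:R :> R.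
Proof.
suff e0 : (2 * m + 1) ^+ 2 = (8 * itri m + 1)%:Z.
  by rewrite -[RHS]/(((8 * itri m + 1)%:Z)%:~R) -e0 rmorphXn.
rewrite /itri; have h : exists k : nat, m * (m + 1) = (2 * k)%:Z.
  have [e|e] : (m %% 2)%Z = 0 \/ (m %% 2)%Z = 1 by lia.
    have := divz_eq m 2; rewrite e addr0 => ->; move: (m %/ 2)%Z => q; clear.
    exists `|(q * (2 * q + 1))%R|%N; rewrite PoszM gez0_abs; first by ring.
    have [?|?] : 0 <= q \/ q <= -1 by lia.
      by rewrite mulr_ge0//; lia.
    by rewrite -mulrNN mulr_ge0//; lia.
  have := divz_eq m 2; rewrite e => ->; move: (m %/ 2)%Z => q; clear.
  exists `|((q + 1) * (2 * q + 1))%R|%N; rewrite PoszM gez0_abs; first by ring.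
  have [?|?] : 0 <= q \/ q <= -1 by lia.
    by rewrite mulr_ge0//; lia.
  by rewrite -mulrNN mulr_ge0//; lia.
by have [k hk] := h; rewrite hk absz_nat mul2n doubleK; lia.
Qed.

Lemma nome_ex x : 0 < x < 1 -> exists2 y, 0 < y & x = expR (- (pi * y)).
Proof.
move=> /andP[x0 x1]; have p0 := pi_gt0 R; exists (- ln x / pi).
  by rewrite divr_gt0// oppr_gt0 ln_lt0// x0.
by rewrite mulrC divfK ?gt_eqF// opprK lnK.
Qed.

Lemma isq_gexp y k : expR (- (pi * y)) ^+ isq k = gexp y k.
Proof. by rewrite -expRM_natr isqE /gexp mulNr. Qed.

Lemma itri_gexp y k : expR (- (pi / 4 * y)) * expR (- (pi * y)) ^+ 2 ^+ itri k = gexp (y / 4) (2 * k + 1).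
Proof.
rewrite /gexp itriE -exprM -expRM_natr -expRD; congr expR.
by rewrite natrD !natrM; field.
Qed.

Lemma summ_isq x : 0 < x < 1 -> summ [set: int] (fun k => x ^+ isq k).
Proof.
move=> /nome_ex[y y0 ->]; rewrite (eq_summ (g := gexp y)); first exact: summ_gexp.
by move=> k _; exact: isq_gexp.
Qed.

Lemma odd_bij : set_bij [set: int] (congr_set 2 1) (fun k : int => 2 * k + 1).
Proof.
split => [k _|k k' _ _ /=|k]; rewrite /congr_set/=; try lia.
by move=> h; exists ((k - 1) %/ 2)%Z => //; lia.
Qed.

Lemma th2_series y : 0 < y -> summ [set: int] (fun k => (expR (- (pi * y)) ^+ 2) ^+ itri k) /\
  th2 y = expR (- (pi / 4 * y)) * rsum [set: int] (fun k => (expR (- (pi * y)) ^+ 2) ^+ itri k).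
Proof.
move=> y0; have y4 : 0 < y / 4 by rewrite divr_gt0.
have e : y = 4 * (y / 4) by field.
have [h1 h2] := rsum_bij (gexp (y / 4)) odd_bij.
have s1 := proj1 h2 (summ_gexp _ y4).
have ei0 : 0 <= (expR (- (pi / 4 * y)))^-1 by rewrite invr_ge0 expR_ge0.
have [s2 h3] := summZ (fun k => gexp_ge0 (y / 4) (2 * k + 1)) ei0 s1.
have e2 : (fun k : int => (expR (- (pi / 4 * y)))^-1 * (gexp (y / 4) \o (fun k : int => 2 * k + 1)) k) =
    (fun k => (expR (- (pi * y)) ^+ 2) ^+ itri k).
  by apply/funext => k; rewrite /= -itri_gexp mulKf// gt_eqF// expR_gt0.
rewrite /= e2 in s2 h3; split => //.
by rewrite h3 -h1 mulVKf ?gt_eqF ?expR_gt0// {1}e th2E.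
Qed.

Lemma summ_itri x : 0 < x < 1 -> summ [set: int] (fun k => x ^+ itri k).
Proof.
move=> /nome_ex[y y0 ->]; have y2 : 0 < y / 2 by rewrite divr_gt0.
have [+ _] := th2_series y2; rewrite -expRM_natr.
by rewrite (_ : - (pi * (y / 2)) * 2%:R = - (pi * y)) //; field.
Qed.

Lemma th3_series y : 0 < y -> th3 y = rsum [set: int] (fun k => expR (- (pi * y)) ^+ isq k).
Proof.
move=> y0; rewrite th3E (_ : congr_set 1 0 = setT).
  by apply: eq_rsum => k _; rewrite isq_gexp.
by apply/seteqP; split => k //; rewrite /congr_set/= dvd1z.
Qed.

End Thetas.

(** * Fibre sums and Taylor jets *)

Section Fibers.
Context {R : realType} {T : choiceType} (S : set T) (g : T -> nat).
Local Notation C := R[i].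
Implicit Types (x s : R).
Hypothesis sg : forall x, 0 < x < 1 -> summ S (fun v => x ^+ g v).

Definition fser x : R := rsum S (fun v => x ^+ g v).
(** The cardinality of a fibre of g, written as an unordered sum of ones so that it makes sense
    before finiteness is known. *)
Definition fcoef (m : nat) : R := rsum [set v | S v /\ g v = m] (fun=> 1).

Let x0 x v : 0 <= x -> 0 <= x ^+ g v. Proof. by move=> ?; rewrite exprn_ge0. Qed.

Lemma summ_fser x : 0 <= x < 1 -> summ S (fun v => x ^+ g v).
Proof.
move=> /andP[h0 h1]; pose y := Num.max x (1 / 2).
have y1 : 0 < y < 1 by rewrite /y lt_max gt_max h1 /=; apply/andP; split; [apply/orP; right|]; lra.
apply: summ_le (sg y1) => [v|v _]; first by rewrite exprn_ge0.
have yx : x <= y by rewrite /y le_max lexx.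
by apply: lerXn2r => //; rewrite nnegrE//; exact: le_trans yx.
Qed.

Lemma summ_fiber m : summ [set v | S v /\ g v = m] (fun=> 1 : R).
Proof.
have h2 : 0 < (1 / 2 : R) < 1 by apply/andP; split; lra.
rewrite (eq_summ (g := fun v => 2 ^+ m * (1 / 2) ^+ g v)); last first.
  by move=> v [_ ->]; rewrite -exprMn mulrA mulr1 mulfV ?expr1n.
apply: (proj1 (@summZ R T _ _ _ _ _ _)).
- by move=> v; rewrite exprn_ge0//; lra.
- by rewrite exprn_ge0.
- by apply: summ_sub (sg h2) => [v|v []//]; rewrite exprn_ge0//; lra.
Qed.

Lemma fcoef_ge0 m : 0 <= fcoef m.
Proof. by apply: rsum_ge0 => _; exact: ler01. Qed.

Lemma fser_ge0 x : 0 <= x -> 0 <= fser x.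
Proof. by move=> h; apply: rsum_ge0 => v; exact: x0. Qed.

Lemma sum_fcoef x M : 0 <= x -> \sum_(m < M) fcoef m * x ^+ m =
  rsum [set v | S v /\ (g v < M)%N] (fun v => x ^+ g v).
Proof.
move=> h; have -> : [set v | S v /\ (g v < M)%N] =
    [set v | exists2 i : 'I_M, xpredT i & (S v /\ g v = i)].
  apply/seteqP; split => v; first by move=> [Sv gv]; exists (Ordinal gv).
  by move=> [i _ [Sv e]]; split; rewrite ?e.
have fi (i : 'I_M) : summ [set v | S v /\ g v = i] (fun v => x ^+ g v) /\
    rsum [set v | S v /\ g v = i] (fun v => x ^+ g v) = fcoef i * x ^+ i.
  have e : forall v, [set v | S v /\ g v = i] v -> x ^+ g v = x ^+ i * 1 by move=> v [_ ->]; rewrite mulr1.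
  rewrite (eq_summ e) (eq_rsum e) [RHS]mulrC.
  exact: (summZ (fun _ => ler01) (exprn_ge0 i h) (summ_fiber i)).
have [||i _|_ ->] := @summ_bigcup R T _ xpredT (fun i : 'I_M => [set v | S v /\ g v = i]) (fun v => x ^+ g v).
- by move=> v; exact: x0.
- by move=> i j v [_ e1] [_ e2]; apply/val_inj; rewrite /= -e1 -e2.
- by case: (fi i).
by apply: eq_bigr => i _; case: (fi i).
Qed.

Lemma fser_sup x : 0 <= x < 1 -> is_sup_sum (fun m => fcoef m * x ^+ m) (fser x).
Proof.
move=> hx; have /andP[h0 h1] := hx; have sx := summ_fser hx; split => [M|e e0].
  rewrite sum_fcoef//; apply: (proj2 (@summ_ub _ _ _ _ (fser x) _ _)) => [v|X XS]; first exact: x0.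
  by apply: rsum_fset_le => // [v|v /XS []//]; exact: x0.
have [X XS hX] := rsum_approx (fun v => x0 v h0) sx e0.
exists (\max_(v <- X) g v).+1; rewrite sum_fcoef//; apply: lt_le_trans hX _.
apply: rsum_fset_le => [v||v vX]; first exact: x0.
  by apply: summ_sub sx => [v|v []//]; exact: x0.
by split; [exact: XS | rewrite ltnS; exact: leq_bigmax_seq].
Qed.

Lemma fser_analytic : exists2 f : C -> C, analytic f &
  forall x, 0 <= x < 1 -> f x%:C%C = (fser x)%:C%C.
Proof. exact: (complexify fcoef_ge0 fser_sup). Qed.

(** For s <= 1/2 and k >= 2, s^k <= 4 s^2 (1/2)^k; so the remainder is at most 4 s^2 times the value
    at 1/2. *)
Lemma fser_jet : exists2 B, 0 <= B & forall s, 0 <= s <= 1 / 2 ->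
  0 <= fser s - (fcoef 0 + fcoef 1 * s) <= B * s ^+ 2.
Proof.
have h2 : 0 <= (1 / 2 : R) < 1 by apply/andP; split; lra.
exists (4 * fser (1 / 2)); first by rewrite mulr_ge0// fser_ge0//; lra.
move=> s /andP[s0 s2]; have hs : 0 <= s < 1 by rewrite s0; lra.
have [ub1 ap1] := fser_sup hs; have [ub2 ap2] := fser_sup h2.
apply/andP; split.
  by have := ub1 2; rewrite !big_ord_recl big_ord0 expr0 expr1; rewrite /bump/=; lra.
apply: (@lim_le _ _ _ 1) => e e0 _; have [M hM] := ap1 e e0.
have [M2|M2] := leqP M 2.
  have : \sum_(k < M) fcoef k * s ^+ k <= \sum_(k < 2) fcoef k * s ^+ k.
    rewrite (big_ord_widen 2 (fun k => fcoef k * s ^+ k) M2) big_mkcond/=.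
    by apply: ler_sum => k _; case: ifP => // _; rewrite mulr_ge0 ?fcoef_ge0 ?exprn_ge0.
  have : 0 <= 4 * fser (1 / 2) * s ^+ 2 by rewrite mulr_ge0 ?sqr_ge0// mulr_ge0// fser_ge0//; lra.
  by rewrite !big_ord_recl big_ord0 expr0 expr1 /bump/=; lra.
have := ub2 M; move: hM.
rewrite -(subnKC (ltnW M2)) !big_split_ord/= !big_ord_recl !big_ord0 /bump/= !expr0 !expr1 => hM h.
set X := \sum_(i < _) _ in hM; set Y := \sum_(i < _) _ in h.
suff XY : X <= 4 * s ^+ 2 * Y.
  have : 4 * s ^+ 2 * Y <= 4 * s ^+ 2 * fser (1 / 2).
    rewrite ler_wpM2l ?mulr_ge0 ?sqr_ge0//.
    by have := fcoef_ge0 0; have := fcoef_ge0 1; lra.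
  lra.
rewrite /X /Y mulr_sumr; apply: ler_sum => i _.
have hi : s ^+ i <= (1 / 2) ^+ i by apply: lerXn2r => //; rewrite nnegrE//; lra.
rewrite !exprD; move: hi; move: (s ^+ i) ((1 / 2 : R) ^+ i) => X1 Y1 hi.
rewrite [leRHS](_ : _ = fcoef (2 + i) * (s ^+ 2 * Y1)); last by field.
by rewrite ler_wpM2l ?fcoef_ge0// ler_wpM2l ?sqr_ge0.
Qed.

End Fibers.

(** * Third-order Taylor expansions with a uniform remainder *)

Section Jets.
Context {R : realType}.
Implicit Types (f g : R -> R) (x : R).

Definition jet f (a0 a1 a2 a3 : R) := exists2 B, 0 <= B & forall x, `|x| <= 1 / 2 ->
  exists2 u, `|u| <= B & f x = a0 + a1 * x + a2 * x ^+ 2 + a3 * x ^+ 3 + x ^+ 4 * u.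

Lemma jet_of_bound f a0 a1 a2 a3 B : 0 <= B ->
  (forall x, `|x| <= 1 / 2 -> `|f x - (a0 + a1 * x + a2 * x ^+ 2 + a3 * x ^+ 3)| <= B * x ^+ 4) ->
  jet f a0 a1 a2 a3.
Proof.
move=> B0 h; exists B => // x hx; have := h x hx; have [->|xn] := eqVneq x 0.
  rewrite !expr0n/= !mulr0 !addr0 normr_le0 subr_eq0 => /eqP ->.
  by exists 0; rewrite ?normr0// mul0r addr0.
have x4 : x ^+ 4 != 0 by rewrite expf_neq0.
have p4 : 0 < x ^+ 4 by rewrite lt_neqAle eq_sym x4 (exprM x 2 2) sqr_ge0.
move=> hb; exists ((f x - (a0 + a1 * x + a2 * x ^+ 2 + a3 * x ^+ 3)) / x ^+ 4).
  by rewrite normrM normfV (gtr0_norm p4) ler_pdivrMr.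
by rewrite [X in _ = _ + X]mulrC divfK//; ring.
Qed.

Lemma jet_ext f g a0 a1 a2 a3 : (forall x, `|x| <= 1 / 2 -> f x = g x) ->
  jet f a0 a1 a2 a3 -> jet g a0 a1 a2 a3.
Proof. by move=> e [B B0 h]; exists B => // x hx; rewrite -e//; exact: h. Qed.

Lemma jet_eq f a0 a1 a2 a3 b0 b1 b2 b3 : jet f a0 a1 a2 a3 ->
  a0 = b0 -> a1 = b1 -> a2 = b2 -> a3 = b3 -> jet f b0 b1 b2 b3.
Proof. by move=> h <- <- <- <-. Qed.

Lemma jet_const c : jet (fun=> c) c 0 0 0.
Proof. by exists 0 => // x _; exists 0; rewrite ?normr0//; ring. Qed.

Lemma jet_id : jet (fun x => x) 0 1 0 0.
Proof. by exists 0 => // x _; exists 0; rewrite ?normr0//; ring. Qed.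

Lemma jetD f g a0 a1 a2 a3 b0 b1 b2 b3 : jet f a0 a1 a2 a3 -> jet g b0 b1 b2 b3 ->
  jet (fun x => f x + g x) (a0 + b0) (a1 + b1) (a2 + b2) (a3 + b3).
Proof.
move=> [B B0 h] [B' B'0 h']; exists (B + B'); first exact: addr_ge0.
move=> x hx; have [u hu ->] := h x hx; have [u' hu' ->] := h' x hx.
exists (u + u'); last by ring.
by apply: le_trans (ler_normD _ _) _; exact: lerD.
Qed.

Lemma jetM f g a0 a1 a2 a3 b0 b1 b2 b3 : jet f a0 a1 a2 a3 -> jet g b0 b1 b2 b3 ->
  jet (fun x => f x * g x) (a0 * b0) (a0 * b1 + a1 * b0) (a0 * b2 + a1 * b1 + a2 * b0)
    (a0 * b3 + a1 * b2 + a2 * b1 + a3 * b0).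
Proof.
move=> [B B0 h] [B' B'0 h'].
pose p x := a0 + a1 * x + a2 * x ^+ 2 + a3 * x ^+ 3.
pose p' x := b0 + b1 * x + b2 * x ^+ 2 + b3 * x ^+ 3.
have pb (c0 c1 c2 c3 : R) x : `|x| <= 1 / 2 ->
    `|c0 + c1 * x + c2 * x ^+ 2 + c3 * x ^+ 3| <= `|c0| + `|c1| + `|c2| + `|c3|.
  move=> hx; have x1 : `|x| <= 1 by lra.
  have k (c : R) j : `|c * x ^+ j| <= `|c|.
    by rewrite normrM normrX ler_piMr// exprn_ile1.
  do 3 (apply: le_trans (ler_normD _ _) _; apply: lerD; last by rewrite ?k// -[x]expr1 k).
  by [].
set M := `|a0| + `|a1| + `|a2| + `|a3|; set M' := `|b0| + `|b1| + `|b2| + `|b3|.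
pose c4 := a1 * b3 + a2 * b2 + a3 * b1; pose c5 := a2 * b3 + a3 * b2; pose c6 := a3 * b3.
have M0 : 0 <= M by rewrite !addr_ge0.
have M'0 : 0 <= M' by rewrite !addr_ge0.
exists (`|c4| + `|c5| + `|c6| + `|0 : R| + B * M' + M * B' + B * B').
  by rewrite !addr_ge0 ?mulr_ge0.
move=> x hx; have [u hu ->] := h x hx; have [u' hu' ->] := h' x hx.
exists (c4 + c5 * x + c6 * x ^+ 2 + 0 * x ^+ 3 + u * p' x + p x * u' + (x ^+ 4 * u) * u'); last first.
  by rewrite /p /p' /c4 /c5 /c6; ring.
apply: le_trans (ler_normD _ _) _; apply: lerD; last first.
  rewrite normrM; apply: ler_pM => //; apply: le_trans hu; rewrite normrM normrX.
  by rewrite ler_piMl// exprn_ile1//; lra.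
apply: le_trans (ler_normD _ _) _; apply: lerD; last by rewrite normrM; apply: ler_pM => //; exact: pb.
apply: le_trans (ler_normD _ _) _; apply: lerD; last by rewrite normrM; apply: ler_pM => //; exact: pb.
exact: pb.
Qed.

Lemma jetZ c f a0 a1 a2 a3 : jet f a0 a1 a2 a3 ->
  jet (fun x => c * f x) (c * a0) (c * a1) (c * a2) (c * a3).
Proof. by move=> h; apply: (jet_eq (jetM (jet_const c) h)); ring. Qed.

(** Covers powers of theta3 = 1 + 2q + O(q^4) and of theta4; the coefficients are the binomial
    ones. *)
Lemma jetX f c m : jet f 1 c 0 0 -> jet (fun x => f x ^+ m) 1 (m%:R * c)
  (c ^+ 2 * (m%:R * (m%:R - 1)) / 2) (c ^+ 3 * (m%:R * (m%:R - 1) * (m%:R - 2)) / 6).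
Proof.
move=> h; elim: m => [|m ih].
  apply: jet_ext (jet_eq (jet_const 1) _ _ _ _) => [x _||||]; by rewrite ?expr0 ?mul0r ?mulr0 ?mul0r.
apply: jet_ext (jet_eq (jetM h ih) _ _ _ _) => [x _||||]; first by rewrite exprS.
- by ring.
- by rewrite -natr1; ring.
- by rewrite -natr1; field.
- by rewrite -natr1; field.
Qed.

Definition jet2 f (c0 c1 : R) := exists2 B, 0 <= B &
  forall s, 0 <= s <= 1 / 2 -> 0 <= f s - (c0 + c1 * s) <= B * s ^+ 2.

Let x2 x : `|x| <= 1 / 2 -> 0 <= x ^+ 2 <= 1 / 2.
Proof.
move=> h; rewrite sqr_ge0 -[x ^+ 2]ger0_norm ?sqr_ge0// normrX expr2.
by have := normr_ge0 x; nra.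
Qed.

Lemma jet2_square f c0 c1 : jet2 f c0 c1 -> jet (fun x => f (x ^+ 2)) c0 0 c1 0.
Proof.
move=> [B B0 h]; apply: (jet_of_bound B0) => x /x2/h/andP[h1 h2].
rewrite (_ : _ - _ = f (x ^+ 2) - (c0 + c1 * x ^+ 2)); last by ring.
by rewrite ger0_norm// (exprM x 2 2).
Qed.

Lemma jet2_flat f g c0 c1 : jet2 f c0 c1 ->
  (forall x, `|x| <= 1 / 2 -> 0 <= g x <= x ^+ 4) -> jet (fun x => f (g x)) c0 0 0 0.
Proof.
move=> [B B0 h] hg; apply: (@jet_of_bound _ _ _ _ _ (`|c1| + B)) => [|x hx]; first by rewrite addr_ge0.
have /andP[h4 g4] := hg x hx; have /andP[hx2 hx2'] := x2 hx.
have s4 : x ^+ 4 <= 1 / 4 by rewrite (exprM x 2 2) expr2; nra.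
have gs : 0 <= g x <= 1 / 2 by rewrite h4; lra.
have /andP[h1 h2] := h _ gs.
rewrite !mul0r !addr0 (_ : f (g x) - c0 = (f (g x) - (c0 + c1 * g x)) + c1 * g x); last by ring.
apply: le_trans (ler_normD _ _) _; rewrite (ger0_norm h1) normrM (ger0_norm h4) mulrDl addrC.
apply: lerD; first by rewrite ler_wpM2l.
by apply: le_trans h2 _; rewrite ler_wpM2l// expr2; nra.
Qed.

Lemma jetN f a0 a1 a2 a3 : jet f a0 a1 a2 a3 -> jet (fun x => f (- x)) a0 (- a1) a2 (- a3).
Proof.
move=> [B B0 h]; exists B => // x hx; have [|u hu ->] := h (- x); first by rewrite normrN.
by exists u => //; ring.
Qed.

Lemma jet_vanish3 f a3 : jet f 0 0 0 a3 -> (forall x, 0 < x < 1 -> f x = 0) -> a3 = 0.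
Proof.
move=> [B B0 h] f0; apply/eqP; rewrite -normr_le0.
apply: (@lim_le _ _ _ B) => e e0 e1; rewrite add0r.
have hx : `|e / 2| <= 1 / 2 by rewrite ger0_norm; lra.
have [u hu] := h _ hx; rewrite f0; last by apply/andP; split; lra.
move=> hE; have e3 : (e / 2) ^+ 3 != 0 by rewrite expf_neq0//; lra.
have : a3 = - (e / 2 * u).
  by apply: (mulfI e3); move: hE; rewrite !mul0r !add0r exprS; lra.
move=> ->; rewrite normrN normrM ger0_norm; last by lra.
apply: le_trans (_ : e / 2 * B <= _); first by rewrite ler_wpM2l//; lra.
by rewrite mulrC [leRHS]mulrC ler_wpM2l//; lra.
Qed.

Lemma jet_cubic f a3 : jet f 0 0 0 a3 -> exists2 B, 0 <= B &
  forall x, `|x| <= 1 / 2 -> `|f x| <= B * `|x| ^+ 3.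
Proof.
move=> [B B0 h]; exists (`|a3| + B); first by rewrite addr_ge0.
move=> x hx; have [u hu ->] := h x hx.
rewrite !mul0r !add0r (_ : _ + _ = (a3 + x * u) * x ^+ 3); last by ring.
rewrite normrM normrX ler_wpM2r ?exprn_ge0//.
apply: le_trans (ler_normD _ _) _; rewrite lerD2l normrM.
by apply: le_trans hu; rewrite ler_piMl//; lra.
Qed.

End Jets.

(** * Unimodular lattices *)

Section Dot.
Context {R : realType} {n : nat}.
Implicit Types (x y z : 'rV[R]_n).

Lemma dotpC x y : dotp x y = dotp y x.
Proof. by apply: eq_bigr => i _; rewrite mulrC. Qed.

Lemma dotpDl x y z : dotp (x + y) z = dotp x z + dotp y z.
Proof. by rewrite /dotp -big_split/=; apply: eq_bigr => i _; rewrite mxE mulrDl. Qed.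

Lemma dotpZl (c : R) x y : dotp (c *: x) y = c * dotp x y.
Proof. by rewrite /dotp mulr_sumr; apply: eq_bigr => i _; rewrite mxE mulrA. Qed.

Lemma dotpDr x y z : dotp x (y + z) = dotp x y + dotp x z.
Proof. by rewrite !(dotpC x) dotpDl. Qed.

Lemma dotpZr (c : R) x y : dotp x (c *: y) = c * dotp x y.
Proof. by rewrite !(dotpC x) dotpZl. Qed.

Lemma dotpNl x y : dotp (- x) y = - dotp x y.
Proof. by rewrite -scaleN1r dotpZl mulN1r. Qed.

Lemma dotpNr x y : dotp x (- y) = - dotp x y.
Proof. by rewrite !(dotpC x) dotpNl. Qed.

Lemma dotpBl x y z : dotp (x - y) z = dotp x z - dotp y z.
Proof. by rewrite dotpDl dotpNl. Qed.

Lemma dotpBr x y z : dotp x (y - z) = dotp x y - dotp x z.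
Proof. by rewrite dotpDr dotpNr. Qed.

Lemma dotp0l x : dotp 0 x = 0.
Proof. by rewrite -(scale0r (0 : 'rV[R]_n)) dotpZl mul0r. Qed.

Lemma dotp0r x : dotp x 0 = 0.
Proof. by rewrite dotpC dotp0l. Qed.

Lemma dotp_suml I (r : seq I) (P : pred I) (F : I -> 'rV[R]_n) y :
  dotp (\sum_(i <- r | P i) F i) y = \sum_(i <- r | P i) dotp (F i) y.
Proof. by elim/big_rec2: _ => [|i u v _ <-]; rewrite ?dotp0l// dotpDl. Qed.

Lemma dotp_sumr I (r : seq I) (P : pred I) (F : I -> 'rV[R]_n) y :
  dotp y (\sum_(i <- r | P i) F i) = \sum_(i <- r | P i) dotp y (F i).
Proof. by rewrite dotpC dotp_suml; apply: eq_bigr => i _; rewrite dotpC. Qed.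

Lemma sqnorm_ge0 x : 0 <= sqnorm x.
Proof. by apply: sumr_ge0 => i _; rewrite -expr2 sqr_ge0. Qed.

Lemma sqnorm_eq0 x : (sqnorm x == 0) = (x == 0).
Proof.
apply/eqP/eqP => [h|->]; last exact: dotp0l.
apply/rowP => i; rewrite mxE; apply/eqP; rewrite -sqrf_eq0 expr2; apply/eqP.
by have /psumr_eq0P := h; apply => // j _; rewrite -expr2 sqr_ge0.
Qed.

Lemma sqnormD x y : sqnorm (x + y) = sqnorm x + sqnorm y + 2 * dotp x y.
Proof. by rewrite /sqnorm dotpDl !dotpDr (dotpC y x); ring. Qed.

Lemma sqnormN x : sqnorm (- x) = sqnorm x.
Proof. by rewrite /sqnorm dotpNl dotpNr opprK. Qed.

Lemma sqnormB x y : sqnorm (x - y) = sqnorm x + sqnorm y - 2 * dotp x y.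
Proof. by rewrite sqnormD sqnormN dotpNr mulrN. Qed.

Lemma sqnormZ (c : R) x : sqnorm (c *: x) = c ^+ 2 * sqnorm x.
Proof. by rewrite /sqnorm dotpZl dotpZr; ring. Qed.

End Dot.

Section Unimodular.
Context {R : realType} {n : nat} (L : set 'rV[R]_n).
Hypothesis LD : L = dual L.
Implicit Types (x y : 'rV[R]_n).

Lemma dual_int x y : L x -> L y -> dotp x y \is a Num.int.
Proof. by rewrite {1}LD; apply. Qed.

Lemma dualP x : (forall l, L l -> dotp x l \is a Num.int) -> L x.
Proof. by rewrite {2}LD. Qed.

Lemma sqnorm_int x : L x -> sqnorm x \is a Num.int.
Proof. by move=> Lx; exact: dual_int. Qed.

Lemma dual0 : L 0.
Proof. by apply: dualP => l _; rewrite dotp0l rpred0. Qed.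

Lemma dualD x y : L x -> L y -> L (x + y).
Proof. by move=> Lx Ly; apply: dualP => l Ll; rewrite dotpDl rpredD ?dual_int. Qed.

Lemma dualN x : L x -> L (- x).
Proof. by move=> Lx; apply: dualP => l Ll; rewrite dotpNl rpredN dual_int. Qed.

Lemma dualB x y : L x -> L y -> L (x - y).
Proof. by move=> Lx Ly; apply: dualD => //; exact: dualN. Qed.

Lemma dualZ (c : R) x : c \is a Num.int -> L x -> L (c *: x).
Proof. by move=> hc Lx; apply: dualP => l Ll; rewrite dotpZl rpredM ?dual_int. Qed.

Lemma dual_sum I (r : seq I) (P : pred I) (F : I -> 'rV[R]_n) :
  (forall i, P i -> L (F i)) -> L (\sum_(i <- r | P i) F i).
Proof. by move=> h; apply: big_ind => //; [exact: dual0 | exact: dualD]. Qed.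

Lemma sqnorm_nat x : L x -> exists m : nat, sqnorm x = m%:R.
Proof.
move=> /sqnorm_int h; apply/natrP; rewrite natrEint h; exact: sqnorm_ge0.
Qed.

Section Basis.
Variable B : 'M[R]_n.
Hypothesis Bu : B \in unitmx.
Hypothesis LB : L = [set map_mx intr z *m B | z in [set: 'rV[int]_n]].

Lemma basis_in i : L (row i B).
Proof.
rewrite LB; exists (delta_mx 0 i) => //.
by rewrite map_delta_mx -rowE.
Qed.

Lemma basis_expand x : L x -> exists z : 'I_n -> int, x = \sum_i (z i)%:~R *: row i B.
Proof.
rewrite {1}LB => -[z _ <-]; exists (fun i => z 0 i).
by rewrite mulmx_sum_row; apply: eq_bigr => i _; rewrite mxE.
Qed.

(** x.x mod 2 is additive on L, as 2 x.y is even. A real w with the right products against a basis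
    exists, and self-duality puts it in L. *)
Lemma characteristic_vector : exists2 w, L w &
  forall x, L x -> (dotp w x - sqnorm x) / 2 \is a Num.int.
Proof.
pose c : 'rV[R]_n := \row_i sqnorm (row i B).
pose w := c *m invmx B^T.
have wB i : dotp w (row i B) = sqnorm (row i B).
  have : (w *m B^T) 0 i = c 0 i by rewrite mulmxKV ?unitmx_tr.
  by rewrite !mxE => <-; apply: eq_bigr => j _; rewrite !mxE.
have Lw : L w.
  apply: dualP => l /basis_expand[z ->]; rewrite dotp_sumr rpred_sum// => i _.
  by rewrite dotpZr wB rpredM ?intr_int ?sqnorm_int//; exact: basis_in.
exists w => // x /basis_expand[z ->].
pose P x := L x /\ (dotp w x - sqnorm x) / 2 \is a Num.int.
suff: P (\sum_i (z i)%:~R *: row i B) by case.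
apply: (big_ind P) => [|x1 x2 [L1 h1] [L2 h2]|i _].
- by split; [exact: dual0|rewrite dotp0r /sqnorm dotp0l subrr mul0r rpred0].
- split; first exact: dualD.
  rewrite (_ : _ / 2 = (dotp w x1 - sqnorm x1) / 2 + (dotp w x2 - sqnorm x2) / 2 - dotp x1 x2).
    by rewrite rpredB ?rpredD ?dual_int.
  by rewrite sqnormD dotpDr; field.
- have Lb := basis_in i; split; first by apply: dualZ; rewrite ?intr_int.
  have /intrP[m hm] := sqnorm_int Lb.
  have [k hk] : exists k, (z i - z i ^+ 2 = 2 * k)%R.
    exists ((z i - z i ^+ 2) %/ 2)%Z; rewrite mulrC divzK//.
    rewrite (_ : z i - z i ^+ 2 = z i * (1 - z i)); last by ring.
    have := divz_eq (z i) 2; have : ((z i %% 2)%Z = 0 \/ (z i %% 2)%Z = 1) by lia.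
    move: (z i) => y [] -> ->; apply/dvdzP.
      by exists ((y %/ 2)%Z * (1 - (y %/ 2)%Z * 2)); ring.
    by exists (- (((y %/ 2)%Z * 2 + 1) * (y %/ 2)%Z)); ring.
  rewrite dotpZr wB sqnormZ hm (_ : _ / 2 = (k * m)%:~R) ?intr_int//.
  rewrite -mulrBl -rmorphXn -rmorphB/= hk !rmorphM/=; by field.
Qed.

(** One Gram-Schmidt step, multiplied by the product P of the norms so that the result stays in L.
    It cannot kill all basis vectors, for then B would have rank at most k < n. *)
Lemma orthogonal_extend k (f : nat -> 'rV[R]_n) : (k < n)%N ->
  (forall i, (i < k)%N -> L (f i) /\ f i != 0) ->
  (forall i j, (i < k)%N -> (j < k)%N -> i != j -> dotp (f i) (f j) = 0) ->
  exists g, [/\ L g, g != 0 & forall i, (i < k)%N -> dotp (f i) g = 0].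
Proof.
move=> kn hf fo.
pose P : R := \prod_(i < k) sqnorm (f i).
have sn i : (i < k)%N -> sqnorm (f i) != 0 by move=> /hf[_]; rewrite sqnorm_eq0.
pose res x := P *: x - \sum_(i < k) (dotp x (f i) * (P / sqnorm (f i))) *: f i.
have Lres x : L x -> L (res x).
  move=> Lx; apply: dualB.
    by apply: dualZ => //; rewrite rpred_prod// => i _; apply: sqnorm_int; case: (hf i).
  apply: dual_sum => i _; have [Li _] := hf _ (ltn_ord i); apply: dualZ => //.
  rewrite rpredM ?dual_int// /P (bigD1 i)//= mulrAC mulfV ?sn// mul1r.
  by rewrite rpred_prod// => j _; apply: sqnorm_int; case: (hf j).
have res_orth x i : (i < k)%N -> dotp (f i) (res x) = 0.
  move=> ik; rewrite dotpBr dotpZr dotp_sumr (bigD1 (Ordinal ik))//= big1 => [|j jne].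
    by rewrite addr0 dotpZr -/(sqnorm (f i)) -mulrA divfK ?sn// (dotpC x); ring.
  by rewrite dotpZr fo ?mulr0//; apply: contra jne => /eqP e; apply/eqP/val_inj.
have P0 : P != 0 by apply/prodf_neq0 => i _; exact: sn.
have [i hi] : exists i, res (row i B) != 0.
  apply/existsP; apply: contraT; rewrite negb_exists => /forallP h.
  pose F := \matrix_(i < k) f i.
  pose X := \matrix_(i < n, j < k) (dotp (row i B) (f j) * (P / sqnorm (f j))).
  have e : P *: B = X *m F.
    apply/row_matrixP => i; have := h i; rewrite negbK subr_eq0 => /eqP.
    rewrite linearZ/= => ->; rewrite row_mul mulmx_sum_row.
    by apply: eq_bigr => j _; rewrite !mxE rowK.
  have r1 : \rank (P *: B) = n.
    by apply/eqP; rewrite -/(row_free _) row_free_unit unitmxZ// unitfE.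
  by have := leq_trans (mxrankM_maxl X F) (rank_leq_col X); rewrite -e r1 leqNgt kn.
exists (res (row i B)); split => //; last by move=> j; exact: res_orth.
by apply: Lres; exact: basis_in.
Qed.

Lemma orthogonal_frame : exists f : 'I_n -> 'rV[R]_n,
  [/\ forall i, L (f i), forall i, f i != 0 & forall i j, i != j -> dotp (f i) (f j) = 0].
Proof.
suff [f [h1 h2]] : exists f : nat -> 'rV[R]_n,
    (forall i, (i < n)%N -> L (f i) /\ f i != 0) /\
    (forall i j, (i < n)%N -> (j < n)%N -> i != j -> dotp (f i) (f j) = 0).
  exists (fun i => f i); split => [i|i|i j ij]; try by case: (h1 i).
  exact: h2.
suff H k : (k <= n)%N -> exists f : nat -> 'rV[R]_n,
    (forall i, (i < k)%N -> L (f i) /\ f i != 0) /\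
    (forall i j, (i < k)%N -> (j < k)%N -> i != j -> dotp (f i) (f j) = 0) by exact: H.
elim: k => [_|k ih kn]; first by exists (fun=> 0).
have [f [h1 h2]] := ih (ltnW kn).
have [g [Lg g0 go]] := orthogonal_extend kn h1 h2.
exists (fun i => if i == k then g else f i); split => [i|i j].
  have [//|ne] := eqVneq i k; rewrite ltnS leq_eqVlt (negbTE ne); exact: h1.
have lk m : (m < k.+1)%N -> m != k -> (m < k)%N by rewrite ltnS leq_eqVlt => /orP[/eqP ->|//]; rewrite eqxx.
move=> ik jk; case: (eqVneq i k) => [ei|ni]; case: (eqVneq j k) => [ej|nj] ij.
- by rewrite ei ej eqxx in ij.
- by rewrite dotpC go ?lk.
- by rewrite go ?lk.
- by rewrite h2 ?lk.
Qed.

End Basis.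
End Unimodular.

Section Frame.
Context {R : realType} {n : nat} (b : 'I_n -> 'rV[R]_n).
Hypothesis b0 : forall i, b i != 0.
Hypothesis bo : forall i j, i != j -> dotp (b i) (b j) = 0.

Lemma frame_expand x : x = \sum_i (dotp x (b i) / sqnorm (b i)) *: b i.
Proof.
pose F := \matrix_i b i; pose D : 'rV[R]_n := \row_i (sqnorm (b i))^-1.
have h : F *m (F^T *m diag_mx D) = 1%:M.
  apply/matrixP => i j; rewrite mulmxA mul_mx_diag !mxE.
  rewrite (_ : \sum_k _ = dotp (b i) (b j)); last by apply: eq_bigr => k _; rewrite !mxE.
  case: eqP => [->|/eqP ij]; last by rewrite bo// mul0r.
  by rewrite mulfV// sqnorm_eq0.
have := mulmx1C h => h'; rewrite -{1}[x]mulmx1 -h' mulmxA mulmx_sum_row.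
apply: eq_bigr => i _; rewrite rowK; congr (_ *: _).
rewrite mulmxA mul_mx_diag !mxE; congr (_ * _).
by apply: eq_bigr => j _; rewrite !mxE.
Qed.

Lemma frame_dotp x y : dotp x y = \sum_i dotp x (b i) * dotp y (b i) / sqnorm (b i).
Proof.
rewrite {1}(frame_expand x) dotp_suml; apply: eq_bigr => i _.
by rewrite dotpZl (dotpC (b i)); ring.
Qed.

End Frame.

(** * Duality for lattice theta series *)

Section FfunSum.
Context {R : realType}.

Lemma rsum_ffun m (S : 'I_m -> set int) (g : 'I_m -> int -> R) :
  (forall i k, 0 <= g i k) -> (forall i, summ (S i) (g i)) ->
  summ [set k : {ffun 'I_m -> int} | forall i, S i (k i)] (fun k => \prod_i g i (k i)) /\
  rsum [set k : {ffun 'I_m -> int} | forall i, S i (k i)] (fun k => \prod_i g i (k i)) =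
    \prod_i rsum (S i) (g i).
Proof.
elim: m S g => [|m ih] S g g0 sg.
  pose z : {ffun 'I_0 -> int} := [ffun=> 0].
  have uz k : k = z by apply/ffunP => -[].
  have -> : [set k : {ffun 'I_0 -> int} | forall i, S i (k i)] = [set z].
    by apply/seteqP; split => k _ /=; [exact: uz | case].
  have h0 k : 0 <= \prod_i g i (k i) by apply: prodr_ge0.
  by have [s1 s2] := rsum_set1 z h0; split=> //; rewrite s2 !big_ord0.
pose e (p : int * {ffun 'I_m -> int}) : {ffun 'I_m.+1 -> int} :=
  [ffun i => if unlift ord0 i is Some j then p.2 j else p.1].
have e0 p : e p ord0 = p.1 by rewrite ffunE unlift_none.
have el p j : e p (lift ord0 j) = p.2 j by rewrite ffunE liftK.
have [s1 r1] := ih (fun j => S (lift ord0 j)) (fun j => g (lift ord0 j)) (fun j => g0 _) (fun j => sg _).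
have h0 (k : {ffun 'I_m -> int}) : 0 <= \prod_j g (lift ord0 j) (k j) by apply: prodr_ge0.
have [s2 r2] := rsum_prod (g0 ord0) h0 (sg ord0) s1.
have bij : set_bij (S ord0 `*` [set k : {ffun 'I_m -> int} | forall j, S (lift ord0 j) (k j)])
    [set k : {ffun 'I_m.+1 -> int} | forall i, S i (k i)] e.
  split.
  - move=> p [p1 p2] i /=; case: (unliftP ord0 i) => [j|] ->; by rewrite ?el ?e0.
  - move=> [a k] [a' k'] _ _ h; congr (_, _); first by rewrite -[a](e0 (a, k)) h e0.
    by apply/ffunP => j; rewrite -[k j](el (a, k)) h el.
  - move=> k hk; exists (k ord0, [ffun j => k (lift ord0 j)]).
      by split => /= [|j]; rewrite ?ffunE.
    by apply/ffunP => i; case: (unliftP ord0 i) => [j|] ->; rewrite ?el ?e0 ?ffunE.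
have [-> ->] := rsum_bij (fun k : {ffun 'I_m.+1 -> int} => \prod_i g i (k i)) bij.
have fe : (fun k : {ffun 'I_m.+1 -> int} => \prod_i g i (k i)) \o e =
    (fun p => g ord0 p.1 * \prod_j g (lift ord0 j) (p.2 j)).
  by apply/funext => p /=; rewrite big_ord_recl e0; congr (_ * _); apply: eq_bigr => j _; rewrite el.
by rewrite fe; split=> //; rewrite r2 r1 big_ord_recl.
Qed.

End FfunSum.

Section ComplexDual.
Context {R : realType}.
Local Notation C := R[i].

Lemma gaussian_class_sym (b a a' : nat) (t : R) : (a + a' = b)%N ->
  gaussian_class b a t = gaussian_class b a' t.
Proof.
move=> hb; have bij : set_bij (congr_set b a) (congr_set b a') (fun k : int => - k).
  split.
  - move=> k; rewrite /congr_set /= => /dvdzP[q hq]; apply/dvdzP; exists (- q - 1).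
    by rewrite mulrBl mulNr -hq -hb PoszD; ring.
  - by move=> k k' _ _ /oppr_inj.
  - move=> k; rewrite /congr_set /= => /dvdzP[q hq]; exists (- k); last by rewrite opprK.
    by apply/dvdzP; exists (- q - 1); rewrite mulrBl mulNr -hq -hb PoszD; ring.
rewrite /gaussian_class.
rewrite (proj1 (rsum_bij (fun k : int => expR (- (pi * t * k%:~R ^+ 2 / b%:R)) : R) bij)).
by apply: eq_rsum => k _ /=; rewrite rmorphN sqrrN.
Qed.

(** The sum is odd under c -> b - c, because k -> -k exchanges the two classes. Hence the cosines of
    the duality may be replaced by complex exponentials, which are multiplicative. *)
Lemma gaussian_class_sin (b a : nat) (t : R) :
  \sum_(c < b) sin (pi *+ 2 * (c%:R * a%:R / b%:R)) * gaussian_class b c t = 0.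
Proof.
case: b => [|b]; first by rewrite big_ord0.
rewrite big_ord_recl mul0r mul0r mulr0 sin0 mul0r add0r.
set X := \sum_(i < b) _.
suff : X = - X by lra.
rewrite {1}/X (reindex_inj rev_ord_inj) -sumrN; apply: eq_bigr => i _.
rewrite (gaussian_class_sym (a' := i.+1)); last by rewrite /= /bump /=; have := ltn_ord i; lia.
rewrite -mulNr; congr (_ * _).
have -> : ((lift ord0 (rev_ord i) : nat)%:R : R) = b.+1%:R - i.+1%:R.
  by rewrite -natrB; [congr _%:R; rewrite /= /bump /=; have := ltn_ord i; lia|have := ltn_ord i; lia].
rewrite lift0 mulrBl mulrBl mulrBr mulrAC mulfV ?mul1r ?pnatr_eq0//.
set y := pi *+ 2 * (_ / _); have := @cis_int R a.
have : cis (pi *+ 2 * a%:R - y) * cis y = cis (pi *+ 2 * a%:R) by rewrite -cisD subrK.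
move=> /[swap] /= ->; move/(congr1 (fun z => z * cis (- y))); rewrite -mulrA -cisD subrr cis0 mulr1 mul1r.
by rewrite !cisE => /(congr1 (@complex.Im R))/=; rewrite sinN.
Qed.

Lemma gaussian_class_cis (b a : nat) (t : R) : (0 < b)%N -> 0 < t ->
  \sum_(c < b) cis (pi *+ 2 * (c%:R * a%:R / b%:R)) * (gaussian_class b c t^-1)%:C%C =
  (Num.sqrt (t * b%:R) * gaussian_class b a t)%:C%C.
Proof.
move=> b0 t0; rewrite -gaussian_class_dual//.
have /= h := gaussian_class_sin b a t^-1.
apply/eqP; rewrite eq_complex !raddf_sum /=; apply/andP; split; apply/eqP.
  by apply: eq_bigr => c _; rewrite expR0 !mul1r mulr0 subr0.
by rewrite big1_eq -[RHS]h; apply: eq_bigr => c _; rewrite expR0 !mul1r mulr0 add0r.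
Qed.

End ComplexDual.

(** * Sums over unions of cosets of an orthogonal frame *)

Section Classes.
Context {R : realType} {n : nat} (f : 'I_n -> 'rV[R]_n) (be : 'I_n -> nat) (N : nat).
Local Notation C := R[i].
Implicit Types (v x : 'rV[R]_n) (t : R) (S : set 'rV[R]_n).
Hypothesis fo : forall i j, i != j -> dotp (f i) (f j) = 0.
Hypothesis fbe : forall i, sqnorm (f i) = (be i)%:R.
Hypothesis be0 : forall i, (0 < be i)%N.
Hypothesis beN : forall i, (be i <= N.+1)%N.

Definition gsum S t := rsum S (fun v => expR (- (pi * t * sqnorm v)) : R).

(** The point of the dual of the frame lattice with products k_i against the f_i. An integral
    lattice containing the frame lies between the frame lattice and this dual. *)
Definition fvec (k : {ffun 'I_n -> int}) : 'rV[R]_n := \sum_i ((k i)%:~R / (be i)%:R) *: f i.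

Let beR i : (0 : R) < (be i)%:R. Proof. by rewrite ltr0n. Qed.
Let f0 i : f i != 0. Proof. by rewrite -sqnorm_eq0 fbe gt_eqF. Qed.

Lemma fvec_dotp k i : dotp (fvec k) (f i) = (k i)%:~R.
Proof.
rewrite dotp_suml (bigD1 i)//= big1 => [|j ji]; last by rewrite dotpZl fo// mulr0.
by rewrite addr0 dotpZl -/(sqnorm _) fbe divfK// gt_eqF.
Qed.

Lemma fvecP v (k : {ffun 'I_n -> int}) : (forall i, dotp v (f i) = (k i)%:~R) -> v = fvec k.
Proof. by move=> h; rewrite (frame_expand f0 fo v); apply: eq_bigr => i _; rewrite h fbe. Qed.

Lemma fvec_inj : injective fvec.
Proof.
move=> k k' h; apply/ffunP => i; apply: (@intr_inj R).
by rewrite -!fvec_dotp h.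
Qed.

Lemma fvec_dot k k' : dotp (fvec k) (fvec k') = \sum_i (k i)%:~R * (k' i)%:~R / (be i)%:R.
Proof.
by rewrite (frame_dotp f0 fo); apply: eq_bigr => i _; rewrite !fvec_dotp fbe.
Qed.

Definition periodic S := forall v (m : 'I_n -> int), S v -> S (v + \sum_i (m i)%:~R *: f i).

Definition frame_integral S := forall v, S v -> forall i, dotp v (f i) \is a Num.int.

(** Residues modulo [be i] would have a type depending on i; they are embedded in one ordinal and
    cut out by this predicate. *)
Definition fam (r : {ffun 'I_n -> 'I_N.+1}) : bool :=
  r \in family (fun i (j : 'I_N.+1) => (j < be i)%N).

Lemma famP (r : {ffun 'I_n -> 'I_N.+1}) : reflect (forall i, (r i < be i)%N) (fam r).
Proof. by apply: (iffP familyP) => h i; exact: h. Qed.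

Definition ffun_int (r : {ffun 'I_n -> 'I_N.+1}) : {ffun 'I_n -> int} := [ffun i => (r i)%:Z].

Definition tclass (r : {ffun 'I_n -> 'I_N.+1}) t := \prod_i gaussian_class (be i) (r i) t : R.

Definition residue (k : {ffun 'I_n -> int}) : {ffun 'I_n -> 'I_N.+1} :=
  [ffun i => inord `|(k i %% be i)%Z|%N].

Lemma residueE k i : ((residue k i : nat)%:Z = (k i %% be i)%Z) /\ (residue k i < be i)%N.
Proof.
have b0 : (be i)%:Z != 0 by rewrite eqz_nat -lt0n.
have h1 := modz_ge0 (k i) b0; have h2 := ltz_mod (k i) b0.
have h3 : (`|(k i %% be i)%Z| < be i)%N by move: h1 h2; clear; lia.
by rewrite ffunE inordK ?gez0_abs//; exact: leq_trans (beN i).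
Qed.

Lemma residue_fam k : fam (residue k).
Proof. by apply/famP => i; case: (residueE k i). Qed.

Lemma fvec_residue k : fvec k = fvec (ffun_int (residue k)) +
  \sum_i (k i %/ be i)%Z%:~R *: f i.
Proof.
rewrite -big_split; apply: eq_bigr => i _ /=; rewrite -scalerDl ffunE (proj1 (residueE k i)).
by congr (_ *: _); rewrite {1}(divz_eq (k i) (be i)) rmorphD rmorphM/=; field; rewrite gt_eqF.
Qed.

Lemma periodic_residue S k : periodic S -> S (fvec k) <-> S (fvec (ffun_int (residue k))).
Proof.
move=> pS; split => h; last by rewrite fvec_residue; exact: pS.
have -> : fvec (ffun_int (residue k)) = fvec k + \sum_i (- (k i %/ be i)%Z)%:~R *: f i.
  rewrite (fvec_residue k) -[RHS]addrA -big_split/= big1 ?addr0// => i _.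
  by rewrite -scalerDl rmorphN/= subrr scale0r.
exact: pS.
Qed.

(** S is a union of cosets of the frame lattice, and in frame coordinates the norm is a sum, so each
    coset contributes a product of one-dimensional Gaussian sums. *)
Lemma gsum_classes S t : 0 < t -> periodic S -> frame_integral S ->
  summ S (fun v => expR (- (pi * t * sqnorm v))) /\
  gsum S t = \sum_(r | fam r && `[< S (fvec (ffun_int r)) >]) tclass r t.
Proof.
move=> t0 pS iS.
pose P : set {ffun 'I_n -> int} := [set k | S (fvec k)].
have bij : set_bij P S fvec.
  split => // [k k' _ _|v Sv]; first exact: fvec_inj.
  have /choice[k hk] : forall i, exists m : int, dotp v (f i) = m%:~R.
    by move=> i; apply/intrP; exact: iS.
  exists (finfun k); last by symmetry; apply: fvecP => i; rewrite ffunE.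
  by rewrite /P /= -(@fvecP v)// => i; rewrite ffunE.
rewrite /gsum.
have [-> ->] := rsum_bij (fun v => expR (- (pi * t * sqnorm v)) : R) bij.
pose g i (k : int) : R := expR (- (pi * t * k%:~R ^+ 2 / (be i)%:R)).
have -> : (fun v => expR (- (pi * t * sqnorm v)) : R) \o fvec = fun k => \prod_i g i (k i).
  apply/funext => k /=; rewrite -expR_sum; congr expR.
  rewrite /sqnorm fvec_dot mulr_sumr -sumrN; apply: eq_bigr => i _; congr (- _).
  by rewrite -expr2 mulrA.
have g0 i k : 0 <= g i k by exact: expR_ge0.
pose F (r : {ffun 'I_n -> 'I_N.+1}) : set {ffun 'I_n -> int} :=
  [set k | fam r /\ forall i, congr_set (be i) (r i) (k i)].
have resF r k : F r k <-> r = residue k.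
  split => [[fr h]|->].
    apply/ffunP => i; apply/val_inj => /=; have /congr_set_mod := h i => /(_ (be0 i)) e.
    have /famP /(_ i) ri := fr.
    rewrite modn_small// in e; rewrite -e ffunE inordK// e.
    exact: leq_trans ri (beN i).
  split; first exact: residue_fam.
  by move=> i; rewrite /congr_set/= (proj1 (residueE k i)) -eqz_mod_dvd modz_mod.
have -> : P = [set k | exists2 r, fam r && `[< S (fvec (ffun_int r)) >] & F r k].
  apply/seteqP; split => k.
    move=> Sk; exists (residue k); last exact/resF.
    by rewrite residue_fam; apply/asboolP; exact: (proj1 (periodic_residue k pS) Sk).
  by move=> [r /andP[fr /asboolP Sr] /resF e]; apply/(periodic_residue _ pS); rewrite -e.
have p0 (k : {ffun 'I_n -> int}) : 0 <= \prod_i g i (k i) by apply: prodr_ge0.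
have sF r : fam r -> summ (F r) (fun k => \prod_i g i (k i)) /\
    rsum (F r) (fun k => \prod_i g i (k i)) = tclass r t.
  move=> fr; have -> : F r = [set k | forall i, congr_set (be i) (r i) (k i)].
    by apply/seteqP; split => k; [case | split].
  exact: (rsum_ffun g0 (fun i => summ_gaussian_class _ (be0 i) t0)).
have [|r /andP[fr _]|s1 r1] := @summ_bigcup R _ _ (fun r => fam r && `[< S (fvec (ffun_int r)) >]) F _ p0.
- by move=> r r' k /resF -> /resF ->.
- by case: (sF r fr).
split => //; rewrite r1; apply: eq_bigr => r /andP[fr _]; by case: (sF r fr).
Qed.

(** The product of n one-dimensional dualities, expanded by distributivity into a sum over residue
    vectors c. *)
Lemma tclass_dual r t : 0 < t ->
  (\prod_i Num.sqrt (t * (be i)%:R) * tclass r t)%:C%C =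
  \sum_(c | fam c) cis (pi *+ 2 * dotp (fvec (ffun_int c)) (fvec (ffun_int r))) * (tclass c t^-1)%:C%C.
Proof.
move=> t0; rewrite /tclass -big_split/=.
transitivity (\prod_i (Num.sqrt (t * (be i)%:R) * gaussian_class (be i) (r i) t)%:C%C : C).
  by rewrite rmorph_prod.
under eq_bigr => i _.
  rewrite -(gaussian_class_cis _ (be0 i) t0).
  rewrite -(big_ord_narrow (beN i) (F := fun c : 'I_N.+1 =>
    cis (pi *+ 2 * (c%:R * (r i)%:R / (be i)%:R)) * (gaussian_class (be i) c t^-1)%:C%C)).
  over.
rewrite bigA_distr_big_dep; apply: eq_bigr => c _.
rewrite big_split/= -rmorph_prod/=; congr (_ * _).
rewrite fvec_dot mulr_sumr.
under [in RHS]eq_bigr do rewrite !ffunE.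
rewrite (big_morph (fun x : R => cis x) (id1 := 1) (op1 := *%R)) ?cis0//.
by move=> x y; rewrite cisD.
Qed.

End Classes.

(** * From the frame to the lattice by a finite character sum *)

Section MacWilliams.
Context {R : realType} {n : nat} (L : set 'rV[R]_n).
Local Notation C := R[i].
Hypothesis LD : L = dual L.
Implicit Types (v x u : 'rV[R]_n) (t : R) (S : set 'rV[R]_n) (k c m : {ffun 'I_n -> int}).

Definition translate x : set 'rV[R]_n := [set v | L (v - x)].

Lemma translate0 : translate 0 = L.
Proof. by apply/seteqP; split => v; rewrite /translate/= subr0. Qed.

Section WithFrame.
Variables (f : 'I_n -> 'rV[R]_n) (be : 'I_n -> nat) (N : nat).
Hypothesis fo : forall i j, i != j -> dotp (f i) (f j) = 0.
Hypothesis fbe : forall i, sqnorm (f i) = (be i)%:R.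
Hypothesis be0 : forall i, (0 < be i)%N.
Hypothesis beN : forall i, (be i <= N.+1)%N.
Hypothesis fL : forall i, L (f i).
Implicit Types (r : {ffun 'I_n -> 'I_N.+1}).

Local Notation fvec := (fvec f be).
Local Notation fam := (@fam n be N).
Local Notation tclass := (@tclass R n be N).
Local Notation residue := (@residue n be N).

Definition integral_frame x := forall i, dotp x (f i) \is a Num.int.

Let zL (m : 'I_n -> int) : L (\sum_i (m i)%:~R *: f i).
Proof. by apply: dual_sum => // i _; apply: dualZ; rewrite ?intr_int. Qed.

Lemma translate_periodic x : periodic f (translate x).
Proof. by move=> v m; rewrite /translate/= addrAC => h; apply: dualD. Qed.

Lemma translate_integral x : integral_frame x -> frame_integral f (translate x).
Proof.
move=> ix v h i; rewrite -[v](subrK x) dotpDl; apply: rpredD; last exact: ix.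
exact: (dual_int LD).
Qed.

(** The image of x + L in the finite group of dual points modulo the frame lattice, where L acts as
    a self-dual code. *)
Definition tres x : {set {ffun 'I_n -> 'I_N.+1}} :=
  [set r | fam r && `[< translate x (fvec (ffun_int r)) >]]%SET.

Definition shift m r : {ffun 'I_n -> 'I_N.+1} := residue [ffun i => (ffun_int r) i + m i].

Lemma fvecD k (k' : {ffun 'I_n -> int}) : fvec [ffun i => k i + k' i] = fvec k + fvec k'.
Proof.
by rewrite -big_split; apply: eq_bigr => i _ /=; rewrite ffunE rmorphD mulrDl scalerDl.
Qed.

Lemma shift_eq m r : exists z : 'I_n -> int,
  fvec (ffun_int (shift m r)) = fvec (ffun_int r) + fvec m - \sum_i (z i)%:~R *: f i.
Proof.
exists (fun i => ([ffun i => ffun_int r i + m i] i %/ be i)%Z).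
by rewrite -fvecD [X in _ = X - _](fvec_residue f be0 beN) addrK.
Qed.

Lemma shift_tres m x r : r \in tres x -> shift m r \in tres (x + fvec m).
Proof.
rewrite !inE => /andP[_ /asboolP h]; rewrite residue_fam//=; apply/asboolP.
have [z ->] := shift_eq m r; rewrite /translate/=.
rewrite (_ : _ - _ = fvec (ffun_int r) - x - \sum_i (z i)%:~R *: f i); first exact: dualB.
by apply/rowP => j; rewrite !mxE; ring.
Qed.

Lemma shift_inj m : {in fam &, injective (shift m)}.
Proof.
move=> r r' /famP fr /famP fr' /ffunP h; apply/ffunP => i; apply/val_inj => /=.
have := h i => /(congr1 (fun j : 'I_N.+1 => (j : nat)%:Z)).
rewrite !(proj1 (residueE be0 beN _ _)) !ffunE => /eqP.
rewrite eqz_modDr => /eqP; rewrite !modz_nat => -[].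
by rewrite !modn_small.
Qed.

Lemma card_tres x : integral_frame x -> #|tres x| = #|tres 0|.
Proof.
move=> ix; have /choice[k hk] : forall i, exists m : int, dotp x (f i) = m%:~R.
  by move=> i; apply/intrP; exact: ix.
have xE : x = fvec (finfun k) by apply: (fvecP fo fbe be0) => i; rewrite ffunE.
have le y m : (#|tres y| <= #|tres (y + fvec m)|)%N.
  rewrite -(@card_in_imset _ _ (shift m)); last first.
    by move=> r r'; rewrite !inE => /andP[h _] /andP[h' _]; exact: shift_inj.
  by apply: subset_leq_card; apply/fintype.subsetP => _ /imsetP[r hr ->]; exact: shift_tres.
apply/eqP; rewrite eqn_leq; apply/andP; split; last by have := le 0 (finfun k); rewrite add0r -xE.
have := le x [ffun i => - k i]; rewrite (_ : x + _ = 0)//.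
by rewrite {1}xE -fvecD; apply: big1 => i _; rewrite !ffunE subrr mul0r scale0r.
Qed.

Lemma sum_shift m x u (G : {ffun 'I_n -> 'I_N.+1} -> C) : fvec m = u -> L u ->
  \sum_(r in tres x) G (shift m r) = \sum_(r in tres x) G r.
Proof.
move=> mu Lu.
have si : {in tres x &, injective (shift m)}.
  by move=> r r'; rewrite !inE => /andP[h _] /andP[h' _]; exact: shift_inj.
suff E : [set shift m s | s in tres x]%SET = tres x :> {set {ffun 'I_n -> 'I_N.+1}}.
  by rewrite -(big_imset G si)/= E.
apply/eqP; rewrite finset.eqEcard card_in_imset// leqnn andbT.
apply/fintype.subsetP => _ /imsetP[s hs ->]; have := shift_tres m hs.
rewrite !inE mu => /andP[-> /asboolP h]; apply/asboolP; move: h; rewrite /translate/=.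
by move=> /(dualD LD Lu); congr L; rewrite opprD !addrA; apply/rowP => j; rewrite !mxE; ring.
Qed.

Lemma cis_dotp_shift c m r :
  cis (pi *+ 2 * dotp (fvec c) (fvec (ffun_int (shift m r)))) =
  cis (pi *+ 2 * dotp (fvec c) (fvec m)) * cis (pi *+ 2 * dotp (fvec c) (fvec (ffun_int r))) :> C.
Proof.
have [z ->] := shift_eq m r.
rewrite dotpBr dotpDr mulrBr mulrDr cisD cisD [cis _ * cis _]mulrC -[RHS]mulr1; congr (_ * _).
rewrite dotp_sumr (_ : \sum_i _ = (\sum_i z i * c i)%:~R); last first.
  by rewrite rmorph_sum; apply: eq_bigr => i _; rewrite dotpZr (fvec_dotp fo fbe be0) rmorphM.
by rewrite -mulrN -rmorphN cis_int.
Qed.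

Lemma cis_eq1_int (y : R) : cis (pi *+ 2 * y) = 1 :> C -> y \is a Num.int.
Proof.
move=> h; apply/negPn/negP => ny.
pose z := y - (Num.floor y)%:~R.
have /andP[f1 f2] := Num.Theory.floor_itv y.
have z0 : 0 <= z by rewrite subr_ge0.
have z1 : z < 1 by move: f2; rewrite intrD /z; lra.
have zn : z != 0 by apply: contra ny; rewrite subr_eq0 => /eqP ->; rewrite intr_int.
have p0 := pi_gt0 R.
have : cis (pi *+ 2 * z) != 1 :> C.
  have p2 : (0 : R) < pi *+ 2 by rewrite mulr2n addr_gt0.
  apply: cis_neq1; rewrite mulr_gt0//=; last by rewrite lt_neqAle eq_sym zn z0.
  by rewrite -[X in _ < X]mulr1 ltr_pM2l.
by rewrite /z mulrBr cisD h mul1r -mulrN -rmorphN cis_int eqxx.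
Qed.

(** Orthogonality of characters on L modulo the frame. If the point lies outside L = dual L, some u
    in L has a non-integral product with it, and translation by u multiplies the sum by a number
    other than 1. *)
Lemma character_sum c x : integral_frame x ->
  \sum_(r in tres x) cis (pi *+ 2 * dotp (fvec c) (fvec (ffun_int r))) =
  if `[< L (fvec c) >] then #|tres 0|%:R * cis (pi *+ 2 * dotp (fvec c) x) else 0 :> C.
Proof.
move=> ix; case: asboolP => Lc.
  rewrite -(card_tres ix) mulr_natl -sumr_const; apply: eq_bigr => r; rewrite inE => /andP[_ /asboolP h].
  have /intrP[d hd] := dual_int LD Lc h.
  rewrite -[fvec (ffun_int r)](subrK x) dotpDr hd mulrDr cisD cis_int mul1r//.
have [u Lu hu] : exists2 u, L u & dotp (fvec c) u \isn't a Num.int.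
  apply: contrapT => h; apply: Lc; apply: (dualP LD) => l Ll.
  by apply: contrapT => hl; apply: h; exists l => //; apply/negP.
have /choice[k hk] : forall i, exists m : int, dotp u (f i) = m%:~R.
  by move=> i; apply/intrP; exact: (dual_int LD).
have uE : fvec (finfun k) = u by symmetry; apply: (fvecP fo fbe be0) => i; rewrite ffunE.
have := sum_shift x (fun r => cis (pi *+ 2 * dotp (fvec c) (fvec (ffun_int r))) : C) uE Lu.
under eq_bigr do rewrite cis_dotp_shift.
rewrite -mulr_sumr uE; set X := \sum_(r in _) _ => /eqP.
rewrite -subr_eq0 -[X in _ - X]mul1r -mulrBl mulf_eq0 => /orP[|/eqP //].
by rewrite subr_eq0 => /eqP /cis_eq1_int h; rewrite h in hu.
Qed.

Lemma gsum_dual_frame x t : 0 < t -> integral_frame x ->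
  (\prod_i Num.sqrt (t * (be i)%:R) * gsum (translate x) t)%:C%C =
  #|tres 0|%:R * \sum_(c | fam c && `[< L (fvec (ffun_int c)) >])
     cis (pi *+ 2 * dotp (fvec (ffun_int c)) x) * (tclass c t^-1)%:C%C.
Proof.
move=> t0 ix.
have [_ ->] := gsum_classes fo fbe be0 beN t0 (@translate_periodic x) (translate_integral ix).
rewrite [X in X%:C%C]mulr_sumr (rmorph_sum (@real_complex R)).
rewrite (eq_bigr _ (fun r _ => tclass_dual fo fbe be0 beN r t0)).
rewrite exchange_big/= mulr_sumr [RHS]big_mkcondr/=; apply: eq_bigr => c fc.
rewrite -mulr_suml (eq_bigl (fun r => r \in tres x)); last by move=> r; rewrite inE.
by rewrite character_sum//; case: asboolP => _; rewrite ?mul0r// mulrA.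
Qed.

End WithFrame.
End MacWilliams.

(** * Theta duality for unimodular lattices and their shadows *)

Section ThetaDuality.
Context {R : realType} {n : nat} (L : set 'rV[R]_n).
Local Notation C := R[i].
Hypothesis UL : unimodular L.
Implicit Types (v x u : 'rV[R]_n) (t : R) (S : set 'rV[R]_n).

Let LD : L = dual L. Proof. by case: UL. Qed.

Definition even_part := [set v | L v /\ sqnorm v / 2 \is a Num.int].
Definition odd_part := [set v | L v /\ sqnorm v / 2 \isn't a Num.int].

(** The frame is taken in 2L because adding 2g preserves the parity of the norm, so that the even
    and the odd part of L are unions of cosets. It also makes products with halves of lattice
    vectors integral. *)
Lemma double_frame : exists f (be : 'I_n -> nat),
  [/\ forall i j, i != j -> dotp (f i) (f j) = 0, forall i, sqnorm (f i) = (be i)%:R,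
      forall i, (0 < be i)%N & forall i, exists2 g, L g & f i = 2 *: g].
Proof.
have [[B Bu LB] _] := UL.
have [f [fL f0 fo]] := orthogonal_frame LD Bu LB.
have /choice[be hbe] : forall i, exists m : nat, sqnorm (2 *: f i) = m%:R.
  by move=> i; apply: (sqnorm_nat LD); apply: dualZ.
exists (fun i => 2 *: f i), be; split => // [i j ij|i|i].
- by rewrite dotpZl dotpZr fo ?mulr0.
- rewrite lt0n -(@pnatr_eq0 R) -hbe sqnorm_eq0 scaler_eq0 negb_or f0 andbT.
  by rewrite pnatr_eq0.
- by exists (f i).
Qed.

Lemma gsum_gt0 t : 0 < t -> summ L (fun v => expR (- (pi * t * sqnorm v)) : R) -> 0 < gsum L t.
Proof.
move=> t0 s.
have h := @rsum_fset_le R _ L _ [fset 0]%fset (fun v => expR_ge0 _) s.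
apply: lt_le_trans (h _); last by move=> v; rewrite /= inE => /eqP ->; exact: dual0.
by rewrite big_seq_fset1 expR_gt0.
Qed.

(** x = 0 gives the theta series and x = w/2 the shadow; S and S' collect the vectors on which the
    character of x is 1 and -1. Comparison at t = 1 shows that the index of the frame in L equals K,
    the covolume of the frame. *)
Lemma gsum_duality : exists2 K : R, 0 < K & forall x t, L (2 *: x) -> 0 < t ->
  [/\ summ (translate L x) (fun v => expR (- (pi * t * sqnorm v)) : R),
      gsum L t^-1 = Num.sqrt t ^+ n * gsum L t &
      forall S S', S `<=` L -> S' `<=` L ->
        (forall v, L v -> (cis (pi *+ 2 * dotp v x) = 1 :> C /\ S v /\ ~ S' v) \/
                          (cis (pi *+ 2 * dotp v x) = -1 :> C /\ S' v /\ ~ S v)) ->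
        (forall v g, L g -> S v -> S (v + 2 *: g)) ->
        (forall v g, L g -> S' v -> S' (v + 2 *: g)) ->
        Num.sqrt t ^+ n * gsum (translate L x) t = gsum S t^-1 - gsum S' t^-1].
Proof.
have [f [be [fo fbe be0 f2]]] := double_frame.
pose N := (\sum_i be i)%N.
have beN i : (be i <= N.+1)%N by rewrite leqW// /N (bigD1 i)//= leq_addr.
have fL i : L (f i) by have [g Lg ->] := f2 i; apply: dualZ.
pose K : R := \prod_i Num.sqrt (be i)%:R.
have K0 : 0 < K by apply: prodr_gt0 => i _; rewrite sqrtr_gt0 ltr0n.
have CE t : 0 < t -> \prod_i Num.sqrt (t * (be i)%:R) = Num.sqrt t ^+ n * K.
  move=> t0; under eq_bigr do rewrite sqrtrM ?ltW//.
  by rewrite big_split/= prodr_const card_ord.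
have ix x : L (2 *: x) -> integral_frame f x.
  move=> h i; have [g Lg ->] := f2 i; rewrite dotpZr -dotpZl; exact: (dual_int LD).
have ii S : S `<=` L -> frame_integral f S by move=> SL v /SL Lv i; apply: (dual_int LD).
have per S : (forall v g, L g -> S v -> S (v + 2 *: g)) -> periodic f S.
  move=> h v m Sv; have /choice[g hg] : forall i, exists g, L g /\ f i = 2 *: g.
    by move=> i; have [g ? ?] := f2 i; exists g.
  rewrite (_ : \sum_i _ = 2 *: \sum_i (m i)%:~R *: g i); last first.
    by rewrite scaler_sumr; apply: eq_bigr => i _; rewrite (proj2 (hg i)) !scalerA mulrC.
  by apply: h => //; apply: dual_sum => // i _; apply: dualZ; rewrite ?intr_int//; case: (hg i).
have L2 v g : L g -> L v -> L (v + 2 *: g) by move=> Lg Lv; apply: dualD => //; apply: dualZ.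
pose c0 : R := #|tres L f be N 0|%:R.
have dual0E t : 0 < t -> Num.sqrt t ^+ n * K * gsum L t = c0 * gsum L t^-1.
  move=> t0; have i0 : integral_frame f 0 by apply: ix; rewrite scaler0; exact: dual0.
  have := gsum_dual_frame LD fo fbe be0 beN fL t0 i0.
  have ti0 : 0 < t^-1 by rewrite invr_gt0.
  have [_ gE] := gsum_classes fo fbe be0 beN ti0 (per _ L2) (ii L (@subset_refl _ L)).
  rewrite translate0 CE// => h; apply: (@complexI R); rewrite h gE.
  rewrite rmorphM /= rmorph_sum/= rmorph_nat; congr (_ * _); apply: eq_bigr => c _.
  by rewrite dotp0r mulr0 cis0 mul1r.
have sL t : 0 < t -> summ L (fun v => expR (- (pi * t * sqnorm v)) : R).
  by move=> t0; have [] := gsum_classes fo fbe be0 beN t0 (per _ L2) (ii L (@subset_refl _ L)).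
have c0E : c0 = K.
  have := dual0E 1 ltr01; rewrite sqrtr1 expr1n mul1r invr1 => /mulIf -> //.
  by rewrite gt_eqF//; apply: gsum_gt0 => //; exact: sL.
exists K => // x t Lx t0; split.
- by have [] := gsum_classes fo fbe be0 beN t0 (translate_periodic LD fL (x := x)) (translate_integral LD fL (ix _ Lx)).
- have := dual0E t t0; rewrite c0E mulrAC [RHS]mulrC => /mulIf <- //; by rewrite gt_eqF.
move=> S S' SL SL' SS pS pS'.
have := gsum_dual_frame LD fo fbe be0 beN fL t0 (ix _ Lx).
have cC : #|tres L f be N 0|%:R = c0%:C%C :> C by rewrite rmorph_nat.
rewrite CE// cC c0E => h.
apply: (mulfI (lt0r_neq0 K0)); apply: (@complexI R).
rewrite mulrA [K * _]mulrC h [RHS]rmorphM/=; congr (_ * _); rewrite rmorphB/=.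
have ti0 : 0 < t^-1 by rewrite invr_gt0.
have [_ ->] := gsum_classes fo fbe be0 beN ti0 (per _ pS) (ii _ SL).
have [_ ->] := gsum_classes fo fbe be0 beN ti0 (per _ pS') (ii _ SL').
rewrite !rmorph_sum/= !big_mkcondr/= -sumrB; apply: eq_bigr => c fc.
case: asboolP => Lc; last first.
  by case: asboolP => [/SL//|_]; case: asboolP => [/SL'//|_]; rewrite subr0.
have [[-> [h1 h2]]|[-> [h1 h2]]] := SS _ Lc.
  by case: asboolP => // _; case: asboolP => // _; rewrite mul1r subr0.
by case: asboolP => // _; case: asboolP => // _; rewrite mulN1r sub0r.
Qed.

Lemma summ_lattice t : 0 < t -> summ L (fun v => expR (- (pi * t * sqnorm v)) : R).
Proof.
move=> t0; have [K _ h] := gsum_duality.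
have L0 : L (2 *: 0) by rewrite scaler0; exact: dual0.
by have [s _ _] := h 0 t L0 t0; rewrite -(translate0 L).
Qed.

Lemma theta_duality t : 0 < t -> gsum L t^-1 = Num.sqrt t ^+ n * gsum L t.
Proof.
move=> t0; have [K _ h] := gsum_duality.
by have [] := h 0 t _ t0 => //; rewrite scaler0; exact: dual0.
Qed.

Section Shadow.
Variable w : 'rV[R]_n.
Hypothesis Lw : L w.
Hypothesis hw : forall x, L x -> (dotp w x - sqnorm x) / 2 \is a Num.int.

(** The shadow in the sense of Conway and Sloane: as w is characteristic, the character of w/2 on L
    is (-1)^(v.v). *)
Definition shadow := translate L (2^-1 *: w).

Lemma even_char v : L v -> dotp v w / 2 \is a Num.int = (sqnorm v / 2 \is a Num.int).
Proof.
move=> Lv; have h := hw Lv; rewrite dotpC.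
have -> : dotp w v / 2 = (dotp w v - sqnorm v) / 2 + sqnorm v / 2 by field.
by rewrite (rpredDl _ h).
Qed.

Lemma summ_shadow t : 0 < t -> summ shadow (fun v => expR (- (pi * t * sqnorm v)) : R).
Proof.
move=> t0; have [K _ h] := gsum_duality.
by have [] := h (2^-1 *: w) t _ t0 => //; rewrite scalerA mulfV// scale1r.
Qed.

Lemma shadow_duality t : 0 < t ->
  Num.sqrt t ^+ n * gsum shadow t = gsum even_part t^-1 - gsum odd_part t^-1.
Proof.
move=> t0; have [K _ h] := gsum_duality.
have Lw2 : L (2 *: (2^-1 *: w)) by rewrite scalerA mulfV// scale1r.
have [_ _ ] := h (2^-1 *: w) t Lw2 t0.
have parity v g : L g -> L v ->
    (sqnorm (v + 2 *: g) / 2 \is a Num.int) = (sqnorm v / 2 \is a Num.int).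
  move=> Lg Lv; rewrite sqnormD sqnormZ dotpZr.
  have i1 : 2 * sqnorm g + 2 * dotp v g \is a Num.int.
    have i2 : (2 : R) \is a Num.int by exact: natr_int.
    have i3 := sqnorm_int LD Lg; have i4 := dual_int LD Lv Lg.
    by apply: rpredD; apply: rpredM.
  rewrite (_ : (_ / 2) = sqnorm v / 2 + (2 * sqnorm g + 2 * dotp v g)); last by field.
  by rewrite rpredDr.
have L2 v g : L g -> L v -> L (v + 2 *: g) by move=> Lg Lv; apply: dualD => //; apply: dualZ.
apply => [v []//|v []//|v Lv|v g Lg [Lv pv]|v g Lg [Lv pv]]; last 2 first.
- by split; [exact: L2 | rewrite parity].
- by split; [exact: L2 | rewrite parity].
rewrite dotpZr mulrCA; have e := even_char Lv.
have /intrP[d hd] := dual_int LD Lv Lw.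
have [ev|od] := boolP (sqnorm v / 2 \is a Num.int).
  left; split; last by split => // -[_]; rewrite ev.
  have /intrP[q hq] : dotp v w / 2 \is a Num.int by rewrite e.
  by rewrite (_ : 2^-1 * _ = pi *+ 2 * q%:~R) ?cis_int// -hq; ring.
right; split; last by split => // -[_]; apply/negP.
have [q hq] : exists q : int, d = 2 * q + 1.
  exists (d %/ 2)%Z; have h1 := divz_eq d 2.
  have [h0|h0] : (d %% 2)%Z = 0 \/ (d %% 2)%Z = 1 by lia.
    exfalso; move: od; rewrite -e hd h1 h0 addr0 rmorphM/= mulfK// ?intr_int//.
  by rewrite {1}h1 h0 mulrC.
rewrite hd hq (_ : 2^-1 * _ = pi *+ 2 * q%:~R + pi); last by rewrite rmorphD rmorphM/=; field.
by rewrite cisD cis_int mul1r cisE cospi sinpi; apply/eqP; rewrite eq_complex /= oppr0 !eqxx.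
Qed.

End Shadow.
End ThetaDuality.

(** * The theta series as a polynomial in theta constants *)

Section Coefficients.
Context (R : realType).

Lemma fcoef_fset (T : choiceType) (g : T -> nat) (j : nat) (X : {fset T}) :
  (forall v, g v = j <-> v \in X) -> fcoef [set: T] g j = #|` X|%:R :> R.
Proof.
move=> h; rewrite /fcoef (_ : [set v | _] = [set` X]).
  have [_ ->] := @rsum_fset R T (fun=> 1) X (fun=> ler01).
  by rewrite big_const_seq count_predT iter_addr_0.
by apply/seteqP; split => v /=; [case=> _ /h | move=> /h].
Qed.

Lemma fcoef_isq0 : fcoef [set: int] isq 0 = 1 :> R.
Proof.
rewrite (@fcoef_fset _ _ _ [fset 0]%fset) ?cardfs1// => k; rewrite inE /isq; split.
  by move=> /eqP; rewrite expn_eq0 absz_eq0 => /andP[].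
by move=> /eqP ->.
Qed.

(** m and -m-1 have the same triangular number, so 0 and 1 are attained twice each. *)
Lemma fcoef_itri (j : nat) : (j < 2)%N -> fcoef [set: int] itri j = 2 :> R.
Proof.
move=> j2; rewrite (@fcoef_fset _ _ _ [fset j%:Z; - (j.+1)%:Z]%fset); first by rewrite cardfs2; case: eqP => //; lia.
move=> k; rewrite !inE; split => [h|].
  have := @itriE R k; rewrite h (_ : (8 * j + 1)%:R = (2 * j%:Z + 1)%:~R ^+ 2); last first.
    have e : (2 * j%:Z + 1) ^+ 2 = (8 * j + 1)%N%:Z by case: j j2 {h} => [|[]].
    by rewrite -rmorphXn/= e.
  by move/eqP; rewrite eqf_sqr -rmorphN/= !eqr_int; lia.
by case: j j2 => [|[|//]] _ /orP[] /eqP ->.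
Qed.
End Coefficients.

Section ModularIdentity.
Context {R : realType}.
Local Notation C := R[i].
Implicit Types (x y q s : R) (z t : C).
Local Notation isqser := (fser [set: int] isq : R -> R).
Local Notation itriser := (fser [set: int] itri : R -> R).

Variables (m k1 : nat) (Ev Od Sh : R -> R) (E O F : R -> R).
Hypothesis m7 : (m <= 7)%N.
Hypothesis k7 : (k1 <= 7)%N.
Local Notation n := (m + 16)%N.
Hypothesis EvE : forall y, 0 < y -> Ev y = E (expR (- (pi * y)) ^+ 2).
Hypothesis OdE : forall y, 0 < y -> Od y = expR (- (pi * y)) * O (expR (- (pi * y)) ^+ 2).
Hypothesis ShE : forall y, 0 < y -> Sh y = expR (- (pi / 4 * y)) ^+ k1 * F (expR (- (pi * y)) ^+ 2).
Hypothesis Sh0 : forall y, 0 < y -> 0 < Sh y.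
Hypothesis Th0 : forall y, 0 < y -> 0 < Ev y + Od y.
Hypothesis dualT : forall y, 0 < y -> Ev y^-1 + Od y^-1 = Num.sqrt y ^+ n * (Ev y + Od y).
Hypothesis dualS : forall y, 0 < y -> Ev y^-1 - Od y^-1 = Num.sqrt y ^+ n * Sh y.
Variables (cT1 cPsi cE cO cF : C -> C).
Hypothesis aT1 : analytic cT1.
Hypothesis aPsi : analytic cPsi.
Hypothesis aE : analytic cE.
Hypothesis aO : analytic cO.
Hypothesis aF : analytic cF.
Hypothesis vT1 : forall x, 0 <= x < 1 -> cT1 x%:C%C = (isqser x)%:C%C.
Hypothesis vPsi : forall x, 0 <= x < 1 -> cPsi x%:C%C = (itriser x)%:C%C.
Hypothesis vE : forall x, 0 <= x < 1 -> cE x%:C%C = (E x)%:C%C.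
Hypothesis vO : forall x, 0 <= x < 1 -> cO x%:C%C = (O x)%:C%C.
Hypothesis vF : forall x, 0 <= x < 1 -> cF x%:C%C = (F x)%:C%C.

Let rcM x y : x%:C%C * y%:C%C = (x * y)%:C%C. Proof. by rewrite rmorphM. Qed.
Let rcD x y : x%:C%C + y%:C%C = (x + y)%:C%C. Proof. by rewrite rmorphD. Qed.
Let rcN x : - x%:C%C = (- x)%:C%C. Proof. by rewrite rmorphN. Qed.
Let rcX x k : x%:C%C ^+ k = (x ^+ k)%:C%C. Proof. by rewrite rmorphXn. Qed.
Let rcE := (rcM, rcD, rcN, rcX).

Let sq01 x : `|x| < 1 -> 0 <= x ^+ 2 < 1.
Proof. by move=> h; rewrite sqr_ge0 -[x ^+ 2]ger0_norm ?sqr_ge0// normrX expr_lt1. Qed.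

Let q4 x : `|x| < 1 -> 0 <= x ^+ 4 < 1.
Proof.
move=> /sq01/andP[h0 h1]; rewrite (exprM x 2 2); apply: sq01; by rewrite ger0_norm.
Qed.

Let q8 x : `|x| < 1 -> 0 <= x ^+ 8 < 1.
Proof.
move=> /q4/andP[h0 h1]; rewrite (exprM x 4 2); apply: sq01; by rewrite ger0_norm.
Qed.

(** theta3(q) = theta3(q^4) + theta2(q^4) separates even from odd powers of q, so that z -> -z
    visibly exchanges theta3 and theta4. *)
Let cT z := cT1 (z ^+ 4) + z * cPsi (z ^+ 8).
Let cN z := cE (z ^+ 2) + z * cO (z ^+ 2).
Let TR x := isqser (x ^+ 4) + x * itriser (x ^+ 8).
Let NR x := E (x ^+ 2) + x * O (x ^+ 2).
Let PR x := itriser (x ^+ 2).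

Let acT : analytic cT.
Proof.
by apply: analyticD; [exact: analytic_pow | apply: analyticM; [exact: analytic_id|exact: analytic_pow]].
Qed.

Let acN : analytic cN.
Proof.
by apply: analyticD; [exact: analytic_pow | apply: analyticM; [exact: analytic_id|exact: analytic_pow]].
Qed.

Let cTE x : `|x| < 1 -> cT x%:C%C = (TR x)%:C%C.
Proof. by move=> hx; rewrite /cT !rcX vT1 ?q4// vPsi ?q8// !rcE. Qed.

Let cNE x : `|x| < 1 -> cN x%:C%C = (NR x)%:C%C.
Proof. by move=> hx; rewrite /cN !rcX vE ?sq01// vO ?sq01// !rcE. Qed.

Let cPE x : `|x| < 1 -> cPsi (x%:C%C ^+ 2) = (PR x)%:C%C.
Proof. by move=> hx; rewrite !rcX vPsi ?sq01. Qed.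

Let nome y := expR (- (pi * y)) : R.

Let nome0 y : 0 < nome y. Proof. exact: expR_gt0. Qed.

Let nome1 y : 0 < y -> `|nome y| < 1.
Proof. by move=> y0; rewrite ger0_norm ?ltW// expR_lt1 oppr_lt0 mulr_gt0// pi_gt0. Qed.

Let nomeX y k : nome y ^+ k = nome (k%:R * y).
Proof. by rewrite /nome -expRM_natr; congr expR; ring. Qed.

Let quarter y := expR (- (pi / 4 * y)) : R.

Let quarter4 y : quarter y ^+ 4 = nome y.
Proof. by rewrite /quarter /nome -expRM_natr; congr expR; field. Qed.

Let th2P y : 0 < y -> th2 y = quarter y * PR (nome y).
Proof. by move=> y0; rewrite (proj2 (th2_series y0)). Qed.

Let TR_nome y : 0 < y -> TR (nome y) = th3 y /\ TR (- nome y) = th4 y.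
Proof.
move=> y0; have y4 : 0 < 4 * y by rewrite mulr_gt0.
have e1 : isqser (nome y ^+ 4) = th3 (4 * y) by rewrite nomeX th3_series.
have e2 : nome y * itriser (nome y ^+ 8) = th2 (4 * y).
  rewrite th2P// /PR /quarter /nome; congr (_ * _); first by congr expR; field.
  by rewrite -!expRM_natr; congr (itriser (expR _)); ring.
rewrite /TR (_ : (- nome y) ^+ 4 = nome y ^+ 4); last by ring.
rewrite (_ : (- nome y) ^+ 8 = nome y ^+ 8); last by ring.
by rewrite mulNr e1 e2 -th3_split// -th4_split.
Qed.

Let NR_nome y : 0 < y -> NR (nome y) = Ev y + Od y /\ NR (- nome y) = Ev y - Od y.
Proof. by move=> y0; rewrite /NR sqrrN mulNr EvE// OdE. Qed.

Let yi y : 0 < y -> 0 < y^-1. Proof. by rewrite invr_gt0. Qed.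

Let sqr_sqrtn y : 0 < y -> (Num.sqrt y ^+ n) ^+ 2 = y ^+ n.
Proof. by move=> y0; rewrite -exprM mulnC exprM sqr_sqrtr// ltW. Qed.

(** A and B serve only to find [k1]: the modulus of one theta series is blind to phases, but in a
    sum with theta3^n or theta2^n the relative phase is detected. B is a function of q^(1/4). *)
Let cA z := cN z + cT z ^+ n.
Let cB z := z ^+ k1 * cF (z ^+ 8) + (z * cPsi (z ^+ 8)) ^+ n.

Let acA : analytic cA. Proof. by apply: analyticD => //; exact: analyticX. Qed.

Let acB : analytic cB.
Proof.
apply: analyticD; first by apply: analyticM; [exact: (analyticX _ analytic_id)|exact: analytic_pow].
by apply: analyticX; apply: analyticM; [exact: analytic_id|exact: analytic_pow].
Qed.

Let cB_real y : 0 < y -> cB (quarter y)%:C%C = (Sh y + th2 y ^+ n)%:C%C.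
Proof.
move=> y0; have h2 := sq01 (nome1 y0).
have e8 : quarter y ^+ 8 = nome y ^+ 2 by rewrite -quarter4 -exprM.
by rewrite /cB !rcX e8 vF// vPsi// !rcE ShE// th2P.
Qed.

Let nomeV y : expR (- (pi / y)) = nome y^-1. Proof. by []. Qed.

Let modA t : 0 < complex.Re t -> normc (cA (qpi t^-1)) ^+ 2 = normc t ^+ n * normc (cA (qpi t)) ^+ 2.
Proof.
move=> t0; rewrite (analytic_normc (n := n) (g := fun z => cA (z ^+ 4)) acA (analytic_pow 3 acA) _ t0).
  by rewrite qpi_quarter.
move=> y y0; have eq4 : (quarter y)%:C%C ^+ 4 = (nome y)%:C%C by rewrite rcX quarter4.
rewrite nomeV -/(quarter y) eq4 /cA !cNE ?nome1 ?yi// !cTE ?nome1 ?yi//.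
have [-> _] := NR_nome (yi y0); have [-> _] := TR_nome (yi y0).
have [-> _] := NR_nome y0; have [-> _] := TR_nome y0.
rewrite !rcE; congr (_%:C%C); rewrite dualT// th3_dual// exprMn -mulrDr exprMn sqr_sqrtn//.
Qed.

Let modB t : 0 < complex.Re t -> normc (cA (- qpi t^-1)) ^+ 2 =
  normc t ^+ n * normc (cB (cexp (- ((pi / 4)%:C%C * t)))) ^+ 2.
Proof.
move=> t0; rewrite (analytic_normc (n := n) (f := fun z => cA (- z)) (analyticN acA) acB _ t0)//.
move=> y y0; rewrite nomeV -/(quarter y) cB_real// rcN /cA cNE ?normrN ?nome1 ?yi// cTE ?normrN ?nome1 ?yi//.
have [_ ->] := NR_nome (yi y0); have [_ ->] := TR_nome (yi y0).
by rewrite !rcE; congr (_%:C%C); rewrite dualS// th4_dual// exprMn -mulrDr exprMn sqr_sqrtn.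
Qed.

(* |B(t)| = |B(t - i)|: apply S, T and S to A, using 1/t + i = 1/t' and t' = 1/(t - i) - i. *)
Let normc_cB_shift y : 0 < y ->
  normc (cB (cexp (- ((pi / 4)%:C%C * y%:C%C)))) =
  normc (cB (cexp (- ((pi / 4)%:C%C * (y%:C%C - (0 +i* 1)%C))))).
Proof.
move=> y0; set t : C := y%:C%C; pose j : C := (0 +i* 1)%C; pose u : C := t - j.
have Ret : 0 < complex.Re t by [].
have Reu : 0 < complex.Re u by rewrite /= subr0.
have t0 : t != 0 by exact: neq0_of_Re.
have u0 : u != 0 by exact: neq0_of_Re.
have jj : j * j = -1 by apply/eqP; rewrite eq_complex /= !mul0r !mulr0 !mulr1 addr0 sub0r oppr0 !eqxx.
have nj : normc j = 1 by rewrite /= expr0n expr1n add0r sqrtr1.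
pose t' := u^-1 - j.
have t'u : t' * (j * u) = t.
  rewrite /t' mulrBl [j * (j * u)]mulrA jj mulN1r opprK [j * u]mulrC mulKf// /u; ring.
have t'0 : t' != 0 by apply: contraNneq t0 => h; rewrite -t'u h mul0r.
have t'V : t'^-1 = t^-1 + j.
  apply: (mulfI t'0); rewrite mulfV// mulrDr; apply: (mulIf t0).
  rewrite mul1r mulrDl divfK// -{1}t'u /u mulrBr jj opprK mulrDr mulr1.
  by rewrite addrC mulrA.
have Ret' : 0 < complex.Re t'.
  by rewrite -[t']invrK; apply: Re_inv_gt0; rewrite t'V raddfD /= addr0; exact: (Re_inv_gt0 Ret).
have qs z : qpi (z + j) = - qpi z.
  rewrite /qpi mulrDr opprD cexpD (_ : - (pi%:C%C * j) = (0 +i* - pi)%C).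
    by rewrite -/(cis (- pi)) cisE cosN sinN cospi sinpi oppr0 (_ : (-1 +i* 0)%C = -1) ?mulrN1//;
      apply/eqP; rewrite eq_complex /= oppr0 !eqxx.
  by apply/eqP; rewrite eq_complex /= !mul0r mulr0 mulr1 subr0 addr0 oppr0 !eqxx.
have h1 := modB Ret; have h2 := modA Ret'; have h3 := modB Reu.
rewrite -qs -t'V h2 in h1.
have e : qpi t' = - qpi u^-1 by have := qs t'; rewrite /t' subrK => ->; rewrite opprK.
rewrite e h3 mulrA -exprMn in h1.
have nt : normc t' * normc u = normc t by rewrite -t'u !normcM nj mul1r.
have n0 : normc t ^+ n != 0 by rewrite expf_neq0// gt_eqF// normc_gt0_Re.
rewrite nt in h1; have := mulfI n0 h1 => /eqP.
by rewrite eqrXn2 ?normc_ge0// => /eqP ->.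
Qed.

(** In effect w.w = n mod 8. Passing from t to t - i multiplies q^(1/4) by a primitive eighth root
    of unity z8, so B becomes z8^k1 (Sh + z8^(n-k1) theta2^n). As Sh and theta2^n are positive,
    equality of moduli forces z8^(n-k1) = 1. *)
Lemma shadow_class : k1 = m.
Proof.
have X0 := Sh0 ltr01; have Y0 : 0 < th2 1 ^+ n :> R by rewrite exprn_gt0// th2_gt0.
have kn : (k1 <= n)%N by lia.
pose dl := unity 8 ^+ (n - k1) : C.
have h := normc_cB_shift ltr01.
have e1 : cexp (- ((pi / 4)%:C%C * 1%:C%C)) = (quarter 1)%:C%C.
  by rewrite -rmorphM -rmorphN cexp_real.
pose z8 : C := unity 8.
have e2 : cexp (- ((pi / 4)%:C%C * (1%:C%C - (0 +i* 1)%C))) = (quarter 1)%:C%C * z8.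
  rewrite mulrBr opprB addrC cexpD e1; congr (_ * _).
  rewrite /z8 /unity /cis; congr cexp; apply/eqP; rewrite eq_complex /= !mul0r !mulr0 !mulr1 subr0 addr0 eqxx /=.
  by apply/eqP; rewrite -[_ *+ 2]mulr_natr; field.
have z88 : z8 ^+ 8 = 1 by have := unityX 1 (ltn0Sn 7) => /=; rewrite muln1.
rewrite e1 e2 cB_real// in h.
have h2 := sq01 (nome1 ltr01).
have e8 : quarter 1 ^+ 8 = nome 1 ^+ 2 by rewrite -quarter4 -exprM.
have vB : cB ((quarter 1)%:C%C * z8) = z8 ^+ k1 * ((Sh 1)%:C%C + dl * (th2 1 ^+ n)%:C%C).
  have p8 : ((quarter 1)%:C%C * z8) ^+ 8 = (nome 1 ^+ 2)%:C%C by rewrite exprMn z88 mulr1 rcX e8.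
  rewrite /cB p8 vF// vPsi// ShE// th2P// /dl.
  rewrite mulrDr mulrA -exprD subnKC// -rcM -rcX -rcX -rcM !exprMn.
  by congr (_ + _); ring.
have nz k : normc (z8 ^+ k) = 1 by rewrite normcX normc_cis expr1n.
rewrite vB normcM nz mul1r normc_real ger0_norm ?addr_ge0 ?ltW// in h.
have nd : normc dl = 1 by exact: nz.
have : dl = 1.
  move: nd h; move: (Sh 1) (th2 1 ^+ n) X0 Y0 => X Y X0 Y0; move: (dl) => [a b] nd h.
  have nE (u v : R) : normc (u +i* v)%C ^+ 2 = u ^+ 2 + v ^+ 2.
    by rewrite /= sqr_sqrtr// addr_ge0// sqr_ge0.
  have h1 : a ^+ 2 + b ^+ 2 = 1 by rewrite -nE nd expr1n.
  have h3 : (X + Y) ^+ 2 = (X + a * Y) ^+ 2 + (b * Y) ^+ 2.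
    rewrite h -nE; congr (normc _ ^+ 2); apply/eqP; rewrite eq_complex /=.
    by apply/andP; split; apply/eqP; ring.
  have ha : a = 1.
    have XY : 0 < X * Y by rewrite mulr_gt0.
    by apply: (mulfI (lt0r_neq0 XY)); nra.
  have hb : b = 0 by apply/eqP; rewrite -sqrf_eq0; move: h1; rewrite ha; lra.
  by rewrite ha hb.
move/eqP; rewrite unity_eq1//; move: m7 k7; clear; lia.
Qed.

Variables K2 N3 : R.
Hypothesis jE : jet2 E 1 K2.
Hypothesis jO : jet2 O 0 N3.

Let a2 := 2 * n%:R * (n%:R - 23) + K2.
Let HR x := 1 / 2 * PR x.
(** (theta2 theta4)^4 / 16 as a series in q: theta2 / 2 is q^(1/4) [HR], and the four quarter powers
    make one factor q. *)
Let DR x := x * (HR x ^+ 4 * TR (- x) ^+ 4).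
Let G1R x := NR x - TR x ^+ n + 2 * n%:R * (TR x ^+ (m + 8) * DR x) - a2 * (TR x ^+ m * DR x ^+ 2).
Let cH z := (1 / 2)%:C%C * cPsi (z ^+ 2).
Let cD z := z * (cH z ^+ 4 * cT (- z) ^+ 4).
Let cG1 z := cN z - cT z ^+ n + (2 * n%:R)%:C%C * (cT z ^+ (m + 8) * cD z) -
  a2%:C%C * (cT z ^+ m * cD z ^+ 2).
Let cU z := ((1 / 2)%:C%C * (cT z * cT (- z))) ^+ 4.
(** The transform of G1 at the other cusp, divided by q^(m/4). Besides this factor theta2^n,
    theta2^(m+8), theta2^m carry q^4, q^2, 1, and by [shadow_class] the shadow series carries none.
    D turns into -(theta3 theta4)^4 / 16, whence the sign of the middle term. *)
Let cG3 z := cF (z ^+ 2) - z ^+ 4 * cPsi (z ^+ 2) ^+ n -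
  (2 * n%:R)%:C%C * (z ^+ 2 * (cPsi (z ^+ 2) ^+ (m + 8) * cU z)) -
  a2%:C%C * (cPsi (z ^+ 2) ^+ m * cU z ^+ 2).

Let acD : analytic cD.
Proof.
apply: analyticM; first exact: analytic_id.
apply: analyticM; apply: analyticX; last exact: analyticN.
by apply: analyticZ; exact: analytic_pow.
Qed.

Let acG1 : analytic cG1.
Proof.
apply: analyticB; last by apply: analyticZ; apply: analyticM; apply: analyticX.
apply: analyticD; last by apply: analyticZ; apply: analyticM => //; apply: analyticX.
by apply: analyticB => //; exact: analyticX.
Qed.

Let acU : analytic cU.
Proof. by apply: analyticX; apply: analyticZ; apply: analyticM => //; exact: analyticN. Qed.

Let acG3 : analytic cG3.
Proof.
have aP2 : analytic (fun z => cPsi (z ^+ 2)) by exact: analytic_pow.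
apply: analyticB; last first.
  by apply: analyticZ; apply: analyticM; apply: analyticX.
apply: analyticB; last first.
  apply: analyticZ; apply: analyticM; first exact: (analyticX _ analytic_id).
  by apply: analyticM => //; apply: analyticX.
apply: analyticB; first exact: analytic_pow.
by apply: analyticM; [exact: (analyticX _ analytic_id) | exact: analyticX].
Qed.

Let cG3_even z : cG3 (- z) = cG3 z.
Proof.
have e4 : (- z) ^+ 4 = z ^+ 4 by rewrite (exprM (- z) 2 2) sqrrN -exprM.
by rewrite /cG3 /cU sqrrN e4 opprK (mulrC (cT (- z))).
Qed.

Let cHE x : `|x| < 1 -> cH x%:C%C = (HR x)%:C%C.
Proof. by move=> hx; rewrite /cH cPE// rcM. Qed.

Let cDE x : `|x| < 1 -> cD x%:C%C = (DR x)%:C%C.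
Proof. by move=> hx; rewrite /cD cHE// rcN cTE ?normrN// !rcE. Qed.

Let cG1E x : `|x| < 1 -> cG1 x%:C%C = (G1R x)%:C%C.
Proof. by move=> hx; rewrite /cG1 cNE// cTE// cDE// !rcE. Qed.

Let dd y := (th2 y * th4 y) ^+ 4 / 16.

Let DR_nome y : 0 < y -> DR (nome y) = dd y.
Proof.
move=> y0; rewrite /DR (proj2 (TR_nome y0)) /dd th2P// /HR -quarter4.
by field.
Qed.

Let DR_nomeN y : 0 < y -> DR (- nome y) = - ((th2 y * th3 y) ^+ 4 / 16).
Proof.
move=> y0; rewrite /DR opprK (proj1 (TR_nome y0)) th2P// /HR /PR sqrrN -quarter4.
by field.
Qed.

Let G1R_nome y : 0 < y -> G1R (nome y) = Ev y + Od y - th3 y ^+ n +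
  2 * n%:R * (th3 y ^+ (m + 8) * dd y) - a2 * (th3 y ^+ m * dd y ^+ 2).
Proof.
by move=> y0; rewrite /G1R (proj1 (NR_nome y0)) (proj1 (TR_nome y0)) DR_nome.
Qed.

Let dual1 y : 0 < y -> G1R (nome y^-1) = Num.sqrt y ^+ n * G1R (nome y).
Proof.
move=> y0; rewrite !G1R_nome ?yi// dualT// /dd th2_dual// th3_dual// th4_dual//.
rewrite !exprD !exprMn; move: (th3 y ^+ m) (Num.sqrt y ^+ m) (th2 y) (th3 y) (th4 y) (Num.sqrt y).
by move=> A1 A2 t2 t3 t4 s; field.
Qed.

Let dual3 y : 0 < y -> G1R (- nome y^-1) = Num.sqrt y ^+ n *
  (Sh y - th2 y ^+ n - 2 * n%:R * (th2 y ^+ (m + 8) * ((th4 y * th3 y) ^+ 4 / 16)) -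
   a2 * (th2 y ^+ m * ((th4 y * th3 y) ^+ 4 / 16) ^+ 2)).
Proof.
move=> y0; rewrite /G1R (proj2 (NR_nome (yi y0))) (proj2 (TR_nome (yi y0))) DR_nomeN ?yi//.
rewrite dualS// th2_dual// th3_dual// th4_dual//.
rewrite !exprD !exprMn; move: (th2 y ^+ m) (Num.sqrt y ^+ m) (th2 y) (th3 y) (th4 y) (Num.sqrt y).
by move=> A1 A2 t2 t3 t4 s; field.
Qed.

Let cG3_nome y : 0 < y -> (quarter y)%:C%C ^+ m * cG3 (nome y)%:C%C =
  (Sh y - th2 y ^+ n - 2 * n%:R * (th2 y ^+ (m + 8) * ((th4 y * th3 y) ^+ 4 / 16)) -
   a2 * (th2 y ^+ m * ((th4 y * th3 y) ^+ 4 / 16) ^+ 2))%:C%C.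
Proof.
move=> y0; have h1 := nome1 y0.
rewrite /cG3 /cU cPE// rcN !cTE ?normrN// (proj1 (TR_nome y0)) (proj2 (TR_nome y0)).
rewrite [(nome y)%:C%C ^+ 2]rcX vF ?sq01// !rcE; congr (_%:C%C).
rewrite ShE// shadow_class th2P// -/(quarter y) -/(nome y).
move: (F (nome y ^+ 2)) (PR (nome y)) => f P; rewrite -quarter4.
rewrite !(exprD _ m) !(exprMn m).
move: (P ^+ m) (quarter y ^+ m) (quarter y) (th3 y) (th4 y) => A1 A2 p t3 t4.
by field.
Qed.

Let jT : jet TR 1 2 0 0.
Proof.
have h1 : jet (fun x => isqser (x ^+ 4)) 1 0 0 0.
  rewrite -(fcoef_isq0 R); apply: jet2_flat (fser_jet summ_isq) _ => x hx.
  by rewrite lexx (exprM x 2 2) sqr_ge0.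
have h2 : jet (fun x => itriser (x ^+ 8)) 2 0 0 0.
  apply: jet_eq (jet2_flat (g := fun x => x ^+ 8) (fser_jet summ_itri) _)
    (@fcoef_itri R 0 isT) erefl erefl erefl => x hx.
  have h4 : 0 <= x ^+ 4 by rewrite (exprM x 2 2) sqr_ge0.
  rewrite (exprM x 4 2) sqr_ge0/= expr2 ler_piMl// -[x ^+ 4]ger0_norm// normrX exprn_ile1//; lra.
by apply: (jet_eq (jetD h1 (jetM jet_id h2))); ring.
Qed.

Let jTN : jet (fun x => TR (- x)) 1 (- 2) 0 0.
Proof. by apply: (jet_eq (jetN jT)); rewrite ?oppr0. Qed.

Let jN : jet NR 1 0 K2 N3.
Proof.
by apply: (jet_eq (jetD (jet2_square jE) (jetM jet_id (jet2_square jO)))); ring.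
Qed.

Let jH : jet HR 1 0 1 0.
Proof.
have h : jet PR 2 0 2 0.
  exact: jet_eq (jet2_square (fser_jet summ_itri)) (@fcoef_itri R 0 isT) erefl (@fcoef_itri R 1 isT) erefl.
by apply: (jet_eq (jetZ (1 / 2) h)); field.
Qed.

(** From D = q (1 + q^2 + ...)^4 (1 - 2q + ...)^4. *)
Let jD : jet DR 0 1 (- 8) 28.
Proof.
have h2 := jetM jH jH; have h4 := jetM h2 h2.
have h := jetM jet_id (jetM h4 (jetX 4 jTN)).
apply: jet_ext (jet_eq h _ _ _ _) => [x _||||]; try by field.
by rewrite /DR -!expr2 -exprM.
Qed.

(** The q^3 coefficient of G1. Those of 1 and q cancel by themselves, that of q^2 by the choice of
    a2. *)
Let cubic := N3 - 8 * (n%:R * (n%:R - 1) * (n%:R - 2)) / 6 +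
  2 * n%:R * (28 - 16 * (n%:R - 8) + 2 * ((n%:R - 8) * (n%:R - 9))) -
  a2 * (2 * (n%:R - 16) - 16).

Let jG : jet G1R 0 0 0 cubic.
Proof.
have h := jetD (jetD (jetD jN (jetZ (-1) (jetX n jT))) (jetZ (2 * n%:R) (jetM (jetX (m + 8) jT) jD)))
  (jetZ (- a2) (jetM (jetX m jT) (jetM jD jD))).
apply: jet_ext (jet_eq h _ _ _ _) => [x _||||].
- by rewrite /G1R mulN1r mulNr.
- by ring.
- by rewrite !natrD; field.
- by rewrite /a2 !natrD; field.
- by rewrite /cubic !natrD; field.
Qed.

Let G1R0 x : 0 < x < 1 -> G1R x = 0.
Proof.
move=> hx; have nx : `|x| < 1 by case/andP: hx => h0 h1; rewrite ger0_norm// ltW.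
have [B B0 hB] := jet_cubic jG.
have n1623 : (16 <= n <= 23)%N by move: m7; clear; lia.
have d0 : (0 : R) < 1 / 2 by lra.
have := modular_vanishing (G1 := cG1) (G3 := cG3) (B := B) n1623 acG1 acG3 d0 _ _ _ cG3_even hx.
rewrite cG1E// => h; apply: (@complexI R); apply: h => [u /andP[_ u2]|y y0|y y0].
- by rewrite cG1E ?normc_real ?hB ?ltW//; lra.
- rewrite nomeV -/(nome y) !cG1E ?nome1 ?yi// dual1// !rcE; congr (_%:C%C).
  by rewrite exprMn sqr_sqrtn.
- rewrite nomeV -/(nome y) -/(quarter y) addnK cG3_nome// rcN cG1E ?normrN ?nome1 ?yi// dual3// !rcE.
  by congr (_%:C%C); rewrite exprMn sqr_sqrtn.
Qed.

Lemma theta_formula y : 0 < y -> Ev y + Od y = th3 y ^+ n -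
  2 * n%:R * (th3 y ^+ (m + 8) * ((th2 y * th4 y) ^+ 4 / 16)) +
  (2 * n%:R * (n%:R - 23) + K2) * (th3 y ^+ m * ((th2 y * th4 y) ^+ 4 / 16) ^+ 2).
Proof.
move=> y0; have : G1R (nome y) = 0.
  by apply: G1R0; rewrite nome0 expR_lt1 oppr_lt0 mulr_gt0// pi_gt0.
by rewrite G1R_nome// /dd /a2; lra.
Qed.

(** G1 vanishes identically, hence so does its q^3 coefficient: the number of vectors of norm 3 is
    determined by that of norm 2. *)
Lemma cubic_coefficient : N3 = 8 * (n%:R * (n%:R - 1) * (n%:R - 2)) / 6 -
  2 * n%:R * (28 - 16 * (n%:R - 8) + 2 * ((n%:R - 8) * (n%:R - 9))) +
  (2 * n%:R * (n%:R - 23) + K2) * (2 * (n%:R - 16) - 16).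
Proof. by have := jet_vanish3 jG G1R0; rewrite /cubic /a2; lra. Qed.

End ModularIdentity.

(** * A bound on the number of roots *)

Lemma sum_indicator_le1 (R : realType) (I : finType) (P Q : pred I) :
  (forall j k, P j -> P k -> Q j -> Q k -> j = k) -> \sum_(j | P j) (Q j)%:R <= 1 :> R.
Proof.
move=> h; case: (pickP (fun j => P j && Q j)) => [j /andP[Pj Qj]|h0].
  rewrite (bigD1 j)//= Qj big1 ?addr0// => k /andP[Pk kj].
  by case: (boolP (Q k)) => // Qk; rewrite (h k j) ?eqxx in kj.
by rewrite big1// => j Pj; have := h0 j; rewrite Pj /= => ->.
Qed.

Section FrameInequality.
Context {R : realType} {n : nat}.
Implicit Types (x y : 'rV[R]_n).

Lemma dotp_cauchy_schwarz x y : dotp x y ^+ 2 <= sqnorm x * sqnorm y.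
Proof.
have := @cauchy_schwarz_sum R _ xpredT (fun i => x 0 i) (fun i => y 0 i).
by rewrite /sqnorm /dotp; under [X in _ <= X * _]eq_bigr do rewrite expr2;
  under [X in _ <= _ * X]eq_bigr do rewrite expr2.
Qed.

(* With M the sum of the rank-one matrices v_i^T v_i: tr(M)^2 <= n tr(M^2). *)
Lemma frame_inequality (I : finType) (P : pred I) (v : I -> 'rV[R]_n) :
  (\sum_(i | P i) sqnorm (v i)) ^+ 2 <= n%:R * \sum_(i | P i) \sum_(j | P j) dotp (v i) (v j) ^+ 2.
Proof.
pose M (k l : 'I_n) := \sum_(i | P i) v i 0 k * v i 0 l.
have -> : \sum_(i | P i) \sum_(j | P j) dotp (v i) (v j) ^+ 2 = \sum_k \sum_l M k l ^+ 2.
  transitivity (\sum_(i | P i) \sum_(j | P j) \sum_k \sum_l (v i 0 k * v i 0 l) * (v j 0 k * v j 0 l)).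
    apply: eq_bigr => i _; apply: eq_bigr => j _; rewrite expr2 /dotp mulr_suml; apply: eq_bigr => k _.
    by rewrite mulr_sumr; apply: eq_bigr => l _; ring.
  under eq_bigr do rewrite exchange_big/=; rewrite exchange_big/=; apply: eq_bigr => k _.
  under eq_bigr do rewrite exchange_big/=; rewrite exchange_big/=; apply: eq_bigr => l _.
  by rewrite expr2 /M mulr_suml; apply: eq_bigr => i _; rewrite mulr_sumr.
have -> : \sum_(i | P i) sqnorm (v i) = \sum_k M k k by rewrite exchange_big.
have := @cauchy_schwarz_sum R _ xpredT (fun=> 1) (fun k => M k k).
under eq_bigr do rewrite mul1r.
under [X in _ <= X * _]eq_bigr do rewrite expr1n.
rewrite sumr_const card_ord => h; apply: le_trans h _.
rewrite ler_wpM2l//; apply: ler_sum => k _; rewrite (bigD1 k)//= lerDl.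
by apply: sumr_ge0 => l _; rewrite sqr_ge0.
Qed.

(** The Gram matrix I + b J has the inverse I - b/(1 + k b) J, so the v_i are independent. *)
Lemma gram_card k (v : 'I_k -> 'rV[R]_n) (b : R) : 0 <= b ->
  (forall i j, dotp (v i) (v j) = (i == j)%:R + b) -> (k <= n)%N.
Proof.
move=> b0 h; pose A := \matrix_i v i; pose J : 'M[R]_k := const_mx 1.
have AA : A *m A^T = 1%:M + b *: J.
  apply/matrixP => i j; rewrite !mxE mulr1 -h.
  by apply: eq_bigr => l _; rewrite !mxE.
have JJ : J *m J = k%:R *: J.
  apply/matrixP => i j; rewrite !mxE mulr1 (eq_bigr (fun=> 1)) => [|l _]; last by rewrite !mxE mulr1.
  by rewrite sumr_const card_ord.
have kb : 1 + k%:R * b != 0 by rewrite gt_eqF// ltr_pwDl// mulr_ge0.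
have inv : (A *m A^T) *m (1%:M - (b / (1 + k%:R * b)) *: J) = 1%:M.
  rewrite AA mulmxBr mulmx1 mulmxDl mul1mx -scalemxAl -!scalemxAr JJ !scalerA.
  rewrite -addrA -scalerDl -scalerBl (_ : b - _ = 0) ?scale0r ?addr0//.
  by field.
have := mulmx1_unit inv => -[u _].
have := mxrankM_maxl A A^T; rewrite mxrank_unit// => /leq_trans; apply.
exact: rank_leq_col.
Qed.

End FrameInequality.

(** * Inner products of roots, common neighbours and their number *)

Section Roots.
Context {R : realType} {n : nat} (L : set 'rV[R]_n).
Hypothesis LD : L = dual L.
Implicit Types (r s t u v : 'rV[R]_n).

Definition root v := L v /\ sqnorm v = 2.

Lemma rootN v : root v -> root (- v).
Proof. by move=> [h1 h2]; split; [exact: dualN|rewrite sqnormN]. Qed.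

Lemma root_dot r s : root r -> root s ->
  [\/ r = s, dotp r s = 1, dotp r s = 0 | dotp r s = -1 \/ r = - s].
Proof.
move=> [Lr r2] [Ls s2]; have /intrP[m hm] := dual_int LD Lr Ls.
have h1 := sqnorm_ge0 (r - s); have h2 := sqnorm_ge0 (r + s).
have e1 := sqnormB r s; have e2 := sqnormD r s.
rewrite r2 s2 hm in e1 e2.
have m2 : m <= 2 by rewrite -(ler_int R); lra.
have mN2 : - 2 <= m by rewrite -(ler_int R); lra.
have : m = 2 \/ m = 1 \/ m = 0 \/ m = -1 \/ m = -2 by move: m2 mN2; clear; lia.
case=> [e|[e|[e|[e|e]]]]; rewrite hm e.
- constructor 1; apply/eqP; rewrite -subr_eq0 -sqnorm_eq0 e1 e; apply/eqP; lra.
- by constructor 2.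
- by constructor 3.
- by constructor 4; left.
- by constructor 4; right; apply/eqP; rewrite -subr_eq0 opprK -sqnorm_eq0 e2 e; apply/eqP; lra.
Qed.

Section Indexed.
Variables (I : finType) (rt : I -> 'rV[R]_n) (ix : 'rV[R]_n -> I).
Hypothesis rt_inj : injective rt.
Hypothesis rtR : forall i, root (rt i).
Hypothesis ixK : forall v, root v -> rt (ix v) = v.

Section Pair.
Variables (r s0 : 'rV[R]_n).
Hypothesis Rr : root r.
Hypothesis Rs0 : root s0.
Hypothesis rs0 : dotp r s0 = 1.

Definition tset : {set I} := [set j | (dotp r (rt j) == 1) && (dotp s0 (rt j) == 1)]%SET.

Definition tvec v := [/\ root v, dotp r v = 1 & dotp s0 v = 1].

Lemma tsetP j : j \in tset -> tvec (rt j).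
Proof. by rewrite inE => /andP[/eqP h1 /eqP h2]; split. Qed.

(** If s.t = -1, then s + t is a root with product 2 against both r and s0, hence equal to both,
    contrary to r.s0 = 1; and s = -t contradicts r.s = r.t = 1. *)
Lemma tvec_dot s t : tvec s -> tvec t -> [\/ s = t, dotp s t = 1 | dotp s t = 0].
Proof.
move=> [Rs s1 s2] [Rt t1 t2].
have [->|h|h|[h|e]] := root_dot Rs Rt; [by constructor 1|by constructor 2|by constructor 3| |]; exfalso.
- have Rst : root (s + t).
    by split; [apply: dualD => //; [case: Rs|case: Rt]|rewrite sqnormD h (proj2 Rs) (proj2 Rt); lra].
  have e1 : dotp r (s + t) = 2 by rewrite dotpDr; lra.
  have e2 : dotp s0 (s + t) = 2 by rewrite dotpDr; lra.
  have [e|h'|h'|[h'|e]] := root_dot Rr Rst; try lra.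
    by move: e2; rewrite -e dotpC rs0; lra.
  have := sqnorm_ge0 (r + (s + t)); rewrite e dotpNl in e1.
  by have := proj2 Rst; rewrite /sqnorm; lra.
- by move: s1; rewrite e dotpNr; lra.
Qed.

Lemma tvec_card_clique : {in tset &, forall i j, i != j -> dotp (rt i) (rt j) = 1} ->
  (#|tset| <= n)%N.
Proof.
move=> h; apply: (@gram_card R n #|tset| (fun k => rt (enum_val k)) 1) => // k l.
have [->|kl] := eqVneq k l; first by rewrite -/(sqnorm _) (proj2 (rtR _)).
by rewrite add0r h ?enum_valP// (inj_eq enum_val_inj).
Qed.

Section Triad.
Variables (a b c : 'rV[R]_n).
Hypothesis Ta : tvec a.
Hypothesis Tb : tvec b.
Hypothesis Tc : tvec c.
Hypothesis abc : a + b + c = r + s0.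

(** When a, b, c are mutually orthogonal common neighbours with sum r + s0, every other common
    neighbour has product 2 with that sum, so it is orthogonal to exactly one of the three. *)
Definition wset : {set I} := [set j in tset | [&& dotp a (rt j) == 0, dotp b (rt j) == 1 & dotp c (rt j) == 1]]%SET.

Let g := r + s0 - a.
(** g has norm 4 and product 2 with each w in [wset], so 2w - g is orthogonal to g, and two such
    vectors have product 4 (w.w' - 1), that is 4, 0 or -4. *)
Let d j := 2 *: rt j - g.

Let nr : sqnorm r = 2. Proof. by case: Rr. Qed.
Let ns : sqnorm s0 = 2. Proof. by case: Rs0. Qed.

Let gg : sqnorm g = 4.
Proof.
have [[_ a2] a3 a4] := Ta.
by rewrite /g sqnormB sqnormD nr ns a2 rs0 dotpDl a3 a4; lra.
Qed.

Let gw j : j \in wset -> dotp g (rt j) = 2.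
Proof.
rewrite inE => /andP[/tsetP[_ h1 h2] /and3P[/eqP h3 _ _]].
by rewrite /g dotpBl dotpDl h1 h2 h3; lra.
Qed.

Let dexp (G u v : 'rV[R]_n) : dotp (2 *: u - G) (2 *: v - G) =
  4 * dotp u v - 2 * dotp G u - 2 * dotp G v + sqnorm G.
Proof. by rewrite !dotpBl !dotpBr !dotpZl !dotpZr (dotpC u G) /sqnorm; ring. Qed.

Let dd i j : i \in wset -> j \in wset -> dotp (d i) (d j) = 4 * (dotp (rt i) (rt j) - 1).
Proof.
by move=> wi wj; rewrite /d dexp !gw// gg; lra.
Qed.

Let wt j : j \in wset -> tvec (rt j).
Proof. by rewrite inE => /andP[/tsetP]. Qed.

(** The only candidate orthogonal to w is g - w. *)
Let orth_unique i j k : i \in wset -> j \in wset -> k \in wset ->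
  dotp (rt i) (rt j) = 0 -> dotp (rt i) (rt k) = 0 -> j = k.
Proof.
move=> wi wj wk ij ik; apply: rt_inj.
have Rg : root (g - rt i).
  split; last by rewrite sqnormB gg gw// (proj2 (rtR i)); lra.
  have [La Lr Ls Li] : [/\ L a, L r, L s0 & L (rt i)] by case: Ta => -[? _] _ _; split => //; [case: Rr|case: Rs0|case: (rtR i)].
  by apply: dualB => //; apply: dualB => //; apply: dualD.
have k2 l : l \in wset -> dotp (rt i) (rt l) = 0 -> rt l = g - rt i.
  move=> wl il; apply/eqP; rewrite -subr_eq0 -sqnorm_eq0 sqnormB (proj2 Rg) (proj2 (rtR l)).
  by rewrite dotpBr (dotpC _ g) (dotpC _ (rt i)) gw// il; apply/eqP; lra.
by rewrite (k2 j)// (k2 k).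
Qed.

Let row_abs i : i \in wset -> \sum_(j in wset) `|dotp (d i) (d j)| <= 8.
Proof.
move=> wi; rewrite (bigD1 i)//= dd// -/(sqnorm _) (proj2 (rtR i)).
have z j : (j \in wset) && (j != i) -> `|dotp (d i) (d j)| = (dotp (rt i) (rt j) == 0)%:R * 4.
  move=> /andP[wj ji]; rewrite dd//.
  have [e|->|->] := tvec_dot (wt wi) (wt wj).
  - by rewrite (rt_inj e) eqxx in ji.
  - by rewrite subrr mulr0 normr0 oner_eq0 mul0r.
  - by rewrite eqxx sub0r mulrN1 normrN mul1r ger0_norm.
rewrite (eq_bigr _ z) -mulr_suml.
have : \sum_(j | (j \in wset) && (j != i)) (dotp (rt i) (rt j) == 0)%:R <= 1 :> R.
  apply: sum_indicator_le1 => j k /andP[wj _] /andP[wk _] /eqP hj /eqP hk.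
  exact: (orth_unique wi wj wk).
by rewrite ger0_norm; lra.
Qed.

Let row_sqr i : i \in wset -> \sum_(j in wset) dotp (d i) (d j) ^+ 2 <= 32.
Proof.
move=> wi; have h : forall j, j \in wset -> dotp (d i) (d j) ^+ 2 <= 4 * `|dotp (d i) (d j)|.
  move=> j wj; rewrite dd//.
  have [e|->|->] := tvec_dot (wt wi) (wt wj).
  - by rewrite e -/(sqnorm _) (proj2 (rtR j)) ger0_norm; lra.
  - by rewrite subrr mulr0 normr0 expr0n mulr0.
  - by rewrite sub0r mulrN1 normrN ger0_norm; lra.
apply: le_trans (ler_sum _ h) _; rewrite -mulr_sumr.
by have := row_abs wi; lra.
Qed.

(** For q vectors d_j of norm 4 with row sums of squares at most 32, the frame inequality reads
    (4q)^2 <= 32 n q. *)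
Lemma wset_card : (#|wset| <= 2 * n)%N.
Proof.
have := frame_inequality (mem wset) d.
have e i : i \in wset -> sqnorm (d i) = 4.
  by move=> wi; rewrite /sqnorm dd// -/(sqnorm _) (proj2 (rtR i)); lra.
rewrite (eq_bigr (fun=> 4)) => [|i wi]; last exact: e.
rewrite sumr_const => h.
have h2 : \sum_(i in wset) \sum_(j in wset) dotp (d i) (d j) ^+ 2 <= 32 *+ #|wset|.
  by rewrite -sumr_const; apply: ler_sum => i wi; exact: row_sqr.
have [->//|w0] := posnP #|wset|.
have w0R : (0 : R) < #|wset|%:R by rewrite ltr0n.
rewrite -(ler_nat R) natrM -(ler_pM2l w0R).
have n0 : (0 : R) <= n%:R by [].
have h3 := le_trans h (ler_wpM2l n0 h2).
move: h3; rewrite -[4 *+ _]mulr_natr -[32 *+ _]mulr_natr; move: (#|wset|%:R : R) (n%:R : R) => q N; nra.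
Qed.

(** y has product 1 or -1 with each of the q vectors d_j. For v, the sum of (y.d_j) d_j, this gives
    y.v = q and v.v <= 8q by [row_abs]; Cauchy-Schwarz yields q^2 <= 16 q. *)
Lemma wset_card16 y : root y -> dotp a y = 1 -> dotp b y = 0 -> dotp c y = 1 ->
  tvec y -> (#|wset| <= 16)%N.
Proof.
move=> Ry ay by0 cy Ty.
have gy : dotp g y = 1 by case: Ty => _ h1 h2; rewrite /g dotpBl dotpDl h1 h2 ay; lra.
have x1 j : j \in wset -> dotp y (d j) ^+ 2 = 1.
  move=> wj; rewrite /d dotpBr dotpZr (dotpC y g) gy.
  have [e|->|->] := tvec_dot Ty (wt wj); try ring.
  by move: wj; rewrite inE => /andP[_ /and3P[_ /eqP h _]]; rewrite -e in h; lra.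
pose v := \sum_(j in wset) dotp y (d j) *: d j.
have yv : dotp y v = #|wset|%:R.
  rewrite dotp_sumr (eq_bigr (fun=> 1)) => [|j wj]; last by rewrite dotpZr -expr2 x1.
  by rewrite sumr_const.
have nx j : j \in wset -> `|dotp y (d j)| = 1.
  by move=> /x1 h; apply/eqP; rewrite -sqrp_eq1// -normrX h normr1.
have vv : sqnorm v <= 8 *+ #|wset|.
  rewrite /sqnorm {1}/v dotp_suml -sumr_const; apply: ler_sum => i wi.
  rewrite dotpZl /v dotp_sumr mulr_sumr; apply: le_trans (row_abs wi).
  apply: ler_sum => j wj; rewrite dotpZr; apply: le_trans (ler_norm _) _.
  by rewrite !normrM !nx// !mul1r.
have := dotp_cauchy_schwarz y v; rewrite yv (proj2 Ry) => h.
have [->//|w0] := posnP #|wset|.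
have w0R : (0 : R) < #|wset|%:R by rewrite ltr0n.
rewrite -(ler_nat R) -(ler_pM2l w0R).
by move: vv h; rewrite -[8 *+ _]mulr_natr; move: (#|wset|%:R : R) (sqnorm v) => q N; nra.
Qed.

End Triad.

Lemma tvec_third a b : tvec a -> tvec b -> dotp a b = 0 -> tvec (r + s0 - (a + b)).
Proof.
move=> [Ra a1 a2] [Rb b1 b2] ab; have nr := proj2 Rr; have ns := proj2 Rs0.
split; last 2 first.
- by rewrite dotpBr !dotpDr -/(sqnorm r) nr rs0 a1 b1; lra.
- by rewrite dotpBr !dotpDr -/(sqnorm s0) ns (dotpC s0 r) rs0 a2 b2; lra.
split; first by apply: dualB => //; apply: dualD => //; [case: Rr|case: Rs0|case: Ra|case: Rb].
rewrite sqnormB !sqnormD nr ns (proj2 Ra) (proj2 Rb) ab rs0 dotpDl !dotpDr a1 a2 b1 b2; lra.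
Qed.

Lemma wset_pair a b c i : tvec a -> tvec b -> tvec c -> a + b + c = r + s0 ->
  i \in wset b a c -> (#|wset a b c| <= 16)%N.
Proof.
move=> Ta Tb Tc abc; rewrite inE => /andP[/tsetP Ti /and3P[/eqP h1 /eqP h2 /eqP h3]].
by apply: (@wset_card16 a b c Ta (rt i)) => //; case: Ti.
Qed.

(** Without an orthogonal pair there are at most n common neighbours by [tvec_card_clique].
    Otherwise they form a triad and three sets [wset]: a single nonempty one has at most 2n
    elements, and if several are nonempty each has at most 16. The total is at most max(2n + 3, 51),
    below 107 - 2n for n <= 23. *)
Lemma tset_card : (n <= 23)%N -> (#|tset| + 2 * n <= 107)%N.
Proof.
move=> n23.
have [h|] := boolP [forall i in tset, forall j in tset, (i != j) ==> (dotp (rt i) (rt j) == 1)].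
  have /tvec_card_clique : {in tset &, forall i j, i != j -> dotp (rt i) (rt j) = 1}.
    move=> i j ti tj ij; move/forall_inP: h => /(_ i ti)/forall_inP/(_ j tj).
    by rewrite ij => /eqP.
  by move: n23; clear; lia.
rewrite negb_forall_in => /exists_inP[i ti]; rewrite negb_forall_in => /exists_inP[j tj].
rewrite negb_imply => /andP[ij dij].
have Ta := tsetP ti; have Tb := tsetP tj.
have ab : dotp (rt i) (rt j) = 0.
  have [e|e|//] := tvec_dot Ta Tb; first by rewrite (rt_inj e) eqxx in ij.
  by rewrite e eqxx in dij.
set a := rt i in Ta ab *; set b := rt j in Tb ab *.
pose c := r + s0 - (a + b); have Tc : tvec c by exact: tvec_third.
have abc : a + b + c = r + s0 by rewrite /c addrC subrK.
have bac : b + a + c = r + s0 by rewrite (addrC b).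
have cab : c + a + b = r + s0 by rewrite -addrA addrC.
pose k : I := ix c; have kc : rt k = c by apply: ixK; case: Tc.
have cover : tset \subset [set i; j; k]%SET :|: (wset a b c :|: (wset b a c :|: wset c a b)).
  apply/fintype.subsetP => l tl; rewrite !finset.in_setU !finset.in_set1.
  have Tl := tsetP tl; have [Rl l1 l2] := Tl.
  have sum : dotp a (rt l) + dotp b (rt l) + dotp c (rt l) = 2.
    by rewrite -!dotpDl abc dotpDl l1 l2; lra.
  have [e|ha|ha] := tvec_dot Ta Tl; first by rewrite (rt_inj e) eqxx.
    have [e|hb|hb] := tvec_dot Tb Tl; first by rewrite (rt_inj e) eqxx !orbT.
      have [e|hc|hc] := tvec_dot Tc Tl; first by rewrite -kc in e; rewrite (rt_inj e) eqxx !orbT.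
        by lra.
      by apply/orP; right; apply/orP; right; apply/orP; right; rewrite inE tl ha hb hc !eqxx.
    have [e|hc|hc] := tvec_dot Tc Tl; first by rewrite -kc in e; rewrite (rt_inj e) eqxx !orbT.
      by apply/orP; right; apply/orP; right; apply/orP; left; rewrite inE tl ha hb hc !eqxx.
    by lra.
  have [e|hb|hb] := tvec_dot Tb Tl; first by rewrite (rt_inj e) eqxx !orbT.
    have [e|hc|hc] := tvec_dot Tc Tl; first by rewrite -kc in e; rewrite (rt_inj e) eqxx !orbT.
      by apply/orP; right; apply/orP; left; rewrite inE tl ha hb hc !eqxx.
    by lra.
  have [e|hc|hc] := tvec_dot Tc Tl; first by rewrite -kc in e; rewrite (rt_inj e) eqxx !orbT.
    by lra.
  by lra.
have c3 : (#|[set i; j; k]%SET| <= 3)%N.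
  apply: leq_trans (leq_card_setU _ _) _; rewrite cards1 addn1 ltnS.
  by apply: leq_trans (leq_card_setU _ _) _; rewrite !cards1.
have := subset_leq_card cover.
have := (leq_card_setU [set i; j; k]%SET (wset a b c :|: (wset b a c :|: wset c a b))).1.
have := (leq_card_setU (wset a b c) (wset b a c :|: wset c a b)).1.
have := (leq_card_setU (wset b a c) (wset c a b)).1.
have sw x y z : wset x y z = wset x z y.
  by apply/setP => l; rewrite !inE; congr (_ && _); rewrite andbA andbAC -andbA.
have A1 := @wset_card a b c Ta; have B1 := @wset_card b a c Tb; have C1 := @wset_card c a b Tc.
have [e1|[x1 hx1]] := set_0Vmem (wset a b c); have [e2|[x2 hx2]] := set_0Vmem (wset b a c);
  have [e3|[x3 hx3]] := set_0Vmem (wset c a b); rewrite ?e1 ?e2 ?e3 ?cards0 in A1 B1 C1 *.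
- by move: c3 n23; clear; lia.
- by move: c3 n23 C1; clear; lia.
- by move: c3 n23 B1; clear; lia.
- have B2 : (#|wset b a c| <= 16)%N.
    by rewrite sw; apply: (@wset_pair b c a x3) => //; rewrite ?[wset c b a]sw// addrAC.
  have C2 : (#|wset c a b| <= 16)%N by rewrite sw; apply: (@wset_pair c b a x2) => //; rewrite ?[wset b c a]sw// addrAC.
  by move: c3 n23 B2 C2; clear; lia.
- by move: c3 n23 A1; clear; lia.
- have A2 : (#|wset a b c| <= 16)%N by rewrite sw; apply: (@wset_pair a c b x3) => //; rewrite addrAC.
  have C2 : (#|wset c a b| <= 16)%N by apply: (@wset_pair c a b x1) => //; rewrite sw.
  by move: c3 n23 A2 C2; clear; lia.
- have A2 : (#|wset a b c| <= 16)%N by apply: (@wset_pair a b c x2).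
  have B2 : (#|wset b a c| <= 16)%N by apply: (@wset_pair b a c x1).
  by move: c3 n23 A2 B2; clear; lia.
- have A2 : (#|wset a b c| <= 16)%N by apply: (@wset_pair a b c x2).
  have B2 : (#|wset b a c| <= 16)%N by apply: (@wset_pair b a c x1).
  have C2 : (#|wset c a b| <= 16)%N by apply: (@wset_pair c a b x1) => //; rewrite sw.
  by move: c3 n23 A2 B2 C2; clear; lia.
Qed.

End Pair.

(** v -> r - v preserves the neighbours of r and sends those orthogonal to s0 to common neighbours
    of r and s0. A product -1 with s0 occurs only for r - s0. This leaves 2 + 2 (107 - 2n). *)
Lemma neighbours_card i : (n <= 23)%N ->
  (#|[set j | dotp (rt i) (rt j) == 1%R]%SET| + 4 * n <= 216)%N.
Proof.
move=> n23; set S := [set j | _]%SET; have Rr := rtR i.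
have [->|[j0 hj0]] := set_0Vmem S; first by rewrite cards0; lia.
have hS j : j \in S -> dotp (rt i) (rt j) = 1 by rewrite inE => /eqP.
have rs0 := hS _ hj0; set r := rt i in Rr rs0 hS *; set s0 := rt j0 in rs0 *.
have Rs0 : root s0 by exact: rtR.
have Rd v : root v -> dotp r v = 1 -> root (r - v).
  move=> [Lv v2] rv; split; first by apply: dualB => //; case: Rr.
  by rewrite sqnormB (proj2 Rr) v2 rv; lra.
pose T0 : {set I} := [set j in S | dotp s0 (rt j) == 0]%SET.
pose j1 := ix (r - s0); have hj1 : rt j1 = r - s0 by apply: ixK; exact: Rd.
have cover : S \subset [set j0; j1]%SET :|: (tset r s0 :|: T0).
  apply/fintype.subsetP => j jS; rewrite !finset.in_setU !finset.in_set1.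
  have rj := hS j jS.
  have [e|e|e|[e|e]] := root_dot Rs0 (rtR j).
  - by rewrite (rt_inj e) eqxx.
  - by apply/orP; right; apply/orP; left; rewrite inE rj e !eqxx.
  - by apply/orP; right; apply/orP; right; rewrite inE jS e eqxx.
  - apply/orP; left; apply/orP; right; apply/eqP; apply: rt_inj; rewrite hj1.
    apply/eqP; rewrite -subr_eq0 -sqnorm_eq0 opprB addrA sqnormB sqnormD.
    by rewrite dotpDl (proj2 (rtR j)) (proj2 Rs0) (proj2 Rr) (dotpC (rt j)) e (dotpC (rt j)) rj dotpC rs0; apply/eqP; lra.
  - by exfalso; move: rs0; rewrite e dotpNr rj; lra.
have T0T : (#|T0| <= #|tset r s0|)%N.
  pose h j := ix (r - rt j).
  have hK j : j \in T0 -> rt (h j) = r - rt j.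
    by rewrite inE => /andP[jS _]; apply: ixK; apply: Rd => //; exact: hS.
  rewrite -(@card_in_imset _ _ h T0).
    apply: subset_leq_card; apply/fintype.subsetP => _ /imsetP[j jT ->].
    rewrite inE hK//; move: jT; rewrite inE => /andP[/hS rj /eqP sj].
    by rewrite !dotpBr rj sj -/(sqnorm r) (proj2 Rr) (dotpC s0) rs0; apply/andP; split; apply/eqP; lra.
  move=> j k jT kT e; have := congr1 rt e; rewrite !hK// => /(congr1 (fun v => r - v)).
  by rewrite !subKr => /rt_inj.
have := tset_card Rr Rs0 rs0 n23.
have := subset_leq_card cover.
have := (leq_card_setU [set j0; j1]%SET (tset r s0 :|: T0)).1.
have := (leq_card_setU (tset r s0) T0).1.
have : (#|[set j0; j1]%SET| <= 2)%N by apply: leq_trans (leq_card_setU _ _) _; rewrite !cards1.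
by move: T0T n23; clear; lia.
Qed.

(** With q the number of roots, the frame inequality reads (2q)^2 <= n q (440 - 8n). The resulting
    bound is equivalent to a2 <= 64 n, just what the monotonicity of the quadratic asks for. *)
Lemma roots_card : (n <= 23)%N -> (#|I|%:R : R) <= 2 * n%:R * (55 - n%:R).
Proof.
move=> n23.
have row i : \sum_j dotp (rt i) (rt j) ^+ 2 <= 440 - 8 * n%:R.
  have nu j : exists k, rt k = - rt j by exists (ix (- rt j)); apply: ixK; exact: rootN.
  have /choice[neg hneg] := nu.
  have neg_inj : injective neg by move=> j k e; apply: rt_inj; apply: oppr_inj; rewrite -!hneg e.
  (* The square is 4 for the root and its negative, 1 for neighbours and their negatives; the second
     half of the bound is the first at -rt j and is reindexed below. *)
  have h j : dotp (rt i) (rt j) ^+ 2 <= 4 * (rt j == rt i)%:R + (dotp (rt i) (rt j) == 1)%:R +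
      (4 * (rt (neg j) == rt i)%:R + (dotp (rt i) (rt (neg j)) == 1)%:R).
    have p (x : bool) : (0 : R) <= x%:R by [].
    have := p (rt j == rt i); have := p (dotp (rt i) (rt j) == 1).
    have := p (rt (neg j) == rt i); have := p (dotp (rt i) (rt (neg j)) == 1).
    rewrite hneg; have [e|e|e|[e|e]] := root_dot (rtR i) (rtR j).
    - have -> : dotp (rt i) (rt j) = 2 by rewrite -e -/(sqnorm _) (proj2 (rtR i)).
      by rewrite e eqxx /=; lra.
    - by rewrite e eqxx /=; lra.
    - by rewrite e; lra.
    - by rewrite dotpNr e opprK eqxx /=; lra.
    - have -> : dotp (rt i) (rt j) = - sqnorm (rt j) by rewrite e dotpNl.
      by rewrite -e eqxx (proj2 (rtR j)) /=; lra.
  apply: le_trans (ler_sum _ (fun j _ => h j)) _.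
  pose F j : R := 4 * (rt j == rt i)%:R + (dotp (rt i) (rt j) == 1)%:R.
  have eF : \sum_j F (neg j) = \sum_j F j by rewrite [RHS](reindex_inj neg_inj).
  rewrite big_split/= -/(\sum_j F j) [X in _ + X](eq_bigr (fun j => F (neg j)))// eF.
  rewrite /F big_split/= -mulr_sumr.
  have h1 : \sum_j (rt j == rt i)%:R <= 1 :> R.
    by apply: sum_indicator_le1 => j k _ _ /eqP hj /eqP hk; apply: rt_inj; rewrite hj.
  have h2 : \sum_j (dotp (rt i) (rt j) == 1)%:R = #|[set j | dotp (rt i) (rt j) == 1]%SET|%:R :> R.
    rewrite -sum1_card natr_sum [RHS]big_mkcond/=; apply: eq_bigr => j _.
    by rewrite inE; case: eqP.
  have := neighbours_card i n23; rewrite h2 -(ler_nat R) natrD natrM; lra.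
have := frame_inequality xpredT rt.
under eq_bigr do rewrite (proj2 (rtR _)).
rewrite sumr_const => h.
have h2 : \sum_i \sum_j dotp (rt i) (rt j) ^+ 2 <= (440 - 8 * n%:R) *+ #|I|.
  by rewrite -sumr_const; apply: ler_sum => i _; exact: row.
have n23R : n%:R <= 23 :> R by rewrite ler_nat.
have n0 : (0 : R) <= n%:R by [].
have [->|w0] := posnP #|I|; first by rewrite mulr_ge0//; lra.
have w0R : (0 : R) < #|I|%:R by rewrite ltr0n.
have h3 := le_trans h (ler_wpM2l n0 h2).
rewrite -(ler_pM2l w0R); move: h3; rewrite -[2 *+ _]mulr_natr -[_ *+ #|I|]mulr_natr.
by move: (#|I|%:R : R) (n%:R : R) => q N; nra.
Qed.

End Indexed.
End Roots.

(** * The secrecy gain *)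

Section LatticeSeries.
Context {R : realType} {n : nat}.
Implicit Types (v x : 'rV[R]_n) (y t : R) (S L : set 'rV[R]_n).

(** The exponent of q^2: on the even part, the odd part and the shadow the norm is 2 [half_norm] +
    rho with rho = 0, 1 and k1/4. *)
Definition half_norm v : nat := Num.truncn (sqnorm v / 2).

Lemma half_normP v (j : int) (rho : R) : 0 <= rho < 2 -> sqnorm v = 2 * j%:~R + rho ->
  sqnorm v = 2 * (half_norm v)%:R + rho.
Proof.
move=> /andP[r0 r2] e; have v0 := sqnorm_ge0 v.
have h2 : 0 <= sqnorm v / 2 by rewrite divr_ge0.
have /andP[t1 t2] := truncn_itv h2; rewrite -/(half_norm v) in t1 t2.
rewrite -[(half_norm v).+1%:R]natr1 in t2; rewrite e; congr (2 * _ + _).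
rewrite [RHS]pmulrn; congr (_ %:~R); apply/eqP; rewrite eq_le.
have l1 : j < (half_norm v)%:Z + 1 by rewrite -(ltr_int R) intrD /=; lra.
have l2 : (half_norm v)%:Z < j + 1 by rewrite -(ltr_int R) intrD /=; lra.
by apply/andP; split; lia.
Qed.

Lemma gsum_fser S rho : (forall v, S v -> sqnorm v = 2 * (half_norm v)%:R + rho) ->
  (forall y, 0 < y -> summ S (fun v => expR (- (pi * y * sqnorm v)) : R)) ->
  (forall q : R, 0 < q < 1 -> summ S (fun v => q ^+ half_norm v)) /\
  forall y, 0 < y -> gsum S y = expR (- (pi * y * rho)) * fser S half_norm (expR (- (pi * y)) ^+ 2).
Proof.
move=> hS sS.
have key y : 0 < y -> summ S (fun v => (expR (- (pi * y)) ^+ 2) ^+ half_norm v) /\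
    gsum S y = expR (- (pi * y * rho)) * fser S half_norm (expR (- (pi * y)) ^+ 2).
  move=> y0; have e v : S v -> expR (pi * y * rho) * expR (- (pi * y * sqnorm v)) =
      (expR (- (pi * y)) ^+ 2) ^+ half_norm v.
    by move=> Sv; rewrite -exprM -expRM_natr -expRD (hS v Sv) natrM; congr expR; ring.
  have [s1 s2] := summZ (fun v => expR_ge0 _) (expR_ge0 (pi * y * rho)) (sS y y0).
  rewrite (eq_summ e) in s1; rewrite (eq_rsum e) in s2; split => //.
  by rewrite /fser s2 mulrA -expRD addNr expR0 mul1r.
split => [q /nome_ex[y y0 ->]|y y0]; last exact: (proj2 (key y y0)).
have y2 : 0 < y / 2 by rewrite divr_gt0.
have [+ _] := key _ y2; rewrite -expRM_natr.
by rewrite (_ : - (pi * (y / 2)) * 2%:R = - (pi * y)) //; field.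
Qed.

Lemma summ1_finite (T : choiceType) (A : set T) : summ A (fun=> 1 : R) -> finite_set A.
Proof.
move=> sA; apply: contrapT => /infinite_set_fset iA.
have [X XA hX] := iA (Num.truncn (rsum A (fun=> 1 : R))).+1.
have := rsum_fset_le (fun=> ler01) sA XA.
rewrite big_const_seq count_predT iter_addr_0 => h.
have h0 : 0 <= rsum A (fun=> 1 : R) by apply: rsum_ge0 => _; exact: ler01.
have /andP[_ t2] := truncn_itv h0.
have := lt_le_trans t2 (le_trans _ h); rewrite ler_nat => /(_ hX).
by rewrite ltxx.
Qed.

Lemma rsum1_card (T : choiceType) (A : set T) : finite_set A ->
  rsum A (fun=> 1 : R) = #|` fset_set A|%:R.
Proof.
move=> fA; rewrite -{1}(fset_setK fA).
have [_ ->] := @rsum_fset R T (fun=> 1) (fset_set A) (fun=> ler01).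
by rewrite big_const_seq count_predT iter_addr_0.
Qed.

End LatticeSeries.

Section Kissing.
Context {R : realType} {n : nat} (L : set 'rV[R]_n).
Hypothesis LD : L = dual L.

Lemma finite_roots_card : (n <= 23)%N -> finite_set [set v | root L v] ->
  #|` fset_set [set v | root L v]|%:R <= 2 * n%:R * (55 - n%:R) :> R.
Proof.
move=> n23 fA; set X := fset_set _.
have XP v : (v \in X) = `[< root L v >] by rewrite in_fset_set//; apply/idP/asboolP => [/set_mem//|h]; exact: mem_set.
have [e|[x0 x0X]] := fset_0Vmem X.
  have n23R : n%:R <= 23 :> R by rewrite ler_nat.
  by rewrite e cardfs0 mulr_ge0// ?mulr_ge0//; lra.
rewrite cardfE; apply: (@roots_card R n L LD X val (insubd [` x0X]%fset)) => //.
- by move=> i; apply/asboolP; rewrite -XP; exact: valP.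
- by move=> v hv; rewrite insubdK// unfold_in XP; apply/asboolP.
Qed.

End Kissing.

(** * Kissing number, minimum of the theta quotient, secrecy gain *)

Section Extremality.
Context {R : realType} (m : nat) (L : set 'rV[R]_(m + 16)).
Local Notation n := (m + 16)%N.
Hypothesis m7 : (m <= 7)%N.
Hypothesis UL : unimodular L.
Hypothesis nonextremal : ~ extremal L.
Hypothesis norm1 : forall x, L x -> sqnorm x <> 1.
Let LD : L = dual L. Proof. by case: UL. Qed.

Let E : R -> R := fser (even_part L) half_norm.
Let O : R -> R := fser (odd_part L) half_norm.
Let K2 : R := fcoef (even_part L) half_norm 1.
Let N3 : R := fcoef (odd_part L) half_norm 1.

Let evenP v : even_part L v -> sqnorm v = 2 * (half_norm v)%:R + 0.
Proof.
move=> [_ /intrP[j hj]]; apply: (half_normP (j := j)); first by rewrite lexx ltr0n.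
by rewrite addr0 -hj; field.
Qed.

Let oddP v : odd_part L v -> sqnorm v = 2 * (half_norm v)%:R + 1.
Proof.
move=> [Lv od]; have /intrP[j hj] := sqnorm_int LD Lv.
have [h0|h0] : (j %% 2)%Z = 0 \/ (j %% 2)%Z = 1 by lia.
  exfalso; move: od; rewrite hj (divz_eq j 2) h0 addr0 rmorphM/= mulfK// intr_int.
  by [].
apply: (half_normP (j := (j %/ 2)%Z)); first by rewrite ler01 ltr1n.
by rewrite hj {1}(divz_eq j 2) h0 rmorphD rmorphM/=; ring.
Qed.

Let evenL : even_part L `<=` L. Proof. by move=> v []. Qed.
Let oddL : odd_part L `<=` L. Proof. by move=> v []. Qed.

Let sL y : 0 < y -> summ L (fun v => expR (- (pi * y * sqnorm v)) : R).
Proof. exact: summ_lattice. Qed.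

Let sEv y : 0 < y -> summ (even_part L) (fun v => expR (- (pi * y * sqnorm v)) : R).
Proof. by move=> y0; apply: summ_sub evenL (sL y0) => v; exact: expR_ge0. Qed.

Let sOd y : 0 < y -> summ (odd_part L) (fun v => expR (- (pi * y * sqnorm v)) : R).
Proof. by move=> y0; apply: summ_sub oddL (sL y0) => v; exact: expR_ge0. Qed.

Let gsum_parity y : 0 < y -> gsum L y = gsum (even_part L) y + gsum (odd_part L) y.
Proof.
move=> y0; have dis : even_part L `&` odd_part L = set0.
  by apply/seteqP; split => v // -[[_ h1] [_ /negP]].
rewrite /gsum -(proj2 (rsum_setU (fun v => expR_ge0 _) dis (sEv y0) (sOd y0))).
congr rsum; apply/seteqP; split => v; last by case=> -[].
by move=> Lv; have [h|h] := boolP (sqnorm v / 2 \is a Num.int); [left|right].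
Qed.

Let even_fiber j : [set v | even_part L v /\ half_norm v = j] = [set v | L v /\ sqnorm v = (2 * j)%:R].
Proof.
apply/seteqP; split => v /=.
  by move=> [ev e]; split; [exact: evenL|rewrite (evenP ev) e natrM addr0].
move=> [Lv e]; have ev : even_part L v.
  by split => //; rewrite e natrM mulrC mulKf// natr_int.
split => //; have := evenP ev; rewrite e natrM addr0 => /mulfI h.
by have := h (lt0r_neq0 (ltr0Sn _ 1)) => /eqP; rewrite eqr_nat => /eqP.
Qed.

Let odd_fiber j : [set v | odd_part L v /\ half_norm v = j] = [set v | L v /\ sqnorm v = (2 * j + 1)%:R].
Proof.
apply/seteqP; split => v /=.
  by move=> [ev e]; split; [exact: oddL|rewrite (oddP ev) e natrD natrM].
move=> [Lv e]; have ev : odd_part L v.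
  split => //; apply/negP => h; have := evenP (conj Lv h); rewrite addr0 e -natrM => /eqP.
  by rewrite eqr_nat; move: (half_norm v) => k; lia.
split => //; have := oddP ev; rewrite e natrD natrM => /addIr /mulfI h.
by have := h (lt0r_neq0 (ltr0Sn _ 1)) => /eqP; rewrite eqr_nat => /eqP.
Qed.

Let coef_even0 : fcoef (even_part L) half_norm 0 = 1 :> R.
Proof.
rewrite /fcoef even_fiber (_ : [set v | _] = [set 0]); first by have [_ ->] := @rsum_set1 R _ (0 : 'rV[R]_n) (fun=> 1) (fun=> ler01).
apply/seteqP; split => v /=; first by move=> [_ /eqP]; rewrite sqnorm_eq0 => /eqP.
by move=> ->; split; [exact: dual0|exact: dotp0l].
Qed.

Let coef_odd0 : fcoef (odd_part L) half_norm 0 = 0 :> R.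
Proof.
rewrite /fcoef odd_fiber (_ : [set v | _] = set0); first by rewrite /rsum esum_set0.
by apply/seteqP; split => v //= [Lv e]; apply: (norm1 Lv); rewrite e.
Qed.

Lemma lattice_theta_formula : (forall y, 0 < y -> gsum L y = th3 y ^+ n -
    2 * n%:R * (th3 y ^+ (m + 8) * ((th2 y * th4 y) ^+ 4 / 16)) +
    (2 * n%:R * (n%:R - 23) + K2) * (th3 y ^+ m * ((th2 y * th4 y) ^+ 4 / 16) ^+ 2)) /\
  N3 = 8 * (n%:R * (n%:R - 1) * (n%:R - 2)) / 6 -
    2 * n%:R * (28 - 16 * (n%:R - 8) + 2 * ((n%:R - 8) * (n%:R - 9))) +
    (2 * n%:R * (n%:R - 23) + K2) * (2 * (n%:R - 16) - 16).
Proof.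
have [[B Bu LB] _] := UL.
have [w Lw hw] := characteristic_vector LD Bu LB.
have [k0 hk0] := sqnorm_nat LD Lw.
(* w/2 has norm k0/4, and shadow norms agree with it modulo 2, so only k0 mod 8 matters. *)
pose k1 := (k0 %% 8)%N.
have k17 : (k1 <= 7)%N by rewrite -ltnS ltn_pmod.
have shP v : shadow L w v -> sqnorm v = 2 * (half_norm v)%:R + k1%:R / 4.
  rewrite /shadow /translate/= => Ll; set l := v - _ in Ll.
  have e : v = l + 2^-1 *: w by rewrite subrK.
  have /intrP[j1 h1] := hw l Ll; have /intrP[j2 h2] := sqnorm_int LD Ll.
  apply: (half_normP (j := j1 + j2 + (k0 %/ 8)%N%:Z)).
    have k17R : k1%:R <= 7 :> R by rewrite ler_nat.
    have k10R : 0 <= k1%:R :> R by [].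
    by apply/andP; split; lra.
  have ek : k0%:R = 8 * (k0 %/ 8)%N%:R + k1%:R :> R by rewrite {1}(divn_eq k0 8) natrD natrM mulrC.
  by rewrite e sqnormD sqnormZ dotpZr hk0 (dotpC l) ek !intrD -h1 -h2; field.
have sSh y : 0 < y -> summ (shadow L w) (fun v => expR (- (pi * y * sqnorm v)) : R).
  exact: summ_shadow.
have [s1 g1] := gsum_fser evenP sEv; have [s2 g2] := gsum_fser oddP sOd.
have [s3 g3] := gsum_fser shP sSh.
have [cE aE vE] := fser_analytic s1; have [cO aO vO] := fser_analytic s2.
have [cF aF vF] := fser_analytic s3.
have [cT1 aT1 vT1] := fser_analytic (@summ_isq R); have [cPsi aPsi vPsi] := fser_analytic (@summ_itri R).
have EvE y : 0 < y -> gsum (even_part L) y = E (expR (- (pi * y)) ^+ 2).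
  by move=> y0; rewrite g1// mulr0 oppr0 expR0 mul1r.
have OdE y : 0 < y -> gsum (odd_part L) y = expR (- (pi * y)) * O (expR (- (pi * y)) ^+ 2).
  by move=> y0; rewrite g2// mulr1.
have ShE y : 0 < y -> gsum (shadow L w) y = expR (- (pi / 4 * y)) ^+ k1 *
    fser (shadow L w) half_norm (expR (- (pi * y)) ^+ 2).
  by move=> y0; rewrite g3// -[expR (- (pi / 4 * y)) ^+ k1]expRM_natr; congr (expR _ * _); field.
have Sh0 y : 0 < y -> 0 < gsum (shadow L w) y.
  move=> y0; have h := @rsum_fset_le R _ (shadow L w) _ [fset 2^-1 *: w]%fset (fun v => expR_ge0 _) (sSh y y0).
  apply: lt_le_trans (h _); first by rewrite big_seq_fset1 expR_gt0.
  by move=> v; rewrite /= inE => /eqP ->; rewrite /shadow/translate/= subrr; exact: dual0.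
have dualT y : 0 < y -> gsum (even_part L) y^-1 + gsum (odd_part L) y^-1 =
    Num.sqrt y ^+ n * (gsum (even_part L) y + gsum (odd_part L) y).
  by move=> y0; rewrite -!gsum_parity ?invr_gt0// theta_duality.
have dualS y : 0 < y -> gsum (even_part L) y^-1 - gsum (odd_part L) y^-1 =
    Num.sqrt y ^+ n * gsum (shadow L w) y.
  by move=> y0; rewrite shadow_duality.
have jE : jet2 E 1 K2 by rewrite -coef_even0; exact: fser_jet.
have jO : jet2 O 0 N3 by rewrite -coef_odd0; exact: fser_jet.
split.
  move=> y y0; rewrite gsum_parity//.
  by apply: (theta_formula m7 k17 EvE OdE ShE Sh0 dualT dualS aT1 aPsi aE aO aF vT1 vPsi vE vO vF jE jO).
by apply: (cubic_coefficient m7 k17 EvE OdE ShE Sh0 dualT dualS aT1 aPsi aE aO aF vT1 vPsi vE vO vF jE jO).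
Qed.

Let K2_roots : finite_set [set v | root L v] /\ K2 = #|` fset_set [set v | root L v]|%:R.
Proof.
have e : [set v | even_part L v /\ half_norm v = 1%N] = [set v | root L v] by rewrite even_fiber.
have [s1 _] := gsum_fser evenP sEv.
have f : finite_set [set v | root L v].
  by rewrite -e; apply: (@summ1_finite R); exact: (summ_fiber s1).
by split => //; rewrite /K2 /fcoef e rsum1_card.
Qed.

Let norm_ge2 v : L v -> v != 0 -> 2 <= sqnorm v.
Proof.
move=> Lv v0; have [k hk] := sqnorm_nat LD Lv.
case: k hk => [|[|k]] hk; last by rewrite hk ler_nat.
  by move: v0; rewrite -sqnorm_eq0 hk eqxx.
by exfalso; exact: (norm1 Lv).
Qed.

Lemma root_exists : exists v, root L v.
Proof.
apply: contrapT => h; apply: nonextremal.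
have [_ eN] := lattice_theta_formula; have [_ eK] := K2_roots.
have nr : [set v | root L v] = set0 by apply/seteqP; split => v // Rv; apply: h; exists v.
rewrite nr fset_set0 cardfs0 in eK.
have N3pos : 0 < N3.
  rewrite eN eK; have : (0 : R) <= m%:R by []; have : m%:R <= 7 :> R by rewrite ler_nat.
  have -> : n%:R = m%:R + 16 :> R by rewrite natrD.
  by move: (m%:R : R) => u u7 u0; nra.
have [v [Lv ev]] : exists v, L v /\ sqnorm v = (2 * 1 + 1)%:R.
  apply: contrapT => h3; move: N3pos; rewrite /N3 /fcoef odd_fiber (_ : [set v | _] = set0).
    by rewrite /rsum esum_set0 ltxx.
  by apply/seteqP; split => v // hv; apply: h3; exists v.
have n8 : (n %/ 8).+1 = 3 by rewrite divnD// (divn_small (m := m))//; move: m7; clear; lia.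
exists v; last by rewrite ev n8.
split => //; first by rewrite -sqnorm_eq0 ev pnatr_eq0.
move=> u Lu u0; have [k hk] := sqnorm_nat LD Lu.
have := norm_ge2 Lu u0; rewrite ev hk !ler_nat leq_eqVlt => /orP[/eqP e|//].
by exfalso; apply: h; exists u; split => //; rewrite hk -e.
Qed.

Lemma kissing_number_roots : (kissing_number L)%:R = K2.
Proof.
have [_ ->] := K2_roots; rewrite /kissing_number; congr (#|` fset_set _|%:R).
have [r [Lr r2]] := root_exists.
have r0 : r != 0 by rewrite -sqnorm_eq0 r2 pnatr_eq0.
apply/seteqP; split => v.
  move=> [Lv v0 hv]; split => //; apply/eqP; rewrite eq_le norm_ge2// andbT -r2.
  exact: hv.
move=> [Lv v2]; split => //; first by rewrite -sqnorm_eq0 v2 pnatr_eq0.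
by move=> u Lu u0; rewrite v2; exact: norm_ge2.
Qed.

Lemma kissing_number_le : (kissing_number L)%:R <= 2 * n%:R * (55 - n%:R) :> R.
Proof.
have [f e] := K2_roots; rewrite kissing_number_roots e.
by apply: finite_roots_card => //; move: m7; clear; lia.
Qed.

Let ratio y := (th2 y * th4 y) ^+ 4 / 16 / th3 y ^+ 8 : R.
Let a2 : R := 2 * n%:R * (n%:R - 23) + (kissing_number L)%:R.

Lemma theta_ratio y : 0 < y -> gsum L y / th3 y ^+ n = 1 - 2 * n%:R * ratio y + a2 * ratio y ^+ 2.
Proof.
move=> y0; have t3 := th3_gt0 y0.
have [h0 _] := lattice_theta_formula; rewrite (h0 _ y0) -kissing_number_roots -/a2 /ratio.
rewrite !(exprD _ m).
have t0 : th3 y != 0 by rewrite gt_eqF.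
have tm : th3 y ^+ m != 0 by rewrite expf_neq0.
by move: (th3 y) (th3 y ^+ m) (th2 y) (th4 y) t0 tm => T3 Tm T2 T4 h1 h2; field; rewrite h1 h2.
Qed.

(** The values of 1 - 2Nz + a z^2 at z and at 1/64 differ by (1/64 - z)(2N - a (z + 1/64)), and the
    second factor is nonnegative for 0 <= z <= 1/64 and a <= 64 N. *)
Lemma theta_ratio_min y : 0 < y -> gsum L 1 / th3 1 ^+ n <= gsum L y / th3 y ^+ n.
Proof.
move=> y0; rewrite !theta_ratio// /ratio jacobi_ratio1 -/(ratio y).
have z1 : ratio y <= 1 / 64 by exact: jacobi_ratio.
have z0 : 0 <= ratio y.
  by rewrite !divr_ge0 ?exprn_ge0// ?mulr_ge0 ?ltW ?th2_gt0 ?th4_gt0 ?th3_gt0.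
have aN : a2 <= 64 * n%:R by have := kissing_number_le; rewrite /a2; nra.
have n0 : (0 : R) <= n%:R by [].
move: (ratio y) a2 (n%:R : R) z0 z1 aN n0 => z a N z0 z1 aN n0.
have h1 : 0 <= (64 * N - a) * (z + 1 / 64) by rewrite mulr_ge0//; lra.
have h2 : 0 <= N * (1 / 64 - z) by rewrite mulr_ge0//; lra.
have h3 : 0 <= (1 / 64 - z) * (2 * N - a * (z + 1 / 64)) by rewrite mulr_ge0//; nra.
rewrite -subr_ge0 [X in 0 <= X](_ : _ = (1 / 64 - z) * (2 * N - a * (z + 1 / 64)))//.
by field.
Qed.

Lemma gsumE y : 0 < y -> theta L y = gsum L y.
Proof.
move=> y0; rewrite /theta /gsum /rsum; congr fine; apply: eq_esum => v _; congr (_%:E).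
by rewrite /nome -expRM; congr expR; ring.
Qed.

Lemma theta3E (y : R) : 0 < y -> theta3 y = th3 y.
Proof.
move=> y0; rewrite th3_series// /theta3 /rsum; congr fine; apply: eq_esum => k _; congr (_%:E).
have -> : k ^+ 2 = Posz (isq k) by rewrite /isq; lia.
by [].
Qed.

Lemma secrecy_functionE y : 0 < y -> 0 < gsum L y /\
  secrecy_function L y = (gsum L y / th3 y ^+ n)^-1.
Proof.
move=> y0; rewrite /secrecy_function gsumE// theta3E// invf_div; split => //.
by apply: (gsum_gt0 UL) => //; exact: sL.
Qed.

Lemma secrecy_function_max y : 0 < y -> secrecy_function L y <= secrecy_function L 1.
Proof.
move=> y0; have [g0 ->] := secrecy_functionE y0; have [g1 ->] := secrecy_functionE (@ltr01 R).
by rewrite lef_pV2 ?posrE ?divr_gt0 ?exprn_gt0 ?th3_gt0// theta_ratio_min.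
Qed.

Lemma secrecy_gainE : secrecy_gain L = 1 / (1 - (2 * n%:R) / 2 ^+ 6 +
  (2 * n%:R * (n%:R - 23) + (kissing_number L)%:R) / 2 ^+ 12).
Proof.
have -> : secrecy_gain L = secrecy_function L 1.
  apply/eqP; rewrite eq_le; apply/andP; split.
    apply: ge_sup; first by exists (secrecy_function L 1), 1 => //=; exact: ltr01.
    by move=> _ [y /= y0 <-]; exact: secrecy_function_max.
  apply: ub_le_sup; last by exists 1 => //=; exact: ltr01.
  by exists (secrecy_function L 1) => _ [y /= y0 <-]; exact: secrecy_function_max.
have [_ ->] := secrecy_functionE (@ltr01 R); rewrite theta_ratio ?ltr01// /ratio jacobi_ratio1 [RHS]div1r.
by congr (_^-1); rewrite /a2; field.
Qed.

End Extremality.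

Theorem mainTheorem3 (R : realType) (n : nat) (L : set 'rV[R]_n)
    (n_ge16 : (16 <= n)%N) (n_le23 : (n <= 23)%N)
    (L_unimodular : unimodular L)
    (L_nonextremal : ~ extremal L)
    (L_no_norm1 : forall x : 'rV[R]_n, L x -> sqnorm x <> 1) :
  (forall y : R, 0 < y -> secrecy_function L y <= secrecy_function L 1) /\
  secrecy_gain L =
    1 / (1 - (2 * n%:R) / 2 ^+ 6
           + (2 * n%:R * (n%:R - 23) + (kissing_number L)%:R) / 2 ^+ 12).
Proof.
(* This form keeps the exponents n - 8 and n - 16 free of truncated subtraction. *)
have [m nE] : exists m, n = (m + 16)%N by exists (n - 16)%N; rewrite subnK.
subst n; have m7 : (m <= 7)%N by move: n_le23; clear; lia.
split; first by move=> y; exact: secrecy_function_max.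
exact: secrecy_gainE.
Qed.
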